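(* Let $S^1=\{z\in\mathbb{C}:|z|=1\}$ and let $\lambda$ be the Haar probability measure (uniform distribution) on $S^1$. A probability measure $\mu\neq\lambda$ on $S^1$ is infinitely divisible for the boolean convolution if and only if there exist a real number $b\in[0,2\pi)$ and a finite (non-negative) measure $\rho$ on $S^1$ such that $$F_\mu(z)=\exp\big(u(z)\big)\quad\text{with}\quad u(z)=ib-\int_{S^1}\frac{x+z}{x-z}\,\mathrm{d}\rho(x)$$ for $|z|<1$. The pair $(b,\rho)$ (called the characteristic pair of $\mu$) is uniquely determined by $\mu$.
   Context: Boolean independence: for a Hilbert space $H$ and a normal state $\varphi$ on $\mathcal{B}(H)$, two operators $X,Y\in\mathcal{B}(H)$ are called boolean independent with respect to $\varphi$ if $$\varphi(X^{n_1}Y^{m_1}X^{n_2}\cdots X^{n_k}Y^{m_k})=\prod_{\ell=1}^k\varphi(X^{n_\ell})\varphi(Y^{m_\ell})$$ for all integers $k\ge 1$ and all integers $n_1,m_k\ge 0$ and $n_2,\ldots,n_k,m_1,\ldots,m_{k-1}\ge 1$. Distribution: for a unitary $U\in\mathcal{B}(H)$, its distribution $\mathcal{L}_\varphi(U)$ in the state $\varphi$ is the unique probability measure $\mu$ on $S^1$ with $\varphi(U^k)=\int_{S^1}x^k\,\mathrm{d}\mu(x)$ for all $k\in\mathbb{N}$. Boolean convolution (the notation $\boxtimes_b$ replaces the paper's symbol): for probability measures $\mu,\nu$ on $S^1$, $\mu\boxtimes_b\nu=\mathcal{L}_\varphi(UV)$, where $U,V\in\mathcal{B}(H)$ are unitary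 operators with $\mathcal{L}_\varphi(U)=\mu$, $\mathcal{L}_\varphi(V)=\nu$ such that $U-1$ and $V-1$ are boolean independent with respect to $\varphi$. It is uniquely determined by $\mu$ and $\nu$ (it does not depend on the choice of $H,\varphi,U,V$). Infinite divisibility: a probability measure $\mu$ on $S^1$ is infinitely divisible for the boolean convolution if for every integer $n\ge 1$ there exists a probability measure $\mu_n$ on $S^1$ with $\mu=\mu_n\boxtimes_b\mu_n\boxtimes_b\cdots\boxtimes_b\mu_n$ ($n$ factors). Transforms: for a probability measure $\mu$ on $S^1$, $$\psi_\mu(z)=\int_{S^1}\frac{xz}{1-xz}\,\mathrm{d}\mu(x),\qquad F_\mu(z)=\frac{1}{z}\,\frac{\psi_\mu(z)}{1+\psi_\mu(z)},\qquad |z|<1,$$ where $F_\mu(0)$ is the value at $0$ of the unique analytic extension of $F_\mu$ from $\{0<|z|<1\}$ to $\{|z|<1\}$. *)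

(* Defs.v *)
(* The complex numbers are R[i] for R : realType; R[i]^o is the same type seen
   as a normed module over itself, which is how it gets its topology. *)
From HB Require Import structures.
From mathcomp Require Import all_boot all_order all_algebra.
From mathcomp Require Import complex.
From mathcomp Require Import all_classical all_reals all_analysis.

Set Implicit Arguments.
Unset Strict Implicit.
Unset Printing Implicit Defensive.

Import Order.TTheory GRing.Theory Num.Theory.
Import numFieldNormedType.Exports.

Local Open Scope classical_set_scope.
Local Open Scope complex_scope.
Local Open Scope ring_scope.

Section Circle.
Variable R : realType.

Definition unit_circle : set R[i]^o := [set z | `|z| = 1].

Definition circle : Type := set_type unit_circle.

HB.instance Definition _ := Topological.on circle.

Lemma cis_subproof (t : R) : (cos t +i* sin t : R[i]^o) \in unit_circle.
Proof. by rewrite inE /unit_circle /= normc_def /= cos2Dsin2 sqrtr1. Qed.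

Definition cis (t : R) : circle := SigSub (cis_subproof t).

HB.instance Definition _ := isPointed.Build circle (cis 0).

(* The circle with its Borel sigma-algebra. *)
Definition S1 : Type := g_sigma_algebraType (@open circle).

Definition cval (x : S1) : R[i] := set_val (x : circle).

Lemma continuous_cis : continuous cis.
Proof.
apply/(@continuous_comp_initial circle R R[i]^o set_val).
move=> t; apply/(@cvgrPdist_lt R[i] R[i]^o) => e e0.
have [r eR r0] : exists2 r : R, e = r%:C & 0 < r.
  case: e e0 => a b; rewrite ltcE /= => /andP[/eqP b0 a0].
  by exists a => //; rewrite b0.
have r20 : 0 < r / 2 by rewrite divr_gt0.
have /cvgrPdist_lt /(_ _ r20) Hc : cos x @[x --> t] --> cos t.
  exact: continuous_cos.
have /cvgrPdist_lt /(_ _ r20) Hs : sin x @[x --> t] --> sin t.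
  exact: continuous_sin.
near=> x.
have -> : (set_val \o cis) t - (set_val \o cis) x =
   (cos t - cos x)%:C + (0 +i* (sin t - sin x)) :> R[i].
  by apply/eqP; rewrite eq_complex /= addr0 add0r !eqxx.
apply: le_lt_trans (ler_normD _ _) _.
rewrite eR !normc_def /= expr0n /= addr0 add0r !sqrtr_sqr -rmorphD ltcR.
rewrite [r]splitr ltrD//.
- by near: x.
- by near: x.
Unshelve. all: by end_near. Qed.

Lemma measurable_cis : measurable_fun [set: measurableTypeR R] (cis : _ -> S1).
Proof.
have mcis := @measurability _ _ (measurableTypeR R) S1 setT cis _ erefl.
apply: mcis => // _ [B oB <-].
apply: measurableI => //; apply: measurable_realfun.open_measurable.
by move/continuousP : continuous_cis; apply.
Qed.

HB.instance Definition _ := isMeasurableFun.Build _ _ (measurableTypeR R) S1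
  (cis : measurableTypeR R -> S1) measurable_cis.

(* The image of the uniform distribution on [0, 2 * pi] under exp(it). *)
Definition haar : probability S1 R :=
  distribution (uniform_prob (mulr_gt0 (ltr0n R 2) (pi_gt0 R)))
    ((cis : measurableTypeR R -> S1) : {mfun measurableTypeR R >-> S1}).

(* Set functions are total, with arbitrary values off the sigma-algebra, so
   equality of measures is equality on measurable sets. *)
Definition eq_meas (m1 m2 : set S1 -> \bar R) : Prop :=
  forall A, measurable A -> m1 A = m2 A.

Definition cintegral (m : {measure set S1 -> \bar R}) (f : S1 -> R[i]) : R[i] :=
  (\int[m]_x complex.Re (f x)) +i* (\int[m]_x complex.Im (f x)).

Definition cexp (z : R[i]) : R[i] :=
  (expR (complex.Re z))%:C * (cos (complex.Im z) +i* sin (complex.Im z)).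

End Circle.

Arguments eq_meas {R} m1 m2.

Section BooleanConvolution.
Variable R : realType.

Record hilbertSpace := HilbertSpace {
  hilbert_sort :> completeNormedModType R[i] ;
  hdot : {dot hilbert_sort for Num.conj} ;
  hdot_norm : forall x, `|x| ^+ 2 = hdot x x }.

Section Operators.
Variable H : hilbertSpace.
Local Notation "<| x , y |>" := (hdot H x y).

Implicit Types S T U X Y : H -> H.

Definition BH : set (H -> H) :=
  [set T | linear T /\ exists M, forall x, `|T x| <= M * `|x|].

Definition is_adjoint T T' : Prop := forall x y, <| T x, y |> = <| x, T' y |>.

Definition unitary U : Prop :=
  BH U /\ exists2 U', BH U' & [/\ is_adjoint U U', U \o U' = id & U' \o U = id].

Definition BHsa : set (H -> H) := [set T | BH T /\ is_adjoint T T].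

Definition op_le S T : Prop := forall x, <| S x, x |> <= <| T x, x |>.

(* T is the least upper bound of D among the self-adjoint operators. *)
Definition op_lub (D : set (H -> H)) T : Prop :=
  [/\ BHsa T, forall S, D S -> op_le S T &
      forall U, BHsa U -> (forall S, D S -> op_le S U) -> op_le T U].

Definition op_directed (D : set (H -> H)) : Prop :=
  [/\ D !=set0, D `<=` BHsa &
      forall S T, D S -> D T -> exists U, [/\ D U, op_le S U & op_le T U]].

(* A functional on B(H); its values on other functions are irrelevant.  Normality
   is preservation of least upper bounds of increasing nets of self-adjoint
   operators, a net being replaced by its range, a directed set. *)
Record normal_state (phi : (H -> H) -> R[i]) : Prop := NormalState {
  state_linear : forall a S T, BH S -> BH T ->
    phi (fun x => a *: S x + T x) = a * phi S + phi T ;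
  state_positive : forall T, BH T -> (forall x, 0 <= <| T x, x |>) -> 0 <= phi T ;
  state_unital : phi id = 1 ;
  state_normal : forall (D : set (H -> H)) T, op_directed D -> op_lub D T ->
    supremums (phi @` D) (phi T) }.

(* X^(n 0) Y^(m 0) X^(n 1) Y^(m 1) ... X^(n k.-1) Y^(m k.-1) *)
Definition alternating_word X Y (k : nat) (n m : nat -> nat) : H -> H :=
  \big[(fun S T => S \o T)/id]_(0 <= l < k) (iter (n l) X \o iter (m l) Y).

Definition boolean_independent (phi : (H -> H) -> R[i]) X Y : Prop :=
  forall (k : nat) (n m : nat -> nat), (0 < k)%N ->
    (forall l, (0 < l < k)%N -> (0 < n l)%N) ->
    (forall l, (l.+1 < k)%N -> (0 < m l)%N) ->
    phi (alternating_word X Y k n m) =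
    \prod_(0 <= l < k) (phi (iter (n l) X) * phi (iter (m l) Y)).

Definition has_law (phi : (H -> H) -> R[i]) U (mu : probability (S1 R) R) : Prop :=
  forall k, phi (iter k U) = cintegral mu (fun x => cval x ^+ k).

End Operators.

(* The relation tau = mu boxtimes nu.  By uniqueness tau does not depend on the
   chosen realization (H, phi, U, V), so it is required for some realization. *)
Definition boolean_conv (mu nu tau : probability (S1 R) R) : Prop :=
  exists (H : hilbertSpace) (phi : (H -> H) -> R[i]) (U V : H -> H),
    [/\ normal_state phi, unitary U & unitary V] /\
    [/\ has_law phi U mu, has_law phi V nu,
        boolean_independent phi (fun x => U x - x) (fun x => V x - x) &
        has_law phi (U \o V) tau].

(* tau is the convolution of n factors nu, bracketed to the left. *)
Inductive boolean_power (nu : probability (S1 R) R) :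
    nat -> probability (S1 R) R -> Prop :=
| boolean_power1 (tau : probability (S1 R) R) : eq_meas tau nu -> boolean_power nu 1 tau
| boolean_powerS n (sigma tau : probability (S1 R) R) :
    boolean_power nu n sigma -> boolean_conv sigma nu tau ->
    boolean_power nu n.+1 tau.

Definition boolean_infdiv (mu : probability (S1 R) R) : Prop :=
  forall n, (0 < n)%N -> exists nu, boolean_power nu n mu.

End BooleanConvolution.

Section Transforms.
Variable R : realType.

Definition psi (mu : probability (S1 R) R) (z : R[i]) : R[i] :=
  cintegral mu (fun x => cval x * z / (1 - cval x * z)).

Definition F_punctured (mu : probability (S1 R) R) (z : R[i]) : R[i] :=
  z^-1 * (psi mu z / (1 + psi mu z)).

Definition analytic_on_disk (f : R[i]^o -> R[i]^o) : Prop :=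
  forall z, `|z| < 1 -> derivable f z 1.

(* The values at 0 of the analytic extensions of F_punctured mu. *)
Definition F_at0 (mu : probability (S1 R) R) : set R[i] :=
  [set w | exists G : R[i] -> R[i],
    [/\ analytic_on_disk G,
        forall z, 0 < `|z| < 1 -> G z = F_punctured mu z & G 0 = w]].

Definition F_transform (mu : probability (S1 R) R) (z : R[i]) : R[i] :=
  if z == 0 then xget 0 (F_at0 mu) else F_punctured mu z.

Definition char_exponent (b : R) (rho : {finite_measure set (S1 R) -> \bar R})
    (z : R[i]) : R[i] :=
  'i%C * b%:C - cintegral rho (fun x => (cval x + z) / (cval x - z)).

Definition characteristic_pair (mu : probability (S1 R) R) (b : R)
    (rho : {finite_measure set (S1 R) -> \bar R}) : Prop :=
  0 <= b < 2 * pi /\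
  forall z, `|z| < 1 -> F_transform mu z = cexp (char_exponent b rho z).

End Transforms.

(* Main.v *)
Require Import Defs.
From HB Require Import structures.
From mathcomp Require Import all_boot all_order all_algebra.
From mathcomp Require Import complex.
From mathcomp Require Import all_classical all_reals all_analysis.
From mathcomp Require Import measurable_realfun.
From mathcomp Require Import ring lra.

Set Implicit Arguments.
Unset Strict Implicit.
Unset Printing Implicit Defensive.

Import Order.TTheory GRing.Theory Num.Theory.
Import numFieldNormedType.Exports.

Local Open Scope classical_set_scope.
Local Open Scope complex_scope.
Local Open Scope ring_scope.

Local Notation Re := complex.Re.
Local Notation Im := complex.Im.

(* Boolean convolution multiplies the transforms F.  Every word in U - 1 and
   V - 1 is an alternating word, so the moments of UV depend on the two laws
   only and may be computed in one explicit model: the direct sum of C and of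
   the zero-mean parts of [L2 mu] and [L2 nu], where an explicit resolvent
   vector gives [\sum_k z^k phi((UV)^k) = (1 - z F_mu(z) F_nu(z))^-1].  The model
   is turned into a Hilbert space by orthonormalising Laurent monomials, which
   embeds it into the square-summable sequences.

   If mu is infinitely divisible then F_mu = F_n ^ n for transforms F_n.  Were
   F_mu(0) = 0, all F_n would vanish at 0, so |F_n| <= 1/2 near 0, F_mu would
   vanish near 0 and mu would be Haar.  Otherwise rotate F_n into the root G_n
   of F_mu with G_n(0) = exp(log F_mu(0) / n): the functions n (1 - G_n) have
   nonnegative real part and bounded value at 0, hence an ultralimit -u, with
   exp(u) = F_mu, and Herglotz's theorem represents -u.  Conversely, for t >= 0
   the function K = z exp(t u(z)) satisfies |K| <= |z|, so Herglotz's theorem for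
   (1 + K) / (1 - K) yields a law with transform exp(t u).  Uniqueness holds
   because |F_mu| = exp(Re u) determines Re u, hence the moments of rho. *)

(** * Complex moduli and limits *)

(** Analyticity is carried by [disk_approx], locally uniform approximation by polynomials. It passes
    through sums, products, inverses and exponentials by elementary estimates, and it suits
    Herglotz's theorem: the real part of a polynomial on a smaller circle, sampled at enough roots
    of unity, already has the right moments. Compactness comes from an ultrafilter on [nat], which
    gives limits of numbers, of Taylor coefficients and of quantile functions. Everything is linked
    by [res0], the generating function of the moments: for a law, [z * F = 1 - 1 / res0], so a
    bounded F, a function of positive real part and a measure are three forms of one datum. This
    relation is silent at [z = 0], where F is the first moment and is treated apart. The kernel of
    the characteristic exponent expands in powers of the conjugate of x, while [res0] expands in
    powers of x. Hence the reflection of h into the conjugate of h at the conjugate of z whenever a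
    Herglotz function becomes an exponent. Semi-definite forms are never divided by their null
    vectors: Gram-Schmidt turns these into zero coordinates. *)

Section ComplexModulus.
Variable R : realType.
Implicit Types (z w : R[i]).

Lemma ReD z w : Re (z + w) = Re z + Re w. Proof. by case: z; case: w. Qed.
Lemma ImD z w : Im (z + w) = Im z + Im w. Proof. by case: z; case: w. Qed.
Lemma ReN z : Re (- z) = - Re z. Proof. by case: z. Qed.
Lemma ImN z : Im (- z) = - Im z. Proof. by case: z. Qed.
Lemma ReB z w : Re (z - w) = Re z - Re w. Proof. by rewrite ReD ReN. Qed.
Lemma ImB z w : Im (z - w) = Im z - Im w. Proof. by rewrite ImD ImN. Qed.
Lemma ReM z w : Re (z * w) = Re z * Re w - Im z * Im w.
Proof. by case: z; case: w. Qed.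
Lemma ImM z w : Im (z * w) = Re z * Im w + Im z * Re w.
Proof. by case: z => a b; case: w => c d. Qed.
Lemma ReJ z : Re z^* = Re z. Proof. by case: z. Qed.
Lemma ImJ z : Im z^* = - Im z. Proof. by case: z. Qed.
Lemma Re_sum I (r : seq I) P (F : I -> R[i]) :
  Re (\sum_(i <- r | P i) F i) = \sum_(i <- r | P i) Re (F i).
Proof. by elim/big_ind2: _ => // x1 x2 y1 y2 <- <-; rewrite ReD. Qed.
Lemma Im_sum I (r : seq I) P (F : I -> R[i]) :
  Im (\sum_(i <- r | P i) F i) = \sum_(i <- r | P i) Im (F i).
Proof. by elim/big_ind2: _ => // x1 x2 y1 y2 <- <-; rewrite ImD. Qed.

Lemma complex_eq z w : Re z = Re w -> Im z = Im w -> z = w.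
Proof. by case: z => a b; case: w => c d /= -> ->. Qed.

Lemma conjCD z w : (z + w)^* = z^* + w^*. Proof. exact: rmorphD. Qed.
Lemma conjCB z w : (z - w)^* = z^* - w^*. Proof. exact: rmorphB. Qed.
Lemma conjCM z w : (z * w)^* = z^* * w^*. Proof. exact: rmorphM. Qed.
Lemma conjCX z n : (z ^+ n)^* = z^* ^+ n. Proof. exact: rmorphXn. Qed.
Lemma conjCR (x : R) : (x%:C)^* = x%:C :> R[i].
Proof. by apply: complex_eq; rewrite /= ?oppr0. Qed.
Lemma conjC_sum I (r : seq I) P (F : I -> R[i]) :
  (\sum_(i <- r | P i) F i)^* = \sum_(i <- r | P i) (F i)^*.
Proof. exact: rmorph_sum. Qed.

Definition cmod z : R := Num.sqrt (Re z ^+ 2 + Im z ^+ 2).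

Lemma normE z : `|z| = (cmod z)%:C. Proof. exact: normc_def. Qed.
Lemma cmod_ge0 z : 0 <= cmod z. Proof. exact: sqrtr_ge0. Qed.
Lemma cmod_sqr z : cmod z ^+ 2 = Re z ^+ 2 + Im z ^+ 2.
Proof. by rewrite sqr_sqrtr// addr_ge0// sqr_ge0. Qed.
Lemma cmod0 : cmod 0 = 0. Proof. by rewrite /cmod/= expr0n/= addr0 sqrtr0. Qed.
Lemma cmod1 : cmod 1 = 1.
Proof. by rewrite /cmod/= expr0n/= addr0 expr1n sqrtr1. Qed.
Lemma cmodM z w : cmod (z * w) = cmod z * cmod w.
Proof. by apply: complexI; rewrite rmorphM/= -!normE normrM. Qed.
Lemma cmodD z w : cmod (z + w) <= cmod z + cmod w.
Proof. by rewrite -lecR rmorphD/= -!normE ler_normD. Qed.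
Lemma cmodN z : cmod (- z) = cmod z.
Proof. by apply: complexI; rewrite -!normE normrN. Qed.
Lemma cmodB z w : cmod (z - w) <= cmod z + cmod w.
Proof. by rewrite -(cmodN w) cmodD. Qed.
Lemma cmodBC z w : cmod (z - w) = cmod (w - z).
Proof. by rewrite -cmodN opprB. Qed.
Lemma cmodX z n : cmod (z ^+ n) = cmod z ^+ n.
Proof. by apply: complexI; rewrite rmorphXn/= -!normE normrX. Qed.
Lemma cmodV z : cmod z^-1 = (cmod z)^-1.
Proof. by apply: complexI; rewrite fmorphV/= -!normE normfV. Qed.
Lemma cmodJ z : cmod z^* = cmod z.
Proof. by rewrite /cmod ReJ ImJ sqrrN. Qed.
Lemma cmod_eq0 z : (cmod z == 0) = (z == 0).
Proof. by rewrite -(inj_eq (@complexI R)) -normE normr_eq0. Qed.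
Lemma cmod_gt0 z : (0 < cmod z) = (z != 0).
Proof. by rewrite lt_def cmod_ge0 cmod_eq0 andbT. Qed.
Lemma cmodR (x : R) : cmod x%:C = `|x|.
Proof. by rewrite /cmod/= expr0n/= addr0 sqrtr_sqr. Qed.
Lemma cmod_nat n : cmod n%:R = n%:R.
Proof. by rewrite -[n%:R](rmorph_nat (real_complex R)) cmodR normr_nat. Qed.
Lemma Re_cmod z : `|Re z| <= cmod z.
Proof. by rewrite -sqrtr_sqr ler_wsqrtr// lerDl sqr_ge0. Qed.
Lemma Im_cmod z : `|Im z| <= cmod z.
Proof. by rewrite -sqrtr_sqr ler_wsqrtr// lerDr sqr_ge0. Qed.
Lemma Re_le_cmod z : Re z <= cmod z.
Proof. exact: le_trans (ler_norm _) (Re_cmod _). Qed.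

Lemma cmod_le z : cmod z <= `|Re z| + `|Im z|.
Proof.
have -> : z = (Re z)%:C + 'i%C * (Im z)%:C by exact: complexE.
apply: le_trans (cmodD _ _) _; rewrite cmodM !cmodR.
have -> : cmod 'i%C = 1 by rewrite /cmod/= expr0n/= add0r expr1n sqrtr1.
by rewrite mul1r -complexE.
Qed.
Lemma cmod_sum I (r : seq I) P (F : I -> R[i]) :
  cmod (\sum_(i <- r | P i) F i) <= \sum_(i <- r | P i) cmod (F i).
Proof.
elim/big_ind2: _ => //; first by rewrite cmod0.
by move=> x1 x2 y1 y2 h1 h2; apply: le_trans (cmodD _ _) _; exact: lerD.
Qed.
Lemma cmodB_dist z w : cmod z - cmod w <= cmod (z - w).
Proof. by rewrite lerBlDr -{1}(subrK w z) cmodD. Qed.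
Lemma cmod_dist z w : `|cmod z - cmod w| <= cmod (z - w).
Proof. by rewrite ler_norml cmodB_dist andbT lerNl opprB cmodBC cmodB_dist. Qed.
Lemma mulcJ z : z * z^* = (cmod z ^+ 2)%:C.
Proof. by rewrite -sqr_normc normE rmorphXn. Qed.
Lemma norm_lt1 z : (`|z| < 1) = (cmod z < 1).
Proof. by rewrite normE -[1]/(1%:C) ltcR. Qed.
Lemma norm_gt0 z : (0 < `|z|) = (z != 0).
Proof. exact: normr_gt0. Qed.
Lemma cval_cmod (x : S1 R) : cmod (cval x) = 1.
Proof.
have /= := set_valP (x : circle R); rewrite /unit_circle/= => h.
by apply: complexI; rewrite -normE.
Qed.
Lemma cvalJ (x : S1 R) : cval x * (cval x)^* = 1.
Proof. by rewrite mulcJ cval_cmod expr1n. Qed.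
Lemma cval_neq0 (x : S1 R) : cval x != 0.
Proof. by rewrite -cmod_gt0 cval_cmod. Qed.
Lemma cvalXJ (x : S1 R) k : cval x ^+ k * ((cval x)^*) ^+ k = 1.
Proof. by rewrite -exprMn cvalJ expr1n. Qed.
Lemma one_sub_ge z : 1 - cmod z <= cmod (1 - z).
Proof. by rewrite -{1}cmod1 cmodB_dist. Qed.
Lemma one_sub_neq0 z : cmod z < 1 -> 1 - z != 0.
Proof.
by move=> h; rewrite -cmod_gt0 (lt_le_trans _ (one_sub_ge z))// subr_gt0.
Qed.
Lemma ger0_Re z : 0 <= z -> z = (Re z)%:C /\ 0 <= Re z.
Proof. by case: z => a b; rewrite lecE/= => /andP[/eqP -> ->]. Qed.

Section Limits.
Context (T : Type) (F : set_system T) {FF : ProperFilter F}.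
Implicit Types (u v : T -> R[i]).

(** Convergence of the two real coordinates along an arbitrary filter: the same calculus then serves
    sequences, ultrafilters, Cauchy filters and the tails of an operator net. *)
Definition clim (G : set_system T) u (l : R[i]) :=
  (Re (u t) @[t --> G] --> Re l) /\ (Im (u t) @[t --> G] --> Im l).

Lemma climP u l : clim F u l <-> cmod (u t - l) @[t --> F] --> (0 : R).
Proof.
split => [[hr hi]|h].
  apply: (@squeeze_cvgr _ _ _ _ (fun=> 0)
    (fun t => `|Re (u t) - Re l| + `|Im (u t) - Im l|)).
  - apply: nearW => t; rewrite cmod_ge0/=; apply: le_trans (cmod_le _) _.
    by rewrite ReB ImB.
  - exact: cvg_cst.
  - have key (f : T -> R) l0 : f t @[t --> F] --> l0 ->
        `|f t - l0| @[t --> F] --> (0 : R).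
      move=> h; have -> : 0 = `|l0 - l0| :> R by rewrite subrr normr0.
      by apply: cvg_norm; apply: cvgB => //; exact: cvg_cst.
    by rewrite -[X in _ --> X]addr0; apply: cvgD; exact: key.
split; apply/cvgrPdist_lt => e e0; near=> t;
  have : cmod (u t - l) < e by near: t; exact: (cvgr_lt _ h).
- by apply: le_lt_trans; rewrite distrC -ReB Re_cmod.
- by apply: le_lt_trans; rewrite distrC -ImB Im_cmod.
Unshelve. all: by end_near. Qed.

Lemma clim_unique u l l' : clim F u l -> clim F u l' -> l = l'.
Proof.
move=> [h1 h2] [k1 k2]; apply: complex_eq.
- exact: (cvg_unique _ h1 k1).
- exact: (cvg_unique _ h2 k2).
Qed.
Lemma clim_cst l : clim F (fun=> l) l. Proof. by split; exact: cvg_cst. Qed.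
Lemma climD u v a b : clim F u a -> clim F v b ->
  clim F (fun t => u t + v t) (a + b).
Proof.
move=> [h1 h2] [k1 k2]; split; rewrite (ReD, ImD).
- by under eq_fun do rewrite ReD; exact: cvgD.
- by under eq_fun do rewrite ImD; exact: cvgD.
Qed.
Lemma climN u a : clim F u a -> clim F (fun t => - u t) (- a).
Proof.
move=> [h1 h2]; split; rewrite (ReN, ImN).
- by under eq_fun do rewrite ReN; exact: cvgN.
- by under eq_fun do rewrite ImN; exact: cvgN.
Qed.
Lemma climB u v a b : clim F u a -> clim F v b ->
  clim F (fun t => u t - v t) (a - b).
Proof. by move=> h k; apply: climD => //; exact: climN. Qed.
Lemma climM u v a b : clim F u a -> clim F v b ->
  clim F (fun t => u t * v t) (a * b).
Proof.
move=> [h1 h2] [k1 k2]; split; rewrite (ReM, ImM).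
- by under eq_fun do rewrite ReM; apply: cvgB; exact: cvgM.
- by under eq_fun do rewrite ImM; apply: cvgD; exact: cvgM.
Qed.
Lemma climX u a k : clim F u a -> clim F (fun t => u t ^+ k) (a ^+ k).
Proof.
move=> h; elim: k => [|k IH].
  by rewrite expr0; under eq_fun do rewrite expr0; exact: clim_cst.
by rewrite exprS; under eq_fun do rewrite exprS; exact: climM.
Qed.
Lemma climR (x : T -> R) (a : R) : x t @[t --> F] --> a ->
  clim F (fun t => (x t)%:C) a%:C.
Proof. by move=> h; split=> //=; exact: cvg_cst. Qed.
Lemma climJ u a : clim F u a -> clim F (fun t => (u t)^*) a^*.
Proof.
move=> [h1 h2]; split; rewrite (ReJ, ImJ).
- by under eq_fun do rewrite ReJ.
- by under eq_fun do rewrite ImJ; exact: cvgN.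
Qed.
Lemma clim_sum I (r : seq I) (u : I -> T -> R[i]) (a : I -> R[i]) :
  (forall i, clim F (u i) (a i)) ->
  clim F (fun t => \sum_(i <- r) u i t) (\sum_(i <- r) a i).
Proof.
move=> h; elim: r => [|i r IH].
  by rewrite big_nil; under eq_fun do rewrite big_nil; exact: clim_cst.
by rewrite big_cons; under eq_fun do rewrite big_cons; exact: climD.
Qed.
Lemma clim_cmod u a : clim F u a -> cmod (u t) @[t --> F] --> cmod a.
Proof.
move/climP => h; apply/cvgrPdist_lt => e e0; near=> t.
rewrite distrC; apply: le_lt_trans (cmod_dist _ _) _.
by near: t; exact: (cvgr_lt _ h).
Unshelve. all: by end_near. Qed.
Lemma clim_le u a M : clim F u a -> (\forall t \near F, cmod (u t) <= M) ->
  cmod a <= M.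
Proof. by move/clim_cmod => h hM; exact: (cvgr_to_le h hM). Qed.
Lemma clim_squeeze u a (e : T -> R) : (\forall t \near F, cmod (u t - a) <= e t) ->
  e t @[t --> F] --> (0 : R) -> clim F u a.
Proof.
move=> h he; apply/climP; apply: (@squeeze_cvgr _ _ _ _ (fun=> 0) e) => //.
  by near=> t; rewrite cmod_ge0/=; near: t.
exact: cvg_cst.
Unshelve. all: by end_near. Qed.
End Limits.

End ComplexModulus.

(** * Ultralimits, power series, the exponential *)

Section UltraLimits.
Variable R : realType.

(** Replaces every extraction of a subsequence: bounded sequences converge along [U], and since [U]
    contains the tails, ordinary limits are also limits along [U]. *)
Lemma ex_ultrafilter_nat :
  exists U : set_system nat, UltraFilter U /\ \oo `<=` U.
Proof. exact: ultraFilterLemma. Qed.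

Variables (U : set_system nat) (UF : UltraFilter U).

Lemma ultra_map T (u : nat -> T) : UltraFilter (u @ U).
Proof.
split; first exact: fmap_proper_filter.
move=> G GF sub; apply/seteqP; split=> [A GA|A]; last exact: sub.
have [//|h] := in_ultra_setVsetC (u @^-1` A) UF.
have GnA : G (~` A) by apply: sub; rewrite /fmap/= /nbhs/=.
have : G (A `&` ~` A) by exact: filterI.
by rewrite setICr => /filter_not_empty.
Qed.

Lemma ulim_ex (u : nat -> R) (M : R) : (forall n, `|u n| <= M) ->
  exists l : R, u n @[n --> U] --> l.
Proof.
move=> hM.
have := @segment_compact R (- M) M.
rewrite compact_ultra => /(_ (u @ U) (ultra_map u)).
case.
  rewrite /fmap/=; by apply: filterE => n; rewrite /= in_itv/= -ler_norml.
by move=> l [_ h]; exists l.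
Qed.

Lemma ulimC_ex (u : nat -> R[i]) M : (forall n, cmod (u n) <= M) ->
  exists l, clim U u l.
Proof.
move=> hM.
have [a ha] := @ulim_ex (fun n => Re (u n)) M
  (fun n => le_trans (Re_cmod _) (hM n)).
have [b hb] := @ulim_ex (fun n => Im (u n)) M
  (fun n => le_trans (Im_cmod _) (hM n)).
by exists (a +i* b).
Qed.

End UltraLimits.

Lemma clim_sub (R : realType) T (F G : set_system T) (u : T -> R[i]) l :
  F `<=` G -> clim F u l -> clim G u l.
Proof. by move=> FG [h k]; split => A /= hA; apply: FG; [exact: h|exact: k]. Qed.

Section PowerSeries.
Variable R : realType.
Implicit Types (a : nat -> R[i]) (z : R[i]).

Definition psum a z n : R[i] := \sum_(k < n) a k * z ^+ k.

Lemma psumS a z n : psum a z n.+1 = psum a z n + a n * z ^+ n.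
Proof. by rewrite /psum big_ord_recr. Qed.

Lemma psum_dist a M z n m : (forall k, cmod (a k) <= M) -> cmod z < 1 ->
  cmod (psum a z (n + m) - psum a z n) <= M * cmod z ^+ n / (1 - cmod z).
Proof.
move=> hM z1; have z1' : 0 < 1 - cmod z by rewrite subr_gt0.
have M0 : 0 <= M by apply: le_trans (hM 0%N); exact: cmod_ge0.
(* The extra factor [1 - cmod z ^+ m] makes the bound the exact geometric sum, so that the induction
   on [m] closes. *)
suff h : cmod (psum a z (n + m) - psum a z n) <=
    M * cmod z ^+ n * (1 - cmod z ^+ m) / (1 - cmod z).
  apply: le_trans h _; rewrite ler_pM2r ?invr_gt0// ler_piMr//.
    by rewrite mulr_ge0// exprn_ge0// cmod_ge0.
  by rewrite lerBlDr lerDl exprn_ge0// cmod_ge0.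
elim: m => [|m IH]; first by rewrite addn0 subrr cmod0 expr0 subrr mulr0 mul0r.
rewrite addnS psumS addrAC; apply: le_trans (cmodD _ _) _.
apply: le_trans (lerD IH (_ : _ <= M * cmod z ^+ (n + m))) _.
  by rewrite cmodM cmodX ler_wpM2r// exprn_ge0// cmod_ge0.
rewrite exprD exprS le_eqVlt; apply/orP; left; apply/eqP.
by field; lra.
Qed.

Lemma geo_tail_cvg0 (M r c : R) : 0 <= r < 1 ->
  (M * r ^+ n / c @[n --> \oo] --> 0)%R.
Proof.
move=> /andP[r0 r1].
have -> : (0 : R) = M * 0 / c by rewrite mulr0 mul0r.
apply: cvgMr_tmp; apply: cvgMl_tmp; apply: cvg_expr.
by rewrite ger0_norm.
Qed.

(** The limit is first found along an ultrafilter; the tail bound [psum_dist] survives the passage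
    to that limit and then forces ordinary convergence. *)
Lemma ps_cvg a M z : (forall k, cmod (a k) <= M) -> cmod z < 1 ->
  exists l, clim \oo (psum a z) l /\
    forall n, cmod (psum a z n - l) <= M * cmod z ^+ n / (1 - cmod z).
Proof.
move=> hM z1; have [U [UF Uoo]] := ex_ultrafilter_nat.
have hb n : cmod (psum a z n) <= M * cmod z ^+ 0 / (1 - cmod z).
  by have := psum_dist 0 n hM z1; rewrite add0n /psum big_ord0 subr0.
have [l hl] := ulimC_ex UF hb.
have hd n : cmod (psum a z n - l) <= M * cmod z ^+ n / (1 - cmod z).
  have h1 : clim U (fun m => psum a z n - psum a z m) (psum a z n - l).
    by apply: climB hl; exact: clim_cst.
  apply: (clim_le h1); apply: Uoo; exists n => // m /= nm.
  by rewrite cmodBC -(subnKC nm) psum_dist.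
exists l; split => //.
apply: (clim_squeeze (e := fun n => M * cmod z ^+ n / (1 - cmod z))).
  exact: nearW.
by apply: geo_tail_cvg0; rewrite cmod_ge0.
Qed.

Lemma ps_lim_dist a M z l : (forall k, cmod (a k) <= M) -> cmod z < 1 ->
  clim \oo (psum a z) l ->
  forall n, cmod (psum a z n - l) <= M * cmod z ^+ n / (1 - cmod z).
Proof.
move=> hM z1 hl; have [l' [hl' hd]] := ps_cvg hM z1.
by rewrite (clim_unique hl hl').
Qed.

(** Once the coefficients below [k] vanish, the tail bound reads [cmod (a k) <= M t / (1 - t)], and
    [t] may be taken as small as one likes. Small positive real [t] suffice, which fits identities
    known only away from 0 or along a ray. *)
Lemma ps_uniq a M d : (forall k, cmod (a k) <= M) -> 0 < d ->
  (forall t : R, 0 < t -> t < d -> clim \oo (psum a t%:C) 0) ->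
  forall k, a k = 0.
Proof.
move=> hM d0 h; have M0 : 0 <= M by apply: le_trans (hM 0%N); exact: cmod_ge0.
apply: ltn_ind => k IH.
apply/eqP; rewrite -cmod_eq0; apply/eqP/le_anti; rewrite cmod_ge0 andbT.
apply/ler_addgt0Pl => e e0; rewrite addr0.
(* With [t <= 1/2] and [M t <= e / 2] one gets [M t <= e (1 - t)]; the [M + 1] guards against
   [M = 0]. *)
set t := Num.min (d / 2) (Num.min (1 / 2) (e / (2 * (M + 1)))).
have M1 : 0 < M + 1 by rewrite ltr_wpDl.
have t0 : 0 < t by rewrite !lt_min !divr_gt0// mulr_gt0.
have t1 : t <= d / 2 by rewrite /t ge_min lexx.
have t2 : t <= 1 / 2 by rewrite /t !ge_min lexx orbT.
have t3 : t <= e / (2 * (M + 1)) by rewrite /t !ge_min lexx !orbT.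
have td : t < d by lra.
have ct : cmod t%:C = t by rewrite cmodR gtr0_norm.
have ct1 : cmod t%:C < 1 by rewrite ct; lra.
have := ps_lim_dist hM ct1 (h _ t0 td) k.+1.
rewrite psumS subr0 /psum big1 ?add0r; last by move=> i _; rewrite IH// mul0r.
rewrite cmodM cmodX ct exprS mulrA -mulrAC ler_pM2r ?exprn_gt0// => /le_trans; apply.
rewrite ler_pdivrMr; last by lra.
move: t3; rewrite ler_pdivlMr ?mulr_gt0// => t3.
have : M * t <= (M + 1) * t by rewrite ler_wpM2r ?lerDl// ltW.
have : e * (1/2) <= e * (1 - t) by rewrite ler_pM2l//; lra.
by nra.
Qed.

End PowerSeries.

Section ComplexExponential.
Variable R : realType.
Implicit Types (z w v : R[i]).

Lemma cexp0 : cexp 0 = 1 :> R[i].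
Proof. by rewrite /cexp/= expR0 cos0 sin0 mul1r. Qed.

Lemma cexpD z w : cexp (z + w) = cexp z * cexp w.
Proof.
rewrite /cexp ReD ImD expRD cosD sinD; apply: complex_eq; rewrite /= !(mul0r, addr0, subr0, add0r); ring.
Qed.

Lemma cexpMn z n : cexp (z *+ n) = cexp z ^+ n.
Proof. by elim: n => [|n IH]; rewrite ?mulr0n ?cexp0// mulrS cexpD IH exprS. Qed.

Lemma cmod_cis (t : R) : cmod (cos t +i* sin t) = 1.
Proof. by rewrite /cmod/= cos2Dsin2 sqrtr1. Qed.

Lemma cmod_cexp z : cmod (cexp z) = expR (Re z).
Proof. by rewrite /cexp cmodM cmod_cis mulr1 cmodR ger0_norm ?expR_ge0. Qed.

Lemma cexp_neq0 z : cexp z != 0.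
Proof. by rewrite -cmod_gt0 cmod_cexp expR_gt0. Qed.

Lemma norm_sin_le (x : R) : `|sin x| <= `|x|.
Proof.
wlog x0 : x / 0 <= x.
  move=> h; have [|/ltW xn] := leP 0 x; first exact: h.
  by rewrite -(normrN x) -(normrN (sin x)) -sinN h// oppr_ge0.
have [|c _] := @MVT_segment R sin cos 0 x x0 (fun y _ => is_derive_sin y).
  by apply: continuous_subspaceT => y; exact: continuous_sin.
rewrite sin0 !subr0 => ->; rewrite normrM ler_piMl//.
exact: cos_max.
Qed.

Lemma norm_cos_sub1_le (x : R) : `|cos x - 1| <= x ^+ 2.
Proof.
have -> : cos x - 1 = - (sin (x / 2) ^+ 2 *+ 2).
  by rewrite {1}[x]splitr cosD -!expr2 cos2sin2; ring.
rewrite normrN normrMn normrX.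
have : `|sin (x / 2)| ^+ 2 <= (x / 2) ^+ 2.
  rewrite -(normrX 2) -[leRHS]ger0_norm ?sqr_ge0// !normrX.
  by rewrite ler_sqr ?nnegrE// norm_sin_le.
by rewrite -mulr_natr => h; nra.
Qed.

Lemma norm_sin_sub_le (x : R) : `|x| <= 1 -> `|sin x - x| <= x ^+ 2.
Proof.
wlog x0 : x / 0 <= x.
  move=> h; have [|/ltW xn] := leP 0 x; first exact: h.
  rewrite -normrN -sqrrN => h1.
  have -> : sin x - x = - (sin (- x) - - x) by rewrite sinN; ring.
  by rewrite normrN h// oppr_ge0.
move=> x1.
have [|c] := @MVT_segment R sin cos 0 x x0 (fun y _ => is_derive_sin y).
  by apply: continuous_subspaceT => y; exact: continuous_sin.
rewrite in_itv/= sin0 !subr0 => /andP[c0 cx] ->.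
have -> : cos c * x - x = (cos c - 1) * x by ring.
rewrite normrM (ger0_norm x0) expr2 ler_wpM2r//.
apply: le_trans (norm_cos_sub1_le _) _.
by move: x1; rewrite ger0_norm// => x1; nra.
Qed.

Lemma norm_expR_sub_le (x : R) : `|x| <= 1 / 2 -> `|expR x - 1 - x| <= 2 * x ^+ 2.
Proof.
rewrite ler_norml => /andP[x1 x2].
have h1 := expR_ge1Dx x; have h2 := expR_ge1Dx (- x).
rewrite ger0_norm; last by lra.
have e0 := expR_gt0 x.
have : expR x * (1 - x) <= 1.
  rewrite -[leRHS](@expRxMexpNx_1 R x) ler_pM2l//; lra.
by nra.
Qed.

(** With [a = Re v] and [b = Im v], the real estimates above bound the two coordinates by a total of
    [3 a^2 + 4 b^2]. *)
Lemma cexp_sub_le v : cmod v <= 1 / 2 -> cmod (cexp v - 1 - v) <= 8 * cmod v ^+ 2.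
Proof.
move=> hv; have ha := le_trans (Re_cmod v) hv; have hb := le_trans (Im_cmod v) hv.
rewrite cmod_sqr /cexp; set a := Re v in ha *; set b := Im v in hb *.
apply: le_trans (cmod_le _) _.
rewrite !(ReB, ImB, ReM, ImM)/= !(mul0r, subr0, addr0) -/a -/b.
have h1 := norm_expR_sub_le ha.
have h2 := norm_cos_sub1_le b.
have h3 : `|sin b - b| <= b ^+ 2 by apply: norm_sin_sub_le; lra.
have h4 := norm_sin_le b.
have e0 := expR_gt0 a.
have e1 : expR a <= 2.
  have : expR a * (1 - a) <= 1.
    rewrite -[leRHS](@expRxMexpNx_1 R a) ler_pM2l//.
    exact: expR_ge1Dx.
  by move: ha; rewrite ler_norml => /andP[a1 a2]; nra.
have e2 : `|expR a - 1| <= 2 * `|a|.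
  have -> : expR a - 1 = (expR a - 1 - a) + a by ring.
  apply: le_trans (ler_normD _ _) _.
  have : a ^+ 2 = `|a| ^+ 2 by rewrite -normrX ger0_norm// sqr_ge0.
  by have := normr_ge0 a; nra.
have r1 : `|expR a * cos b - 1 - a| <= 2 * a ^+ 2 + 2 * b ^+ 2.
  have -> : expR a * cos b - 1 - a = (expR a - 1 - a) + expR a * (cos b - 1) by ring.
  apply: le_trans (ler_normD _ _) _; apply: lerD => //.
  by rewrite normrM (gtr0_norm e0) ler_pM// ltW.
have r2 : `|expR a * sin b - b| <= 2 * `|a| * `|b| + b ^+ 2.
  have -> : expR a * sin b - b = (expR a - 1) * sin b + (sin b - b) by ring.
  apply: le_trans (ler_normD _ _) _; apply: lerD => //.
  by rewrite normrM ler_pM.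
have : 2 * `|a| * `|b| <= a ^+ 2 + b ^+ 2.
  have -> : a ^+ 2 = `|a| ^+ 2 by rewrite -normrX ger0_norm// sqr_ge0.
  have -> : b ^+ 2 = `|b| ^+ 2 by rewrite -normrX ger0_norm// sqr_ge0.
  by have := sqr_ge0 (`|a| - `|b|); nra.
have := sqr_ge0 a; have := sqr_ge0 b.
move: r1 r2; set X := `|_ * cos b - _ - _|; set Y := `|_ - b|.
lra.
Qed.

Lemma cmod_exprB (x y : R[i]) (M : R) n : cmod x <= M -> cmod y <= M ->
  cmod (x ^+ n - y ^+ n) <= cmod (x - y) * (n%:R * M ^+ n.-1).
Proof.
move=> xM yM; have M0 : 0 <= M by exact: le_trans (cmod_ge0 x) xM.
rewrite subrXX cmodM ler_wpM2l ?cmod_ge0//.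
apply: le_trans (cmod_sum _ _ _) _.
rewrite mulr_natl -[X in _ *+ X](card_ord n) -sumr_const.
apply: ler_sum => i _; rewrite cmodM !cmodX.
have -> : M ^+ n.-1 = M ^+ (n.-1 - i) * M ^+ i.
  by rewrite -exprD subnK//; case: n i => [|n] [i hi]//=.
by rewrite ler_pM ?exprn_ge0 ?cmod_ge0// lerXn2r ?nnegrE ?cmod_ge0.
Qed.

(** Both [exp (w / n)] and [1 + w / n] are bounded by [exp (B / n)], whose powers up to [n] stay
    below [exp B]; they differ by [O((B / n)^2)], and taking n-th powers costs a factor [n]. The
    bound is uniform in [w], as needed both for approximating exponentials and for the limit of n-th
    powers along an ultrafilter. *)
Lemma cexp_compound w (B : R) n : cmod w <= B -> (0 < n)%N -> 2 * B <= n%:R ->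
  cmod (cexp w - (1 + w / n%:R) ^+ n) <= 8 * B ^+ 2 * expR B / n%:R.
Proof.
move=> wB n0 Bn; set v := w / n%:R.
have nr0 : 0 < n%:R :> R by rewrite ltr0n.
have nC0 : n%:R != 0 :> R[i] by rewrite pnatr_eq0 -lt0n.
have cv : cmod v <= B / n%:R.
  by rewrite cmodM cmodV cmod_nat ler_pM2r ?invr_gt0.
have cv2 : cmod v <= 1 / 2.
  by apply: le_trans cv _; rewrite ler_pdivrMr//; lra.
have -> : cexp w = cexp v ^+ n by rewrite -cexpMn -mulr_natr mulfVK.
set M := expR (B / n%:R).
have M1 : 1 <= M.
  rewrite -[leLHS]expR0 ler_expR divr_ge0// ?ler0n//.
  exact: le_trans (cmod_ge0 _) wB.
have x1 : cmod (cexp v) <= M.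
  by rewrite cmod_cexp ler_expR (le_trans _ cv)// Re_le_cmod.
have y1 : cmod (1 + v) <= M.
  apply: le_trans (cmodD _ _) _; rewrite cmod1.
  apply: le_trans (expR_ge1Dx _) _; by rewrite ler_expR.
apply: le_trans (cmod_exprB n x1 y1) _.
have -> : cexp v - (1 + v) = cexp v - 1 - v by ring.
have -> : 8 * B ^+ 2 * expR B / n%:R =
    8 * (B / n%:R) ^+ 2 * (n%:R * expR B).
  by field; rewrite gt_eqF.
apply: ler_pM; rewrite ?cmod_ge0//.
- by rewrite mulr_ge0// exprn_ge0// (le_trans _ M1).
- apply: le_trans (cexp_sub_le cv2) _; rewrite ler_pM2l//.
  by rewrite ler_sqr ?nnegrE ?cmod_ge0// (le_trans _ cv)// cmod_ge0.
- rewrite ler_pM2l//.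
  apply: (@le_trans _ _ (M ^+ n)).
    by rewrite ler_weXn2l// leq_pred.
  by rewrite /M -expRM_natl mulrCA divff ?mulr1// gt_eqF.
Qed.

End ComplexExponential.

(** * Locally uniform polynomial approximation on the disk *)

Section DiskApproximation.
Variable R : realType.
Implicit Types (f g : R[i] -> R[i]) (p q : {poly R[i]}) (z : R[i]) (r e : R).

(** Equivalent to holomorphy on the open unit disk, in a form whose closure properties are
    elementary. *)
Definition disk_approx f := forall r e, 0 <= r < 1 -> 0 < e ->
  exists p, forall z, cmod z <= r -> cmod (f z - p.[z]) <= e.

Lemma poly_bounded p : exists2 B : R, 0 < B & forall z, cmod z <= 1 -> cmod p.[z] <= B.
Proof.
exists (1 + \sum_(i < size p) cmod p`_i).
  by rewrite ltr_pwDl// sumr_ge0// => i _; exact: cmod_ge0.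
move=> z z1; rewrite horner_coef; apply: le_trans (cmod_sum _ _ _) _.
rewrite -[leLHS]add0r lerD// ler_sum// => i _.
by rewrite cmodM cmodX ler_piMr ?cmod_ge0// exprn_ile1// cmod_ge0.
Qed.

Lemma disk_approx_poly p : disk_approx (fun z => p.[z]).
Proof.
by move=> r e _ e0; exists p => z _; rewrite subrr cmod0 ltW.
Qed.

Lemma disk_approx_ext f g : (forall z, cmod z < 1 -> f z = g z) ->
  disk_approx f -> disk_approx g.
Proof.
move=> fg hf r e /andP[r0 r1] e0; have [|p hp] := hf r e _ e0; first by rewrite r0.
by exists p => z zr; rewrite -fg ?hp// (le_lt_trans zr).
Qed.

(** The rule that leads beyond polynomials: the exponential, the inverse and power series are all
    reached as locally uniform limits. *)
Lemma disk_approx_unif f :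
  (forall r e, 0 <= r < 1 -> 0 < e -> exists2 g, disk_approx g &
     forall z, cmod z <= r -> cmod (f z - g z) <= e) ->
  disk_approx f.
Proof.
move=> h r e r01 e0; have e20 : 0 < e / 2 by rewrite divr_gt0.
have [g hg fg] := h r (e / 2) r01 e20.
have [p hp] := hg r (e / 2) r01 e20.
exists p => z zr; have -> : f z - p.[z] = (f z - g z) + (g z - p.[z]) by ring.
apply: le_trans (cmodD _ _) _.
by rewrite [leRHS]splitr lerD ?fg ?hp.
Qed.

Lemma disk_approx_bounded f r : disk_approx f -> 0 <= r < 1 ->
  exists2 B : R, 0 < B & forall z, cmod z <= r -> cmod (f z) <= B.
Proof.
move=> hf r01; have [p hp] := hf r 1 r01 ltr01.
have [B B0 hB] := poly_bounded p.
exists (1 + B); first by rewrite ltr_wpDl.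
move=> z zr; rewrite -(subrK p.[z] (f z)); apply: le_trans (cmodD _ _) _.
rewrite lerD ?hp// hB//; case/andP: r01 => _ r1.
by rewrite (le_trans zr)// ltW.
Qed.

Lemma disk_approxD f g : disk_approx f -> disk_approx g ->
  disk_approx (fun z => f z + g z).
Proof.
move=> hf hg r e r01 e0; have e20 : 0 < e / 2 by rewrite divr_gt0.
have [p hp] := hf r _ r01 e20; have [q hq] := hg r _ r01 e20.
exists (p + q) => z zr; rewrite hornerD.
have -> : f z + g z - (p.[z] + q.[z]) = (f z - p.[z]) + (g z - q.[z]) by ring.
apply: le_trans (cmodD _ _) _.
by rewrite [leRHS]splitr lerD ?hp ?hq.
Qed.

Lemma disk_approxM f g : disk_approx f -> disk_approx g ->
  disk_approx (fun z => f z * g z).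
Proof.
move=> hf hg r e r01 e0.
(* The order matters: [q] is chosen from a bound of [f], and only then [p] from a bound of [q]. *)
have [B B0 hB] := disk_approx_bounded hf r01.
have [q hq] := hg r (e / (2 * B)) r01 (divr_gt0 e0 (mulr_gt0 (ltr0Sn _ 1) B0)).
have [C C0 hC] := poly_bounded q.
have [p hp] := hf r (e / (2 * C)) r01 (divr_gt0 e0 (mulr_gt0 (ltr0Sn _ 1) C0)).
exists (p * q) => z zr; rewrite hornerM.
have -> : f z * g z - p.[z] * q.[z] = f z * (g z - q.[z]) + (f z - p.[z]) * q.[z] by ring.
apply: le_trans (cmodD _ _) _; rewrite [leRHS]splitr !cmodM; apply: lerD.
  apply: le_trans (_ : B * (e / (2 * B)) <= _).
    by rewrite ler_pM ?cmod_ge0 ?hB ?hq.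
  by rewrite le_eqVlt; apply/orP; left; apply/eqP; field; rewrite gt_eqF.
apply: le_trans (_ : e / (2 * C) * C <= _).
  rewrite ler_pM ?cmod_ge0 ?hp ?hC//; case/andP: r01 => _ r1.
  by rewrite (le_trans zr)// ltW.
by rewrite le_eqVlt; apply/orP; left; apply/eqP; field; rewrite gt_eqF.
Qed.

Lemma disk_approx_cst c : disk_approx (fun=> c).
Proof.
apply: disk_approx_ext (disk_approx_poly c%:P) => z _; exact: hornerC.
Qed.

Lemma disk_approx_id : disk_approx (fun z => z).
Proof.
apply: disk_approx_ext (disk_approx_poly 'X) => z _; exact: hornerX.
Qed.

Lemma disk_approxZ c f : disk_approx f -> disk_approx (fun z => c * f z).
Proof. by move=> h; apply: disk_approxM => //; exact: disk_approx_cst. Qed.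

Lemma disk_approxB f g : disk_approx f -> disk_approx g ->
  disk_approx (fun z => f z - g z).
Proof.
move=> hf /(disk_approxZ (-1)) hg.
by apply: disk_approx_ext (disk_approxD hf hg) => z _; rewrite mulN1r.
Qed.

Lemma disk_approxX f n : disk_approx f -> disk_approx (fun z => f z ^+ n).
Proof.
move=> hf; elim: n => [|n IH].
  by apply: disk_approx_ext (disk_approx_cst 1) => z _; rewrite expr0.
by apply: disk_approx_ext (disk_approxM hf IH) => z _; rewrite exprS.
Qed.

Lemma disk_approx_sum n (F : nat -> R[i] -> R[i]) :
  (forall i, disk_approx (F i)) -> disk_approx (fun z => \sum_(i < n) F i z).
Proof.
move=> hF; elim: n => [|n IH].
  by apply: disk_approx_ext (disk_approx_cst 0) => z _; rewrite big_ord0.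
by apply: disk_approx_ext (disk_approxD IH (hF n)) => z _; rewrite big_ord_recr.
Qed.

Lemma disk_approx_cexp f : disk_approx f -> disk_approx (fun z => cexp (f z)).
Proof.
move=> hf; apply: disk_approx_unif => r e r01 e0.
have [B B0 hB] := disk_approx_bounded hf r01.
have K0 : 0 < 8 * B ^+ 2 * expR B.
  by rewrite mulr_gt0 ?expR_gt0// mulr_gt0// exprn_gt0.
(* The first term meets the hypothesis of [cexp_compound], the second brings its error below [e]. *)
set m := Num.max (2 * B) (8 * B ^+ 2 * expR B / e).
pose n := (Num.truncn m).+1.
have nm : m < n%:R by rewrite /n truncnS_gt.
have n1 : 2 * B <= n%:R by rewrite (le_trans _ (ltW nm))// le_max lexx.
have n2 : 8 * B ^+ 2 * expR B / e <= n%:R.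
  by rewrite (le_trans _ (ltW nm))// le_max lexx orbT.
exists (fun z => (1 + f z * n%:R^-1) ^+ n).
  apply: disk_approxX; apply: disk_approxD; first exact: disk_approx_cst.
  by apply: disk_approxM => //; exact: disk_approx_cst.
move=> z zr; apply: le_trans (cexp_compound (hB _ zr) _ n1) _ => //.
by rewrite ler_pdivrMr ?ltr0n//; move: n2; rewrite ler_pdivrMr// (mulrC e).
Qed.

Lemma geometric_sub (w : R[i]) n : w != 1 ->
  (1 - w)^-1 - \sum_(i < n) w ^+ i = w ^+ n / (1 - w).
Proof.
move=> w1; have h : 1 - w != 0 by rewrite subr_eq0 eq_sym.
apply: (mulIf h); rewrite mulrBl mulVf// mulfVK//.
elim: n => [|n IH]; first by rewrite big_ord0 mul0r subr0 expr0.
by rewrite big_ord_recr/= mulrDl opprD addrA IH exprS; ring.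
Qed.

Lemma ex_expr_lt (r e : R) : 0 <= r < 1 -> 0 < e -> exists n, r ^+ n <= e.
Proof.
move=> /andP[r0 r1] e0.
have h : (r ^+ n @[n --> \oo] --> (0:R))%R by apply: cvg_expr; rewrite ger0_norm.
have := cvgr_le _ h _ e0; case => n _ /(_ n (leqnn n)) /=.
by exists n.
Qed.

Lemma disk_approx_geometric f :
  disk_approx f ->
  (forall r, 0 <= r < 1 -> exists2 s, 0 <= s < 1 & forall z, cmod z <= r -> cmod (f z) <= s) ->
  disk_approx (fun z => (1 - f z)^-1).
Proof.
move=> hf hs; apply: disk_approx_unif => r e r01 e0.
have [s /andP[s0 s1] hfs] := hs r r01.
have [||n hn] := @ex_expr_lt s (e * (1 - s)); first by rewrite s0.
  by rewrite mulr_gt0// subr_gt0.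
exists (fun z => \sum_(i < n) f z ^+ i).
  by apply: (@disk_approx_sum n (fun i z => f z ^+ i)) => i; exact: disk_approxX.
move=> z zr; have fs := hfs z zr.
have f1 : cmod (f z) < 1 by exact: le_lt_trans s1.
rewrite geometric_sub; last first.
  by apply: contraTneq f1 => ->; rewrite cmod1 ltxx.
rewrite cmodM cmodX cmodV.
have h1 : 1 - s <= cmod (1 - f z) by apply: le_trans (one_sub_ge _); rewrite lerB.
rewrite ler_pdivrMr; last by rewrite (lt_le_trans _ h1)// subr_gt0.
apply: le_trans (_ : s ^+ n <= _); first by rewrite lerXn2r ?nnegrE ?cmod_ge0.
by apply: le_trans hn _; rewrite ler_pM2l.
Qed.

(* With [c = 2 B^2] one has [|1 - w/c| < 1] on [{Re w >= 1/2, |w| <= B}], so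
   [1/w] is a geometric series there. *)
Lemma disk_approxV f : disk_approx f ->
  (forall z, cmod z < 1 -> 1 / 2 <= Re (f z)) ->
  disk_approx (fun z => (f z)^-1).
Proof.
move=> hf hre; apply: disk_approx_unif => r e r01 e0.
have [B0 B00 hB0] := disk_approx_bounded hf r01.
set B := B0 + 1; set c := 2 * B ^+ 2.
have B1 : 1 < B by rewrite /B; lra.
have c2 : 2 < c by rewrite /c; nra.
have c0 : 0 < c by lra.
have cC : c%:C != 0 by rewrite -cmod_gt0 cmodR gtr0_norm.
(* For [w = f z], [|1 - w/c|^2 = 1 - (2 Re w - |w|^2 / c) / c], where [2 Re w >= 1] and
   [|w|^2 / c <= 1/2] by the choice of [c]. *)
set s := Num.sqrt (1 - 1 / (2 * c)).
have s0 : 0 <= 1 - 1 / (2 * c).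
  by rewrite subr_ge0 ler_pdivrMr ?mulr_gt0//; lra.
have hs z : cmod z <= r -> cmod (1 - f z / c%:C) <= s.
  move=> zr; rewrite -(@ler_sqr R) ?nnegrE ?cmod_ge0 ?sqrtr_ge0//.
  have hc : c%:C^-1 = (c^-1)%:C by rewrite fmorphV.
  rewrite cmod_sqr sqr_sqrtr// hc !(ReB, ImB, ReM, ImM)/= !(mulr0, subr0, sub0r, add0r).
  have h1 : cmod (f z) <= B by apply: le_trans (hB0 _ zr) _; rewrite lerDl.
  have h2 : Re (f z) ^+ 2 + Im (f z) ^+ 2 <= B ^+ 2.
    by rewrite -cmod_sqr ler_sqr ?nnegrE ?cmod_ge0//; lra.
  have h3 : 1 / 2 <= Re (f z).
    by apply: hre; case/andP: r01 => _; exact: le_lt_trans.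
  set a := Re (f z) in h2 h3 *; set b := Im (f z) in h2 *.
  have -> : (1 - a * c^-1) ^+ 2 + (- (b * c^-1)) ^+ 2 =
      1 - (2 * a - (a ^+ 2 + b ^+ 2) / c) / c by field; rewrite gt_eqF.
  have -> : 1 / (2 * c) = (1 - 1 / 2) / c by field; rewrite gt_eqF.
  rewrite lerB// ler_pM2r ?invr_gt0//.
  have : (a ^+ 2 + b ^+ 2) / c <= 1 / 2.
    by rewrite ler_pdivrMr// /c; lra.
  lra.
have s1 : s < 1.
  rewrite -[ltRHS](@sqrtr1 R) ltr_sqrt// ltrBlDr ltrDl divr_gt0// mulr_gt0//.
have [||n hn] := @ex_expr_lt s (e / 2); first by rewrite sqrtr_ge0.
  by rewrite divr_gt0.
exists (fun z => c%:C^-1 * \sum_(i < n) (1 - f z / c%:C) ^+ i).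
  apply: disk_approxZ.
  apply: (@disk_approx_sum n (fun i z => (1 - f z / c%:C) ^+ i)) => i.
  apply: disk_approxX; apply: disk_approxB; first exact: disk_approx_cst.
  by apply: disk_approxM => //; exact: disk_approx_cst.
move=> z zr.
have h3 : 1 / 2 <= Re (f z).
  by apply: hre; case/andP: r01 => _; exact: le_lt_trans.
have h4 : 1 / 2 <= cmod (f z) by exact: le_trans h3 (Re_le_cmod _).
have f0 : f z != 0 by rewrite -cmod_gt0; lra.
have w1 : 1 - f z / c%:C != 1.
  by rewrite addrC -subr_eq0 addrK oppr_eq0 mulf_neq0// invr_neq0.
have := geometric_sub n w1; rewrite opprB addrCA subrr addr0 => hg.
have -> : (f z)^-1 - c%:C^-1 * \sum_(i < n) (1 - f z / c%:C) ^+ i =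
   c%:C^-1 * ((f z / c%:C)^-1 - \sum_(i < n) (1 - f z / c%:C) ^+ i).
  by rewrite mulrBr; congr (_ - _); rewrite invfM invrK mulrCA mulVf// mulr1.
rewrite hg !cmodM !cmodV cmodM cmodV cmodX cmodR gtr0_norm//.
have -> : c^-1 * (cmod (1 - f z / c%:C) ^+ n * (cmod (f z) * c^-1)^-1) =
    cmod (1 - f z / c%:C) ^+ n / cmod (f z).
  by field; rewrite (gt_eqF c0) gt_eqF//; lra.
rewrite ler_pdivrMr; last by lra.
apply: le_trans (_ : s ^+ n <= _).
  by rewrite lerXn2r ?nnegrE ?cmod_ge0 ?sqrtr_ge0 ?hs.
apply: le_trans hn _; nra.
Qed.

Lemma disk_approx_ps (a : nat -> R[i]) M f : (forall k, cmod (a k) <= M) ->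
  (forall z, cmod z < 1 -> clim \oo (psum a z) (f z)) -> disk_approx f.
Proof.
move=> hM hf; apply: disk_approx_unif => r e r01 e0.
have M0 : 0 <= M by apply: le_trans (hM 0%N); exact: cmod_ge0.
have M1 : 0 < M + 1 by rewrite ltr_wpDl.
have [r0 r1] := andP r01; have r1' : 0 < 1 - r by rewrite subr_gt0.
have [|n hn] := ex_expr_lt r01 (_ : 0 < e * (1 - r) / (M + 1)).
  by rewrite divr_gt0// mulr_gt0.
exists (fun z => psum a z n).
  apply: (@disk_approx_sum n (fun i z => a i * z ^+ i)) => i.
  by apply: disk_approxZ; apply: disk_approxX; exact: disk_approx_id.
move=> z zr; have z1 : cmod z < 1 by exact: le_lt_trans r1.
rewrite cmodBC; apply: le_trans (ps_lim_dist hM z1 (hf z z1) n) _.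
have z1' : 0 < 1 - cmod z by rewrite subr_gt0.
rewrite ler_pdivrMr//.
apply: le_trans (_ : (M + 1) * r ^+ n <= _).
  by rewrite ler_pM// ?exprn_ge0 ?cmod_ge0 ?lerDl// lerXn2r ?nnegrE ?cmod_ge0.
move: hn; rewrite ler_pdivlMr// mulrC => /le_trans; apply.
by rewrite ler_pM2l// lerB.
Qed.

End DiskApproximation.

(** * Integrals of bounded functions on the circle *)

Section BoundedMeasurable.
Variable R : realType.
Implicit Types (f g : S1 R -> R[i]).

(** All integrands on the circle are bounded and all measures finite, so this one predicate, stable
    under the algebraic operations, settles every integrability condition. *)
Definition bmeas f : Prop :=
  [/\ measurable_fun setT (fun x => Re (f x)),
      measurable_fun setT (fun x => Im (f x)) &
      exists M, forall x, cmod (f x) <= M].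

Lemma open_circle_measurable (A : set (circle R)) : open A ->
  @measurable _ (S1 R) A.
Proof. by move=> oA; exact: sub_sigma_algebra. Qed.

Lemma measurable_continuous_circle (h : circle R -> R) : continuous h ->
  measurable_fun setT (h : S1 R -> R).
Proof.
move=> ch; apply: (measurability _ (RGenOInfty.measurableE R)) => //.
move=> _ [_ [x ->] <-]; rewrite setTI; apply: open_circle_measurable.
by move/continuousP : ch; apply; first [exact: interval_open|exact: rray_open|exact: itv_open].
Qed.

Lemma continuous_ReC : continuous (fun z : R[i]^o => Re z).
Proof.
move=> z A /nbhs_ballP[e /= e0 he]; apply/nbhs_ballP.
exists e%:C; first by rewrite /= ltcR.
move=> w; rewrite -ball_normE/= normE ltcR => h; apply: he.
by rewrite -ball_normE/= -ReB (le_lt_trans (Re_cmod _)).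
Qed.

Lemma continuous_ImC : continuous (fun z : R[i]^o => Im z).
Proof.
move=> z A /nbhs_ballP[e /= e0 he]; apply/nbhs_ballP.
exists e%:C; first by rewrite /= ltcR.
move=> w; rewrite -ball_normE/= normE ltcR => h; apply: he.
by rewrite -ball_normE/= -ImB (le_lt_trans (Im_cmod _)).
Qed.

Lemma continuous_Re_circle : continuous (fun x : circle R => Re (set_val x)).
Proof.
move=> x; apply: (@continuous_comp _ R[i]^o R set_val (fun z => Re z)).
  exact: initial_continuous.
exact: continuous_ReC.
Qed.

Lemma continuous_Im_circle : continuous (fun x : circle R => Im (set_val x)).
Proof.
move=> x; apply: (@continuous_comp _ R[i]^o R set_val (fun z => Im z)).
  exact: initial_continuous.
exact: continuous_ImC.
Qed.

Lemma bmeas_cval : bmeas (@cval R).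
Proof.
split; last by exists 1 => x; rewrite cval_cmod.
- exact: (measurable_continuous_circle continuous_Re_circle).
- exact: (measurable_continuous_circle continuous_Im_circle).
Qed.

Lemma bmeas_cst c : bmeas (fun=> c).
Proof. by split; [exact: measurable_cst|exact: measurable_cst|exists (cmod c)]. Qed.

Lemma bmeasD f g : bmeas f -> bmeas g -> bmeas (fun x => f x + g x).
Proof.
move=> [fr fi [M fM]] [gr gi [N gN]]; split.
- by under eq_fun do rewrite ReD; exact: measurable_funD.
- by under eq_fun do rewrite ImD; exact: measurable_funD.
- exists (M + N) => x; apply: le_trans (cmodD _ _) _; exact: lerD.
Qed.

Lemma bmeasM f g : bmeas f -> bmeas g -> bmeas (fun x => f x * g x).
Proof.
move=> [fr fi [M fM]] [gr gi [N gN]]; split.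
- under eq_fun do rewrite ReM.
  by apply: measurable_funB; exact: measurable_funM.
- under eq_fun do rewrite ImM.
  by apply: measurable_funD; exact: measurable_funM.
- by exists (M * N) => x; rewrite cmodM ler_pM ?cmod_ge0.
Qed.

Lemma bmeasZ c f : bmeas f -> bmeas (fun x => c * f x).
Proof. by apply: bmeasM; exact: bmeas_cst. Qed.

Lemma bmeasN f : bmeas f -> bmeas (fun x => - f x).
Proof.
by move/(bmeasZ (-1)); under eq_fun do rewrite mulN1r.
Qed.

Lemma bmeasB f g : bmeas f -> bmeas g -> bmeas (fun x => f x - g x).
Proof. by move=> hf hg; apply: bmeasD => //; exact: bmeasN. Qed.

Lemma bmeasJ f : bmeas f -> bmeas (fun x => (f x)^*).
Proof.
move=> [fr fi [M fM]]; split.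
- by under eq_fun do rewrite ReJ.
- by under eq_fun do rewrite ImJ; exact: measurable_funN.
- by exists M => x; rewrite cmodJ.
Qed.

Lemma bmeasX f n : bmeas f -> bmeas (fun x => f x ^+ n).
Proof.
move=> hf; elim: n => [|n IH].
  by under eq_fun do rewrite expr0; exact: bmeas_cst.
by under eq_fun do rewrite exprS; exact: bmeasM.
Qed.

Lemma bmeas_sum n (F : nat -> S1 R -> R[i]) : (forall i, bmeas (F i)) ->
  bmeas (fun x => \sum_(i < n) F i x).
Proof.
move=> hF; elim: n => [|n IH].
  by under eq_fun do rewrite big_ord0; exact: bmeas_cst.
by under eq_fun do rewrite big_ord_recr; exact: bmeasD.
Qed.

Lemma bmeas_lim (F : nat -> S1 R -> R[i]) f (M : R) : (forall n, bmeas (F n)) ->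
  (forall n x, cmod (F n x) <= M) -> (forall x, clim \oo (F^~ x) (f x)) -> bmeas f.
Proof.
move=> hF hM hf; split.
- apply: (@measurable_fun_cvg _ _ _ _ (fun n x => Re (F n x))).
    by move=> n; case: (hF n).
  by move=> x _; case: (hf x).
- apply: (@measurable_fun_cvg _ _ _ _ (fun n x => Im (F n x))).
    by move=> n; case: (hF n).
  by move=> x _; case: (hf x).
- exists M => x; apply: (clim_le (hf x)); exact: nearW.
Qed.

Lemma clim_geometric (w : R[i]) : cmod w < 1 ->
  clim \oo (fun n => \sum_(i < n) w ^+ i) (1 - w)^-1.
Proof.
move=> w1; apply: (clim_squeeze (e := fun n => 1 * cmod w ^+ n / cmod (1 - w))).
  apply: nearW => n; rewrite cmodBC geometric_sub.
    by rewrite cmodM cmodX cmodV mul1r.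
  by apply: contraTneq w1 => ->; rewrite cmod1 ltxx.
by apply: geo_tail_cvg0; rewrite cmod_ge0.
Qed.

Lemma cmod_geometric (w : R[i]) (r : R) n : cmod w <= r -> r < 1 ->
  cmod (\sum_(i < n) w ^+ i) <= (1 - r)^-1.
Proof.
move=> wr r1; have r0 : 0 <= r by exact: le_trans (cmod_ge0 _) wr.
apply: le_trans (cmod_sum _ _ _) _.
apply: (@le_trans _ _ (\sum_(i < n) r ^+ i)).
  by apply: ler_sum => i _; rewrite cmodX lerXn2r ?nnegrE ?cmod_ge0.
rewrite -[leRHS]mul1r ler_pdivlMr ?subr_gt0//.
suff -> : (\sum_(i < n) r ^+ i) * (1 - r) = 1 - r ^+ n.
  by rewrite lerBlDr lerDl exprn_ge0.
by elim: n => [|n IH]; rewrite ?big_ord0 ?big_ord_recr/= ?mulrDl ?IH ?exprS; ring.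
Qed.

Lemma bmeas_geometric f (r : R) : bmeas f -> (forall x, cmod (f x) <= r) ->
  r < 1 -> bmeas (fun x => (1 - f x)^-1).
Proof.
move=> hf fr r1.
apply: (@bmeas_lim (fun n x => \sum_(i < n) f x ^+ i) _ (1 - r)^-1).
- by move=> n; apply: (@bmeas_sum n (fun i x => f x ^+ i)) => i; exact: bmeasX.
- by move=> n x; exact: cmod_geometric.
- by move=> x; apply: clim_geometric; exact: le_lt_trans r1.
Qed.

Section Integral.
Variable m : {finite_measure set (S1 R) -> \bar R}.

Definition mass : R := fine (m setT).

Lemma mass_ge0 : 0 <= mass. Proof. exact: fine_ge0. Qed.

Lemma integrable_bounded (h : S1 R -> R) (M : R) : measurable_fun setT h ->
  (forall x, `|h x| <= M) -> m.-integrable setT (EFin \o h).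
Proof.
move=> mh hM; apply: measurable_bounded_integrable => //.
- by rewrite -ge0_fin_numE// fin_num_measure.
- exists M; split; first exact: num_real.
  by move=> N MN x _; rewrite /= (le_trans (hM x))// ltW.
Qed.

Lemma bmeas_integrable f : bmeas f ->
  m.-integrable setT (fun x => (Re (f x))%:E) /\
  m.-integrable setT (fun x => (Im (f x))%:E).
Proof.
move=> [fr fi [M fM]]; split.
- by apply: (integrable_bounded fr) => x; exact: le_trans (Re_cmod _) (fM x).
- by apply: (integrable_bounded fi) => x; exact: le_trans (Im_cmod _) (fM x).
Qed.

Lemma cintE f :
  cintegral m f = (\int[m]_x Re (f x)) +i* (\int[m]_x Im (f x)).
Proof. by []. Qed.

Lemma eq_cint f g : f =1 g -> cintegral m f = cintegral m g.
Proof. by move=> /funext ->. Qed.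

Lemma cintD f g : bmeas f -> bmeas g ->
  cintegral m (fun x => f x + g x) = cintegral m f + cintegral m g.
Proof.
move=> /bmeas_integrable[fr fi] /bmeas_integrable[gr gi]; rewrite !cintE.
apply: complex_eq; rewrite /=.
- under eq_Rintegral do rewrite ReD; exact: RintegralD.
- under eq_Rintegral do rewrite ImD; exact: RintegralD.
Qed.

Lemma cintZ c f : bmeas f -> cintegral m (fun x => c * f x) = c * cintegral m f.
Proof.
move=> /bmeas_integrable[fr fi]; rewrite !cintE.
have h (a : R) (u : S1 R -> R) : m.-integrable setT (EFin \o u) ->
  m.-integrable setT (EFin \o (fun x => a * u x)).
  move=> hu; have := integrableZl measurableT a hu.
  by apply: eq_integrable => // x _; rewrite /= EFinM.
apply: complex_eq; rewrite !(ReM, ImM)/=.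
- under eq_Rintegral do rewrite ReM.
  by rewrite RintegralB ?RintegralZl//; exact: h.
- under eq_Rintegral do rewrite ImM.
  by rewrite RintegralD ?RintegralZl//; exact: h.
Qed.

Lemma cintN f : bmeas f -> cintegral m (fun x => - f x) = - cintegral m f.
Proof. by move=> h; rewrite -mulN1r -cintZ//; apply: eq_cint => x; rewrite mulN1r. Qed.

Lemma cintB f g : bmeas f -> bmeas g ->
  cintegral m (fun x => f x - g x) = cintegral m f - cintegral m g.
Proof. by move=> hf hg; rewrite cintD ?cintN//; exact: bmeasN. Qed.

Lemma cint_cst c : cintegral m (fun=> c) = c * mass%:C.
Proof.
rewrite cintE; apply: complex_eq; rewrite !(ReM, ImM)/= Rintegral_cst// /mass; ring.
Qed.

Lemma cintJ f : bmeas f -> cintegral m (fun x => (f x)^*) = (cintegral m f)^*.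
Proof.
move=> /bmeas_integrable[fr fi]; rewrite !cintE; apply: complex_eq; rewrite /=.
- by under eq_Rintegral do rewrite ReJ.
- under eq_Rintegral do rewrite ImJ -mulN1r.
  by rewrite RintegralZl// mulN1r.
Qed.

Lemma cint_sum n (F : nat -> S1 R -> R[i]) : (forall i, bmeas (F i)) ->
  cintegral m (fun x => \sum_(i < n) F i x) = \sum_(i < n) cintegral m (F i).
Proof.
move=> hF; elim: n => [|n IH].
  by under eq_cint do rewrite big_ord0; rewrite cint_cst mul0r big_ord0.
under eq_cint do rewrite big_ord_recr.
by rewrite cintD ?IH ?big_ord_recr//; exact: bmeas_sum.
Qed.

Lemma Rint_bound (h : S1 R -> R) (M : R) : measurable_fun setT h ->
  (forall x, `|h x| <= M) -> `|\int[m]_x h x| <= M * mass.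
Proof.
move=> mh hM; have ih := integrable_bounded mh hM.
apply: le_trans (le_normr_Rintegral _ ih) _ => //.
rewrite -[leRHS]Rintegral_cst//; apply: le_Rintegral => //.
- apply: (@integrable_bounded (fun x => `|h x|) M) => [|x].
    exact: measurableT_comp.
  by rewrite normr_id.
- by apply: (@integrable_bounded _ `|M|).
Qed.

(** The coordinates are bounded separately, which costs the factor 2; it reappears in [mom_bound]
    and in the constants derived from it. *)
Lemma cint_bound f (M : R) : bmeas f -> (forall x, cmod (f x) <= M) ->
  cmod (cintegral m f) <= 2 * M * mass.
Proof.
move=> [fr fi _] fM; apply: le_trans (cmod_le _) _.
have -> : 2 * M * mass = M * mass + M * mass by ring.
apply: lerD; apply: Rint_bound => // x; apply: le_trans (fM x).
- exact: Re_cmod.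
- exact: Im_cmod.
Qed.

Lemma Re_cint_ge f (a : R) : bmeas f -> (forall x, a <= Re (f x)) ->
  a * mass <= Re (cintegral m f).
Proof.
move=> /bmeas_integrable[fr fi] h; rewrite -Rintegral_cst//=.
apply: le_Rintegral => //.
by apply: (@integrable_bounded _ `|a|).
Qed.

Lemma cint_lim (F : nat -> S1 R -> R[i]) f (M : R) : (forall n, bmeas (F n)) ->
  (forall n x, cmod (F n x) <= M) -> (forall x, clim \oo (F^~ x) (f x)) ->
  clim \oo (fun n => cintegral m (F n)) (cintegral m f).
Proof.
move=> hF hM hf.
have key (u : nat -> S1 R -> R) (v : S1 R -> R) :
    (forall n, measurable_fun setT (u n)) -> (forall n x, `|u n x| <= M) ->
    (forall x, u n x @[n --> \oo] --> v x) ->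
    (\int[m]_x u n x @[n --> \oo] --> \int[m]_x v x)%R.
  move=> mu hu huv.
  have mv : measurable_fun setT v.
    by apply: (@measurable_fun_cvg _ _ _ _ u).
  have iM : m.-integrable setT (EFin \o (fun=> M)).
    by apply: (@integrable_bounded _ `|M|).
  have [|n|||||_ _ h] := @dominated_convergence _ _ R m setT _
    (fun n x => (u n x)%:E) (fun x => (v x)%:E) (fun=> M%:E) => //.
  - exact/measurable_EFinP.
  - exact/measurable_EFinP.
  - by apply: aeW => x _; apply: cvg_EFin; [exact: nearW|exact: huv].
  - by apply: aeW => x n _; rewrite /= lee_fin.
  apply: fine_cvg; rewrite /Rintegral fineK//.
  apply: integrable_fin_num => //.
  apply: (@integrable_bounded v M mv) => x.
  apply: (cvgr_to_le (cvg_norm (huv x))); exact: nearW.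
split; rewrite /=.
- apply: key => [n|n x|x]; [by case: (hF n)| |by case: (hf x)].
  exact: le_trans (Re_cmod _) (hM n x).
- apply: key => [n|n x|x]; [by case: (hF n)| |by case: (hf x)].
  exact: le_trans (Im_cmod _) (hM n x).
Qed.

End Integral.
End BoundedMeasurable.

(** * Resolvents, moments and the transform F *)

Section Resolvent.
Variable R : realType.
Implicit Types (z w : R[i]) (f k : S1 R -> R[i]).

(** The Cauchy kernel, the sum of the [x^n z^n]: its integral generates the moments. *)
Definition ker z (x : S1 R) : R[i] := (1 - cval x * z)^-1.

Lemma cmod_cvalM (x : S1 R) z : cmod (cval x * z) = cmod z.
Proof. by rewrite cmodM cval_cmod mul1r. Qed.

Lemma ker_neq0 (x : S1 R) z : cmod z < 1 -> 1 - cval x * z != 0.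
Proof. by move=> z1; rewrite one_sub_neq0// cmod_cvalM. Qed.

Lemma bmeas_ker z : cmod z < 1 -> bmeas (ker z).
Proof.
move=> z1; apply: (@bmeas_geometric _ (fun x => cval x * z) (cmod z)) => //.
  by apply: bmeasM; [exact: bmeas_cval|exact: bmeas_cst].
by move=> x; rewrite cmod_cvalM.
Qed.

Lemma bmeas_cvalX n : bmeas (fun x : S1 R => cval x ^+ n).
Proof. by apply: bmeasX; exact: bmeas_cval. Qed.

Lemma cmod_ker z x : cmod z < 1 -> cmod (ker z x) <= (1 - cmod z)^-1.
Proof.
move=> z1; rewrite cmodV lef_pV2 ?posrE ?subr_gt0//.
  by rewrite -(cmod_cvalM x) one_sub_ge.
by rewrite cmod_gt0 ker_neq0.
Qed.

Lemma ker_shift z x : cmod z < 1 -> z * (cval x * ker z x) = ker z x - 1.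
Proof. by move=> z1; rewrite /ker; field; exact: ker_neq0. Qed.

(** The map [w |-> 1 / (1 - w)] sends the unit disk onto the half-plane [Re > 1/2]. *)
Lemma Re_ker z x : cmod z < 1 -> 1 / 2 <= Re (ker z x).
Proof.
move=> z1; have := cmod_cvalM x z; have := ker_neq0 x z1; rewrite /ker.
move: (cval x * z) => w w0 wz.
have : cmod w ^+ 2 <= 1 by rewrite expr_le1 ?cmod_ge0// wz ltW.
rewrite cmod_sqr.
move: w0; rewrite -cmod_gt0 => w0.
have : 0 < cmod (1 - w) ^+ 2 by rewrite exprn_gt0.
rewrite cmod_sqr ReB ImB; case: w w0 wz => a b _ _ /=.
rewrite sub0r => h1 h2.
rewrite ler_pdivlMr// mulrC; nra.
Qed.

Section Measure.
Variable m : {finite_measure set (S1 R) -> \bar R}.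

Definition mom n : R[i] := cintegral m (fun x => cval x ^+ n).
Definition res0 z : R[i] := cintegral m (ker z).
Definition res1 z : R[i] := cintegral m (fun x => cval x * ker z x).

Lemma mom0 : mom 0 = (mass m)%:C.
Proof. by rewrite /mom; under eq_cint do rewrite expr0; rewrite cint_cst mul1r. Qed.

Lemma mom_bound n : cmod (mom n) <= 2 * mass m.
Proof.
rewrite -[2]mulr1; apply: cint_bound; first exact: bmeas_cvalX.
by move=> x; rewrite cmodX cval_cmod expr1n.
Qed.

Lemma bmeas_cval_ker z : cmod z < 1 -> bmeas (fun x => cval x * ker z x).
Proof. by move=> z1; apply: bmeasM; [exact: bmeas_cval|exact: bmeas_ker]. Qed.

(** Dominated convergence for the geometric series. The factor [k] is 1 for [res0] and x for
    [res1]. *)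
Lemma cint_ker_ps k (M : R) z : bmeas k -> (forall x, cmod (k x) <= M) ->
  cmod z < 1 ->
  clim \oo (psum (fun n => cintegral m (fun x => k x * cval x ^+ n)) z)
    (cintegral m (fun x => k x * ker z x)).
Proof.
move=> bk kM z1.
have M0 : 0 <= M by apply: le_trans (kM (cis 0)); exact: cmod_ge0.
have -> : psum (fun n => cintegral m (fun x => k x * cval x ^+ n)) z =
   (fun n => cintegral m (fun x => k x * \sum_(i < n) (cval x * z) ^+ i)).
  apply/funext => n; rewrite /psum.
  transitivity (cintegral m (fun x => \sum_(i < n) z ^+ i * (k x * cval x ^+ i))).
    rewrite (@cint_sum _ m n (fun i x => z ^+ i * (k x * cval x ^+ i))); last first.
      move=> i; apply: bmeasZ; apply: bmeasM => //; exact: bmeas_cvalX.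
    apply: eq_bigr => i _; rewrite cintZ 1?mulrC//.
    by apply: bmeasM => //; exact: bmeas_cvalX.
  apply: eq_cint => x; rewrite mulr_sumr; apply: eq_bigr => i _.
  by rewrite exprMn; ring.
apply: (@cint_lim _ m _ _ (M * (1 - cmod z)^-1)).
- move=> n; apply: bmeasM => //.
  apply: (@bmeas_sum _ n (fun i x => (cval x * z) ^+ i)) => i.
  by apply: bmeasX; apply: bmeasM; [exact: bmeas_cval|exact: bmeas_cst].
- move=> n x; rewrite cmodM ler_pM ?cmod_ge0// cmod_geometric//.
  by rewrite cmod_cvalM.
- move=> x; apply: climM; first exact: clim_cst.
  by apply: clim_geometric; rewrite cmod_cvalM.
Qed.

Lemma res0_ps z : cmod z < 1 -> clim \oo (psum mom z) (res0 z).
Proof.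
move=> z1; have := @cint_ker_ps (fun=> 1) 1 z (bmeas_cst 1) _ z1.
have -> : (fun n => cintegral m (fun x => 1 * cval x ^+ n)) = mom.
  by apply/funext => n; apply: eq_cint => x; rewrite mul1r.
have -> : cintegral m (fun x => 1 * ker z x) = res0 z.
  by apply: eq_cint => x; rewrite mul1r.
by apply => x; rewrite cmod1.
Qed.

Lemma res1_ps z : cmod z < 1 -> clim \oo (psum (fun n => mom n.+1) z) (res1 z).
Proof.
move=> z1; have := @cint_ker_ps (@cval R) 1 z (@bmeas_cval R) _ z1.
have -> : (fun n => cintegral m (fun x => cval x * cval x ^+ n)) = (fun n => mom n.+1).
  by apply/funext => n; apply: eq_cint => x; rewrite exprS.
by apply => x; rewrite cval_cmod.
Qed.

Lemma res1_res0 z : cmod z < 1 -> z * res1 z = res0 z - (mass m)%:C.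
Proof.
move=> z1; rewrite -cintZ; last exact: bmeas_cval_ker.
rewrite -[(mass m)%:C]mul1r -cint_cst -cintB; first last.
- exact: bmeas_cst.
- exact: bmeas_ker.
by apply: eq_cint => x; exact: ker_shift.
Qed.

Lemma Re_res0_ge z : cmod z < 1 -> 1 / 2 * mass m <= Re (res0 z).
Proof.
by move=> z1; apply: Re_cint_ge => [|x]; [exact: bmeas_ker|exact: Re_ker].
Qed.

(** Complex derivatives serve to identify the value at 0 of [F_transform], which is defined through
    an analytic extension. *)
Lemma derivable_cint_ker k (M : R) z : bmeas k -> (forall x, cmod (k x) <= M) ->
  cmod z < 1 ->
  @derivable R[i] R[i]^o R[i]^o (fun z => cintegral m (fun x => k x * ker z x)) z 1.
Proof.
move=> bk kM z1; set d := 1 - cmod z.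
have d0 : 0 < d by rewrite subr_gt0.
have M0 : 0 <= M by apply: le_trans (kM (cis 0)); exact: cmod_ge0.
set L := cintegral m (fun x => k x * (cval x * ker z x ^+ 2)).
set C := 2 * (M * (d^-1 ^+ 2 * (d / 2)^-1)) * mass m.
have C0 : 0 <= C.
  by rewrite !mulr_ge0// ?mass_ge0 ?exprn_ge0 ?invr_ge0 ?ltW// divr_gt0.
apply/cvg_ex; exists L; apply/cvgrPdist_le => e e0.
have [eR [eE]] : exists eR : R, e = eR%:C /\ 0 < eR.
  by case: (ger0_Re (ltW e0)) => h1 _; exists (Re e); split => //; move: e0; rewrite h1 ltcR.
move=> eR0; subst e.
(* The radius [d / 2] keeps [h + z] at distance [d / 2] from the unit circle, where the remainder
   integral is bounded by [C]; the other radius makes [cmod h * C] at most [eR]. *)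
set r := Num.min (d / 2) (eR / (C + 1)).
have C1 : 0 < C + 1 by rewrite ltr_wpDl.
have r0 : 0 < r by rewrite lt_min !divr_gt0.
apply/nbhs_ballP; exists r%:C; first by rewrite /= ltcR.
move=> h; rewrite -ball_normE/= sub0r normrN normE ltcR => hr h0.
have hd : cmod h <= d / 2 by rewrite ltW// (lt_le_trans hr)// ge_min lexx.
have he : cmod h <= eR / (C + 1).
  by rewrite ltW// (lt_le_trans hr)// ge_min lexx orbT.
have zh : cmod (h + z) <= 1 - d / 2.
  by apply: le_trans (cmodD _ _) _; rewrite /d in hd *; lra.
have zh1 : cmod (h + z) < 1.
  by apply: le_lt_trans zh _; rewrite ltrBlDr ltrDl divr_gt0.
have b9 : bmeas (fun x => k x * (cval x ^+ 2 * (ker z x ^+ 2 * ker (h + z) x))).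
  apply: (bmeasM bk); apply: (bmeasM (bmeas_cvalX 2)).
  by apply: bmeasM; [apply: bmeasX; exact: bmeas_ker|exact: bmeas_ker].
(* The exact second-order remainder: the derivative of [ker z] in [z] is [x ker^2], and what is left
   over is [h^2 x^2 ker(z)^2 ker(z + h)]. *)
have E : cintegral m (fun x => k x * ker (h + z) x) -
    cintegral m (fun x => k x * ker z x) - h * L =
    h ^+ 2 * cintegral m (fun x => k x * (cval x ^+ 2 * (ker z x ^+ 2 * ker (h + z) x))).
  have b1 := bmeas_ker zh1; have b2 := bmeas_ker z1.
  have b3 := bmeas_cvalX 2; have b4 := @bmeas_cval R.
  have b5 : bmeas (fun x => ker z x ^+ 2) by apply: bmeasX.
  have b6 : bmeas (fun x => k x * ker (h + z) x) by apply: bmeasM.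
  have b7 : bmeas (fun x => k x * ker z x) by apply: bmeasM.
  have b8 : bmeas (fun x => k x * (cval x * ker z x ^+ 2)).
    by apply: bmeasM => //; apply: bmeasM.
  rewrite -!cintZ -?cintB//; first last.
  - exact: bmeasZ.
  - exact: bmeasB.
  apply: eq_cint => x; rewrite /ker; field.
  by rewrite ker_neq0// ker_neq0.
have hA : h *: (1 : R[i]^o) = h by exact: mulr1.
rewrite /= hA.
have -> : L - h^-1 *: (cintegral m (fun x => k x * ker (h + z) x) -
   cintegral m (fun x => k x * ker z x)) =
   - (h * cintegral m (fun x => k x * (cval x ^+ 2 * (ker z x ^+ 2 * ker (h + z) x)))).
  apply: (mulfI h0); rewrite [_ *: _](_ : _ = h^-1 * (cintegral m (fun x => k x * ker (h + z) x) -
   cintegral m (fun x => k x * ker z x)))//.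
  by rewrite mulrBr mulVKf// mulrN mulrA -expr2 -E; ring.
rewrite normE lecR cmodN cmodM.
have bd : cmod (cintegral m (fun x => k x * (cval x ^+ 2 * (ker z x ^+ 2 * ker (h + z) x)))) <= C.
  apply: cint_bound.
    exact: b9.
  move=> x; rewrite !(cmodM, cmodX) cval_cmod expr1n mul1r.
  rewrite ler_pM ?mulr_ge0 ?exprn_ge0 ?cmod_ge0// ler_pM ?exprn_ge0 ?cmod_ge0//.
    by rewrite lerXn2r ?nnegrE ?cmod_ge0 ?invr_ge0 ?(ltW d0)// cmod_ker.
  apply: le_trans (cmod_ker _ zh1) _.
  by rewrite lef_pV2 ?posrE ?subr_gt0 ?divr_gt0//; lra.
apply: le_trans (_ : eR / (C + 1) * C <= _); first by rewrite ler_pM ?cmod_ge0.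
rewrite mulrAC ler_pdivrMr// ler_pM2l//; lra.
Qed.

Lemma derivable_res0 z : cmod z < 1 -> @derivable R[i] R[i]^o R[i]^o res0 z 1.
Proof.
move=> z1; have -> : res0 = (fun z => cintegral m (fun x => 1 * ker z x)).
  by apply/funext => w; apply: eq_cint => x; rewrite mul1r.
apply: (@derivable_cint_ker _ 1) => //; first exact: bmeas_cst.
by move=> x; rewrite cmod1.
Qed.

Lemma derivable_res1 z : cmod z < 1 -> @derivable R[i] R[i]^o R[i]^o res1 z 1.
Proof.
move=> z1; apply: (@derivable_cint_ker _ 1) => //; first exact: bmeas_cval.
by move=> x; rewrite cval_cmod.
Qed.

Lemma disk_approx_res0 : disk_approx res0.
Proof. exact: (@disk_approx_ps _ mom (2 * mass m)) (mom_bound) res0_ps. Qed.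

Lemma disk_approx_res1 : disk_approx res1.
Proof.
apply: (@disk_approx_ps R (fun n => mom n.+1) (2 * mass m)) => [k|z z1].
  exact: mom_bound.
exact: res1_ps.
Qed.

Lemma res1_0 : res1 0 = mom 1.
Proof.
by apply: eq_cint => x; rewrite /ker mulr0 subr0 invr1 mulr1 expr1.
Qed.

End Measure.

Lemma mom_eq (m1 m2 : {finite_measure set (S1 R) -> \bar R}) (d : R) : 0 < d ->
  (forall z, cmod z < d -> z != 0 -> res0 m1 z = res0 m2 z) ->
  forall n, mom m1 n = mom m2 n.
Proof.
move=> d0 h n; apply/eqP; rewrite -subr_eq0; apply/eqP; move: n.
apply: (@ps_uniq R (fun n => mom m1 n - mom m2 n)
  (2 * mass m1 + 2 * mass m2) (Num.min 1 d)).
- by move=> k; apply: le_trans (cmodB _ _) _; rewrite lerD ?mom_bound.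
- by rewrite lt_min ltr01.
move=> t t0; rewrite lt_min => /andP[t1 td].
have ct : cmod t%:C = t by rewrite cmodR gtr0_norm.
have z1 : cmod t%:C < 1 by rewrite ct.
have -> : psum (fun n => mom m1 n - mom m2 n) t%:C =
    fun n => psum (mom m1) t%:C n - psum (mom m2) t%:C n.
  by apply/funext => n; rewrite /psum -sumrB; apply: eq_bigr => i _; rewrite mulrBl.
have <- : res0 m1 t%:C - res0 m2 t%:C = 0.
  by rewrite h ?subrr ?ct// -cmod_gt0 ct.
by apply: climB; exact: res0_ps.
Qed.

Section Probability.
Variable mu : probability (S1 R) R.

Lemma mass_prob : mass mu = 1.
Proof. by rewrite /mass -[RHS]/(fine 1%E) -(@probability_setT _ _ _ mu). Qed.

(** Since [psi = z * res1] and [1 + psi = res0], the factor [1 / z] of F cancels: this is F without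
    its removable singularity. *)
Definition Ftr z : R[i] := res1 mu z / res0 mu z.

Lemma Re_res0_prob z : cmod z < 1 -> 1 / 2 <= Re (res0 mu z).
Proof. by move=> /(Re_res0_ge mu); rewrite mass_prob mulr1. Qed.

Lemma res0_neq0 z : cmod z < 1 -> res0 mu z != 0.
Proof.
move=> /Re_res0_prob h; apply: contraTneq h => ->.
by rewrite /= -ltNge divr_gt0.
Qed.

(** The bridge between F and the moments: away from 0 each of [Ftr] and [res0] determines the
    other. *)
Lemma zFtr z : cmod z < 1 -> z * Ftr z = 1 - (res0 mu z)^-1.
Proof.
move=> z1; rewrite mulrA res1_res0// mass_prob mulrBl divff ?res0_neq0//.
by rewrite mul1r.
Qed.

Lemma res0_Ftr z : cmod z < 1 -> res0 mu z = (1 - z * Ftr z)^-1.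
Proof. by move=> z1; rewrite zFtr// opprB addrC subrK invrK. Qed.

Lemma F_punctured_Ftr z : cmod z < 1 -> z != 0 -> F_punctured mu z = Ftr z.
Proof.
move=> z1 z0; rewrite /F_punctured.
have -> : psi mu z = z * res1 mu z.
  rewrite -cintZ; last exact: bmeas_cval_ker.
  by apply: eq_cint => x; rewrite /ker mulrA (mulrC z).
have -> : 1 + z * res1 mu z = res0 mu z by rewrite res1_res0// mass_prob addrC subrK.
by rewrite -mulrA mulKf.
Qed.

Lemma Ftr0 : Ftr 0 = mom mu 1.
Proof.
rewrite /Ftr res1_0; have -> : res0 mu 0 = 1; last by rewrite divr1.
have := res1_res0 mu (z := 0); rewrite cmod0 mul0r => /(_ ltr01)/eqP.
by rewrite eq_sym subr_eq0 mass_prob => /eqP.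
Qed.

Lemma Ftr_analytic : analytic_on_disk Ftr.
Proof.
move=> z; rewrite norm_lt1 => z1.
apply: (@derivableM R[i] R[i]^o (res1 mu) (fun z => (res0 mu z)^-1)).
  exact: derivable_res1.
apply: (@derivableV R[i] R[i]^o (res0 mu)); first exact: res0_neq0.
exact: derivable_res0.
Qed.

Lemma F_transformE z : cmod z < 1 -> F_transform mu z = Ftr z.
Proof.
move=> z1; rewrite /F_transform; case: eqVneq => [->|z0]; last first.
  exact: F_punctured_Ftr.
have h0 : F_at0 mu (Ftr 0).
  exists Ftr; split=> //; first exact: Ftr_analytic.
  by move=> w; rewrite norm_gt0 norm_lt1 => /andP[w0 w1]; rewrite F_punctured_Ftr.
apply: xget_unique => // w [G [aG GF <-]].
(* Continuity is enough for uniqueness of the extension: [G] and [Ftr] agree on the punctured disk,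
   hence have the same limit at 0. *)
have cont (H : R[i] -> R[i]) : analytic_on_disk H -> {for (0 : R[i]^o), continuous (H : R[i]^o -> R[i]^o)}.
  move=> aH; apply: differentiable_continuous; apply/derivable1_diffP.
  by apply: aH; rewrite normr0.
have c1 := cont _ aG; have c2 := cont _ Ftr_analytic.
apply: (@cvg_unique _ (@norm_hausdorff _ R[i]^o) ((G : R[i]^o -> R[i]^o) @ (0 : R[i]^o)^')).
- have h : G =1 G by []; apply: cvg_trans; last exact: (@continuous_withinNx _ _ _ _).1 c1.
  by [].
- apply: cvg_trans; last exact: (@continuous_withinNx _ _ _ _).1 c2.
  apply: near_eq_cvg; apply/nbhs_ballP; exists 1 => //= y.
  rewrite -ball_normE/= sub0r normrN => y1 y0.
  by rewrite GF ?norm_gt0 ?y0// F_punctured_Ftr// -norm_lt1.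
Qed.

Lemma disk_approx_Ftr : disk_approx Ftr.
Proof.
apply: disk_approxM; first exact: disk_approx_res1.
by apply: disk_approxV; [exact: disk_approx_res0|exact: Re_res0_prob].
Qed.

(** Nonnegativity of the variance, the integral of [|f - c|^2] with [c] the mean of [f]. *)
Lemma cint_var f : bmeas f ->
  cmod (cintegral mu f) ^+ 2 <= Re (cintegral mu (fun x => f x * (f x)^*)).
Proof.
move=> bf; set c := cintegral mu f.
have bJ := bmeasJ bf.
have : 0 * mass mu <= Re (cintegral mu (fun x => (f x - c) * (f x - c)^*)).
  apply: Re_cint_ge.
    apply: bmeasM; [|apply: bmeasJ]; apply: bmeasB => //; exact: bmeas_cst.
  by move=> x; rewrite mulcJ/= exprn_ge0// cmod_ge0.
have -> : cintegral mu (fun x => (f x - c) * (f x - c)^*) =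
    cintegral mu (fun x => f x * (f x)^*) - c * c^*.
  have b1 : bmeas (fun x => f x * (f x)^*) by exact: bmeasM.
  have b2 : bmeas (fun x => c^* * f x) by exact: bmeasZ.
  have b3 : bmeas (fun x => c * (f x)^*) by exact: bmeasZ.
  transitivity (cintegral mu (fun x => (f x * (f x)^* - c^* * f x) - (c * (f x)^* - c * c^*))).
    by apply: eq_cint => x; rewrite rmorphB/=; ring.
  have b4 := bmeas_cst (c * c^*).
  rewrite cintB ?cintB//; [|exact: bmeasB|exact: bmeasB].
  have e1 := cintZ mu c^* bf; have e2 := cintZ mu c bJ; have e3 := cintJ mu bf.
  by rewrite e1 e2 e3 cint_cst mass_prob -/c; ring.
by rewrite mul0r mulcJ ReB/= subr_ge0.
Qed.

(** Let [N] be the integral of [|ker|^2]. Integrating [|ker - 1|^2 = |z|^2 |ker|^2] gives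
    [(1 - |z|^2) N = 2 Re res0 - 1], so [|z res1|^2 = |res0 - 1|^2 = |res0|^2 - (1 - |z|^2) N].
    Since [N >= |res0|^2] by [cint_var], this is at most [|z res0|^2]. At [z = 0] the claim is that
    a first moment has modulus at most 1. *)
Lemma cmod_Ftr z : cmod z < 1 -> cmod (Ftr z) <= 1.
Proof.
move=> z1; rewrite /Ftr cmodM cmodV ler_pdivrMr ?cmod_gt0 ?res0_neq0// mul1r.
have bk := bmeas_ker z1; have bck := bmeas_cval_ker z1.
rewrite -(@ler_sqr R) ?nnegrE ?cmod_ge0//.
have [->|z0] := eqVneq z 0.
  have h := cint_var bck; move: h; rewrite res1_0.
  have := cint_var (@bmeas_cval R).
  have -> : cintegral mu (fun x => cval x * (cval x)^*) = 1.
    by rewrite (eq_cint _ (@cvalJ R)) cint_cst mass_prob mulr1.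
  rewrite /=.
  have -> : cintegral mu (@cval R) = mom mu 1 by apply: eq_cint => x; rewrite expr1.
  have -> : res0 mu 0 = 1.
    have := res1_res0 mu (z := 0); rewrite cmod0 mul0r => /(_ ltr01)/eqP.
    by rewrite eq_sym subr_eq0 mass_prob => /eqP.
  by rewrite cmod1 expr1n.
have h1 := cint_var bk; rewrite -/(res0 mu z) in h1.
set N := Re (cintegral mu _) in h1.
have hz := res1_res0 mu z1; rewrite mass_prob in hz.
have hN : N - 2 * Re (res0 mu z) + 1 = cmod z ^+ 2 * N.
  have bJ := bmeasJ bk; have b1 := bmeasM bk bJ.
  have : cintegral mu (fun x => (ker z x * (ker z x)^* - ker z x) - ((ker z x)^* - 1)) =
     (cmod z ^+ 2)%:C * cintegral mu (fun x => ker z x * (ker z x)^*).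
    rewrite -cintZ//; apply: eq_cint => x.
    transitivity ((ker z x - 1) * (ker z x - 1)^*).
      by rewrite rmorphB rmorph1; ring.
    rewrite -mulcJ -ker_shift// !rmorphM/=.
    transitivity (z * z^* * (ker z x * (ker z x)^*) * (cval x * (cval x)^*)); first by ring.
    by rewrite cvalJ mulr1.
  rewrite cintB ?cintB ?cintJ//; [|exact: bmeas_cst|exact: bmeasB|].
  2: by apply: bmeasB => //; exact: bmeas_cst.
  rewrite cint_cst mass_prob mulr1 => /(congr1 (@complex.Re R)).
  rewrite /N /res0; case: (cintegral mu (fun x => ker z x * (ker z x)^*)) => a b.
  by case: (cintegral mu (ker z)) => c d /=; rewrite mul0r subr0 => <-; ring.
have hd : cmod z ^+ 2 * cmod (res1 mu z) ^+ 2 = cmod (res0 mu z) ^+ 2 - 2 * Re (res0 mu z) + 1.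
  rewrite -exprMn -cmodM hz !cmod_sqr ReB ImB /=; ring.
have z2 : 0 < cmod z ^+ 2 by rewrite exprn_gt0// cmod_gt0.
have z3 : cmod z ^+ 2 < 1 by rewrite expr_lt1// cmod_ge0.
rewrite -(ler_pM2l z2); nra.
Qed.

End Probability.
End Resolvent.

(** * Herglotz's theorem *)

Section ImageMeasure.
Context d1 d2 (T1 : measurableType d1) (T2 : measurableType d2) (R : realType).
Variables (m : {finite_measure set T1 -> \bar R}) (f : {mfun T1 >-> T2}).

Definition image_measure : set T2 -> \bar R := pushforward m f.

Let image_measure0 : image_measure set0 = 0%E.
Proof. exact: measure0. Qed.

Let image_measure_ge0 A : (0 <= image_measure A)%E.
Proof. exact: measure_ge0. Qed.

Let image_measure_sigma_additive : semi_sigma_additive image_measure.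
Proof. exact: measure_semi_sigma_additive. Qed.

HB.instance Definition _ := isMeasure.Build _ _ _ image_measure
  image_measure0 image_measure_ge0 image_measure_sigma_additive.

Let fin_image_measure : fin_num_fun image_measure.
Proof.
move=> A mA; apply: fin_num_measure; rewrite -[X in measurable X]setTI.
exact: measurable_funP.
Qed.

HB.instance Definition _ :=
  Measure_isFinite.Build _ _ _ image_measure fin_image_measure.

End ImageMeasure.

Section ProbabilityOfMass.
Context d (T : measurableType d) (R : realType).
Variables (m : {finite_measure set T -> \bar R}) (m1 : m setT = 1%E).

(** The proof of unit mass is an argument so that the probability structure can be attached to the
    name. *)
Definition prob_of_mass & m setT = 1%E : set T -> \bar R := m.

HB.instance Definition _ := Measure.on (prob_of_mass m1).
HB.instance Definition _ := Measure_isProbability.Build _ _ _ (prob_of_mass m1) m1.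

End ProbabilityOfMass.

Section Interval.
Variables (R : realType) (c : R).
Local Notation leb := (@lebesgue_measure R).

Let m0c : measurable (`[0, c[%classic : set (measurableTypeR R)).
Proof. exact: measurable_itv. Qed.
Let fin0c : (leb (`[0%R, c[%classic : set R) < +oo)%E.
Proof. by rewrite lebesgue_measure_itv/=; case: ifP => _; rewrite ?ltry. Qed.

(** Lebesgue measure on [[0, c[], of mass [c] when [c >= 0]. Measures on the circle are built as its
    images under quantile functions. *)
Definition itv_measure : set (measurableTypeR R) -> \bar R := mfrestr m0c fin0c.
HB.instance Definition _ := FiniteMeasure.on itv_measure.

Lemma itv_measure_itv (a b : R) : 0 <= a -> a <= b -> b <= c ->
  itv_measure `[a, b[%classic = (b - a)%:E.
Proof.
move=> a0 ab bc; rewrite /itv_measure /mfrestr /mrestr.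
rewrite (_ : `[a, b[%classic `&` `[0, c[%classic = `[a, b[%classic); last first.
  apply/seteqP; split => x /=; first by case.
  by rewrite !in_itv/= => /andP[ax xb]; rewrite ax xb (le_trans a0) ?(lt_le_trans xb).
rewrite lebesgue_measure_itv/= lte_fin; case: ifP => //.
by move/negbT; rewrite -leNgt => ba; rewrite (@le_anti _ _ a b) ?ab// subrr.
Qed.

Lemma itv_measure_out : itv_measure (~` `[0, c[%classic) = 0%E.
Proof. by rewrite /itv_measure /mfrestr /mrestr setICl measure0. Qed.

Lemma itv_integrable (D : set (measurableTypeR R)) (h : measurableTypeR R -> R) (M : R) :
  measurable D -> measurable_fun setT h -> (forall x, `|h x| <= M) ->
  itv_measure.-integrable D (EFin \o h).
Proof.
move=> mD mh hM; apply: measurable_bounded_integrable => //.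
- by rewrite -ge0_fin_numE// fin_num_measure.
- exact: measurable_funTS.
- exists M; split; first exact: num_real.
  by move=> N MN x _; rewrite /= (le_trans (hM x))// ltW.
Qed.

Lemma itv_integral_bound (D : set (measurableTypeR R)) (h : measurableTypeR R -> R) (M a e : R) :
  measurable D -> measurable_fun setT h -> (forall x, `|h x| <= M) ->
  (forall x, D x -> `|h x - a| <= e) ->
  `|\int[itv_measure]_(x in D) h x - a * fine (itv_measure D)|
     <= e * fine (itv_measure D).
Proof.
move=> mD mh hM he.
have i1 := itv_integrable mD mh hM.
have ic b : itv_measure.-integrable D (EFin \o (fun=> b)).
  by apply: (@itv_integrable _ _ `|b|).
rewrite -Rintegral_cst// -RintegralB//.
have mh' : measurable_fun setT (fun x => h x - a).
  by apply: measurable_funB.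
have hM' x : `|h x - a| <= M + `|a| by apply: le_trans (ler_normB _ _) _; rewrite lerD.
have i2 := itv_integrable mD mh' hM'.
apply: le_trans (le_normr_Rintegral mD i2) _.
rewrite -Rintegral_cst//; apply: le_Rintegral => //.
apply: (@itv_integrable _ _ (M + `|a|)) => // [|x].
  exact: measurableT_comp.
by rewrite normr_id.
Qed.

(** Used twice: with equal cells, the errors being oscillations of a monotone function, and with
    cells given by cumulated weights, where the errors are 0. *)
Lemma partition_integral (h : measurableTypeR R -> R) (M : R) (t a e : nat -> R) n :
  measurable_fun setT h -> (forall x, `|h x| <= M) ->
  t 0%N = 0 -> {homo t : i j / (i <= j)%N >-> i <= j} -> t n <= c ->
  (forall i x, (i < n)%N -> t i <= x < t i.+1 -> `|h x - a i| <= e i) ->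
  `|\int[itv_measure]_(x in `[0, t n[%classic) h x - \sum_(i < n) (t i.+1 - t i) * a i|
    <= \sum_(i < n) (t i.+1 - t i) * e i.
Proof.
move=> mh hM t0 tmon; elim: n => [|n IH] tc he.
  by rewrite !big_ord0 t0 set_itvco0 Rintegral_set0 subrr normr0.
have tn : 0 <= t n by rewrite -t0 tmon.
have tn1 : t n <= t n.+1 by rewrite tmon.
have tnc : t n <= c by exact: le_trans tc.
have -> : `[0, t n.+1[%classic = `[0, t n[%classic `|` `[t n, t n.+1[%classic :> set (measurableTypeR R).
  apply/seteqP; split=> x /=; rewrite !in_itv/=.
    by move=> /andP[x0 xt]; have [h1|h1] := ltP x (t n); [left; rewrite x0|right].
  by move=> [/andP[x0 xt]|/andP[x0 xt]]; rewrite ?x0 ?xt ?(lt_le_trans xt)// (le_trans tn).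
rewrite Rintegral_setU//; last 2 first.
- by apply: (itv_integrable _ mh hM); apply: measurableU; exact: measurable_itv.
- rewrite disj_set2E; apply/eqP/seteqP; split=> x //=; rewrite !in_itv/= => -[/andP[_ h1] /andP[h2 _]].
  by move: h1; rewrite ltNge h2.
rewrite !big_ord_recr/=.
have h1 := IH tnc (fun i x ni => he i x (ltnW ni)).
have := @itv_integral_bound `[t n, t n.+1[%classic h M (a n) (e n) _ mh hM _.
rewrite itv_measure_itv//= => h2.
have {}h2 := h2 (measurable_itv _).
have -> : \int[itv_measure]_(x in `[0, t n[%classic) h x + \int[itv_measure]_(x in `[t n, t n.+1[%classic) h x -
  (\sum_(i < n) (t i.+1 - t i) * a i + (t n.+1 - t n) * a n) =
  (\int[itv_measure]_(x in `[0, t n[%classic) h x - \sum_(i < n) (t i.+1 - t i) * a i) +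
  (\int[itv_measure]_(x in `[t n, t n.+1[%classic) h x - a n * (t n.+1 - t n)) by ring.
apply: le_trans (ler_normD _ _) _; apply: lerD => //.
rewrite (mulrC _ (e n)); apply: h2 => x /=; rewrite in_itv/=; exact: he.
Qed.

Lemma itv_integralT (h : measurableTypeR R -> R) (M : R) :
  measurable_fun setT h -> (forall x, `|h x| <= M) ->
  \int[itv_measure]_x h x = \int[itv_measure]_(x in `[0, c[%classic) h x.
Proof.
move=> mh hM; have mD : measurable (`[0, c[%classic : set (measurableTypeR R)).
  exact: measurable_itv.
rewrite -(setUv `[0, c[%classic) Rintegral_setU//; last 3 first.
- exact: measurableC.
- by rewrite setUv; exact: (itv_integrable _ mh hM).
- by rewrite disj_set2E setICr.
have := @itv_integral_bound (~` `[0, c[%classic) h M 0 M (measurableC mD) mh hM _.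
rewrite itv_measure_out/= mulr0 mulr0 subr0 => h1.
have /h1 : forall x, (~` `[0, c[%classic) x -> `|h x - 0| <= M by move=> x _; rewrite subr0.
by rewrite normr_le0 => /eqP ->; rewrite addr0.
Qed.

End Interval.

Lemma cvgr_sum (R : realType) (T : Type) (F : set_system T) {FF : Filter F} n
    (f : nat -> T -> R) (l : nat -> R) :
  (forall i, f i t @[t --> F] --> l i) ->
  \sum_(i < n) f i t @[t --> F] --> \sum_(i < n) l i.
Proof.
move=> h; elim: n => [|n IH].
  by rewrite big_ord0; under eq_fun do rewrite big_ord0; exact: cvg_cst.
rewrite big_ord_recr; under eq_fun do rewrite big_ord_recr.
exact: cvgD.
Qed.

(** * Quantile functions and their ultralimits *)

Section LipschitzMonotone.
Variables (R : realType) (c : R) (c0 : 0 <= c).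

Definition lipschitzR (g : R -> R) (L : R) := forall x y, `|g x - g y| <= L * `|x - y|.

Section OneMonotone.
Variables (q g : R -> R) (L M : R).
Hypotheses (L0 : 0 <= L) (qmon : {homo q : x y / x <= y})
  (q0 : forall x, 0 <= q x <= 2 * pi) (gL : lipschitzR g L) (mg : measurable_fun setT g)
  (gM : forall x, `|g x| <= M).

Lemma measurable_comp_monotone : measurable_fun [set: measurableTypeR R] (g \o q).
Proof. by apply: measurableT_comp => //; exact: nondecreasing_measurable. Qed.

(** On each cell [g \o q] varies by at most [L] times the increment of [q], and the increments
    telescope to at most [2 pi]. The bound depends on [q] only through its range, hence is uniform
    over all quantile functions. *)
Lemma riemann_sum_monotone n : (0 < n)%N ->
  `|\int[itv_measure c]_x g (q x) - \sum_(i < n) c / n%:R * g (q (c / n%:R * i%:R))|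
   <= c / n%:R * (L * (2 * pi)).
Proof.
move=> n0; have nr : 0 < n%:R :> R by rewrite ltr0n.
set d := c / n%:R; have d0 : 0 <= d by rewrite divr_ge0// ltW.
have dn : d * n%:R = c by rewrite /d mulfVK// gt_eqF.
rewrite (itv_integralT (M := M) _ measurable_comp_monotone); last by move=> x; exact: gM.
have hS i : d * i.+1%:R - d * i%:R = d by rewrite -mulrBr -natrB// subSnn mulr1.
have hmon : {homo (fun i : nat => d * i%:R) : i j / (i <= j)%N >-> i <= j}.
  by move=> i j ij; rewrite ler_wpM2l// ler_nat.
have herr i x : (i < n)%N -> d * i%:R <= x < d * i.+1%:R ->
    `|g (q x) - g (q (d * i%:R))| <= L * (q (d * i.+1%:R) - q (d * i%:R)).
  move=> _ /andP[x1 x2]; apply: le_trans (gL _ _) _.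
  by rewrite ler_wpM2l// ger0_norm ?subr_ge0 ?qmon// lerB// qmon// ltW.
have tc : d * n%:R <= c by rewrite dn.
have := @partition_integral R c (fun x => g (q x)) M (fun i => d * i%:R)
  (fun i => g (q (d * i%:R))) _ n measurable_comp_monotone (fun x => gM _)
  (mulr0 _) hmon tc herr.
rewrite dn.
rewrite (eq_bigr (fun i : 'I_n => d * g (q (d * i%:R)))); last by move=> i _; rewrite hS.
rewrite [X in _ <= X -> _](eq_bigr (fun i : 'I_n => d * (L * (q (d * i.+1%:R) - q (d * i%:R))))); last by move=> i _; rewrite hS.
move/le_trans; apply; rewrite -!mulr_sumr.
rewrite ler_wpM2l// ler_wpM2l//.
  rewrite (_ : \sum_(i < n) _ = q (d * n%:R) - q (d * 0%:R)).
    by have := q0 (d * n%:R); have := q0 (d * 0%:R); lra.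
  move: (d) => d'; elim: (n) => [|k IH]; first by rewrite big_ord0 subrr.
  by rewrite big_ord_recr/= IH; ring.
Qed.

End OneMonotone.

Section StepFunction.
Variables (K : nat) (w : nat -> R).
Hypotheses (K0 : (0 < K)%N) (w0 : forall j, 0 <= w j) (wc : \sum_(j < K) w j = c).

Definition cumw n : R := \sum_(j < n) w j.
(** The quantile function of the discrete measure with mass [w j] at the angle [2 pi j / K]: it
    counts the cumulated weights not exceeding [x]. *)
Definition stepq (x : R) : R :=
  2 * pi / K%:R * (\sum_(j < K) (cumw j.+1 <= x)%R)%N%:R.

Lemma cumw_mon : {homo cumw : i j / (i <= j)%N >-> i <= j}.
Proof.
move=> i j ij; rewrite -(subnKC ij); elim: (j - i)%N => [|k IH]; first by rewrite addn0.
by rewrite addnS; apply: le_trans IH _; rewrite /cumw big_ord_recr/= lerDl.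
Qed.

Lemma stepq_mon : {homo stepq : x y / x <= y}.
Proof.
move=> x y xy; rewrite /stepq ler_wpM2l ?divr_ge0 ?mulr_ge0 ?pi_ge0//.
rewrite ler_nat leq_sum// => j _.
by case: (leP _ x) => //= h; rewrite (le_trans h xy).
Qed.

Lemma stepq_itv x : 0 <= stepq x <= 2 * pi.
Proof.
have p0 : 0 <= 2 * pi :> R by rewrite mulr_ge0 ?pi_ge0.
rewrite /stepq mulr_ge0 ?divr_ge0//=.
rewrite -[leRHS]mulr1 -mulrA ler_wpM2l// mulrC ler_pdivrMr ?ltr0n// mul1r ler_nat.
apply: leq_trans (_ : \sum_(j < K) 1 <= _)%N; last by rewrite sum1_card card_ord.
by apply: leq_sum => j _; case: leP.
Qed.

Lemma stepqE i x : (i < K)%N -> cumw i <= x < cumw i.+1 -> stepq x = 2 * pi / K%:R * i%:R.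
Proof.
move=> iK /andP[x1 x2]; rewrite /stepq; congr (_ * _%:R).
transitivity (\sum_(j < K) (j < i))%N.
  apply: eq_bigr => j _; congr nat_of_bool; apply/idP/idP.
    by apply: contraTT; rewrite -leqNgt -ltNge => ij; apply: lt_le_trans x2 _; exact: cumw_mon.
  by move=> ji; apply: le_trans x1; exact: cumw_mon.
rewrite -(subnKC (ltnW iK)) big_split_ord/= [X in (_ + X)%N]big1 ?addn0; last first.
  by move=> j _; rewrite /= ltnNge leq_addr.
under eq_bigr do rewrite ltn_ord.
by rewrite sum1_card card_ord.
Qed.

Lemma step_integral (g : R -> R) (M : R) : measurable_fun setT g -> (forall x, `|g x| <= M) ->
  \int[itv_measure c]_x g (stepq x) = \sum_(j < K) w j * g (2 * pi / K%:R * j%:R).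
Proof.
move=> mg gM.
have mgq : measurable_fun [set: measurableTypeR R] (fun x => g (stepq x)).
  by apply: measurableT_comp => //; apply: nondecreasing_measurable => //; exact: stepq_mon.
rewrite (itv_integralT (M := M) _ mgq)//.
have cw0 : cumw 0 = 0 by rewrite /cumw big_ord0.
have cwK : cumw K <= c by rewrite /cumw wc.
have herr i x : (i < K)%N -> cumw i <= x < cumw i.+1 ->
    `|g (stepq x) - g (2 * pi / K%:R * i%:R)| <= 0.
  by move=> iK hx; rewrite (stepqE iK hx) subrr normr0.
have := @partition_integral R c (fun x => g (stepq x)) M cumw
  (fun i => g (2 * pi / K%:R * i%:R)) (fun=> 0) K mgq (fun x => gM _) cw0 cumw_mon cwK herr.
rewrite [X in _ <= X -> _]big1; last by move=> i _; rewrite mulr0.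
rewrite normr_le0 subr_eq0 [X in `[0, X[%classic]/cumw wc => /eqP ->.
by apply: eq_bigr => i _; rewrite /cumw big_ord_recr/=; congr (_ * _); ring.
Qed.

End StepFunction.

(* Pointwise ultralimits of the quantile functions [stepq]; the Riemann sums of
   monotone functions are uniformly close to their integrals, so no dominated
   convergence along the ultrafilter is needed. *)
Lemma ultralimit_integral (U : set_system nat) (UF : UltraFilter U)
  (K : nat -> nat) (w : nat -> nat -> R) :
  (forall n, (0 < K n)%N) -> (forall n j, 0 <= w n j) ->
  (forall n, \sum_(j < K n) w n j = c) ->
  exists q : R -> R, {homo q : x y / x <= y} /\
   forall (g : R -> R) (L M l : R), 0 <= L -> lipschitzR g L -> measurable_fun setT g ->
     continuous g -> (forall x, `|g x| <= M) ->
     (\sum_(j < K n) w n j * g (2 * pi / (K n)%:R * j%:R) @[n --> U] --> l) ->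
     \int[itv_measure c]_x g (q x) = l.
Proof.
move=> K0 w0 wc.
have hq x : exists l : R, stepq (K n) (w n) x @[n --> U] --> l.
  apply: (ulim_ex UF (M := 2 * pi)) => n.
  by have /andP[h1 h2] := stepq_itv (w n) (K0 n) x; rewrite ger0_norm.
have [q {}hq] := choice hq.
have qmon : {homo q : x y / x <= y}.
  move=> x y xy; apply: (ler_cvg_to (hq x) (hq y)).
  by apply: nearW => n; apply: stepq_mon.
have q0 x : 0 <= q x <= 2 * pi.
  apply/andP; split.
    apply: (cvgr_to_ge (hq x)); apply: nearW => n.
    by case/andP: (stepq_itv (w n) (K0 n) x).
  apply: (cvgr_to_le (hq x)); apply: nearW => n.
  by case/andP: (stepq_itv (w n) (K0 n) x).
exists q; split=> // g L M l L0 gL mg cg gM hl.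
apply/eqP; rewrite -subr_eq0 -normr_le0; apply/ler_addgt0Pl => e e0; rewrite addr0.
set B := L * (2 * pi); have B0 : 0 <= B by rewrite mulr_ge0// mulr_ge0// pi_ge0.
(* The mesh is fixed before the limit along [U]. A Riemann sum with [N] points involves finitely
   many values of the quantile functions, so it passes to the limit, and the two Riemann errors add
   up to at most [e]. *)
pose N := (Num.truncn (2 * c * B / e)).+1.
have N0 : 0 < N%:R :> R by rewrite ltr0n.
have hN : 2 * (c / N%:R * B) <= e.
  have : 2 * c * B / e < N%:R by rewrite truncnS_gt.
  rewrite ltr_pdivrMr// => /ltW h.
  have -> : 2 * (c / N%:R * B) = 2 * c * B / N%:R by ring.
  by rewrite ler_pdivrMr// (mulrC e).
set S := fun f : R -> R => \sum_(i < N) c / N%:R * g (f (c / N%:R * i%:R)).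
have h1 : `|\int[itv_measure c]_x g (q x) - S q| <= c / N%:R * B.
  exact: (@riemann_sum_monotone q g L M).
have h2 n : `|\sum_(j < K n) w n j * g (2 * pi / (K n)%:R * j%:R) - S (stepq (K n) (w n))|
    <= c / N%:R * B.
  rewrite -(@step_integral (K n) (w n) (w0 n) (wc n) g M mg gM).
  apply: (@riemann_sum_monotone _ g L M) => //; first exact: stepq_mon.
  by move=> x; exact: stepq_itv.
have h3 : `|l - S q| <= c / N%:R * B.
  have hc : (\sum_(j < K n) w n j * g (2 * pi / (K n)%:R * j%:R) - S (stepq (K n) (w n)))
      @[n --> U] --> l - S q.
    apply: cvgB => //; rewrite /S; apply: (@cvgr_sum R _ U _ N (fun i n => c / N%:R * g (stepq (K n) (w n) (c / N%:R * i%:R)))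
      (fun i => c / N%:R * g (q (c / N%:R * i%:R)))) => i; apply: cvgMl_tmp.
    exact: (cvg_comp _ _ (hq _) (cg _)).
  apply: (cvgr_to_le (cvg_norm hc)); apply: nearW; exact: h2.
have -> : \int[itv_measure c]_x g (q x) - l = (\int[itv_measure c]_x g (q x) - S q) - (l - S q) by ring.
by apply: le_trans (ler_normB _ _) _; lra.
Qed.

End LipschitzMonotone.

(** * Discrete Fourier analysis on the roots of unity *)

Section RootsOfUnity.
Variable R : realType.

Definition cisC (t : R) : R[i] := cos t +i* sin t.

Lemma cval_cis t : cval (cis t) = cisC t. Proof. by []. Qed.

Lemma cisCX t n : cisC t ^+ n = cisC (n%:R * t).
Proof.
elim: n => [|n IH]; first by rewrite expr0 mul0r /cisC cos0 sin0.
rewrite exprS IH -natr1 mulrDl mul1r /cisC cosD sinD.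
by apply: complex_eq; rewrite /=; ring.
Qed.

Lemma cmod_cisC t : cmod (cisC t) = 1. Proof. exact: cmod_cis. Qed.

Lemma cisCJ t : (cisC t)^* * cisC t = 1.
Proof. by rewrite mulrC mulcJ cmod_cisC expr1n. Qed.

Lemma cisC_neq1 t : 0 < t < 2 * pi -> cisC t != 1.
Proof.
move=> /andP[t0 t1]; apply/eqP => /(congr1 (@complex.Re R)) /= h.
have s0 : 0 < sin (t / 2).
  by apply: sin_gt0_pi; rewrite divr_gt0//= ltr_pdivrMr// mulrC.
have : cos t = 1 - sin (t / 2) ^+ 2 *+ 2.
  by rewrite {1}[t]splitr cosD -!expr2 cos2sin2; ring.
by rewrite h => /eqP; rewrite eq_sym subr_eq addrC -subr_eq subrr eq_sym mulrn_eq0/= sqrf_eq0 gt_eqF.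
Qed.

Variables (K : nat) (K0 : (0 < K)%N).
Definition root_of_unity (j : nat) : R[i] := cisC (2 * pi / K%:R * j%:R).
Local Notation om := root_of_unity.

Let Kr0 : K%:R != 0 :> R. Proof. by rewrite pnatr_eq0 -lt0n. Qed.

Lemma sum_root_of_unity a : (0 < a < K)%N -> \sum_(j < K) om j ^+ a = 0.
Proof.
move=> /andP[a0 aK]; set v := cisC (2 * pi / K%:R * a%:R).
have E j : om j ^+ a = v ^+ j by rewrite /om /v !cisCX; congr cisC; ring.
under eq_bigr do rewrite E.
have v1 : v != 1.
  apply: cisC_neq1; rewrite mulr_gt0 ?divr_gt0 ?mulr_gt0 ?pi_gt0 ?ltr0n//=.
  by rewrite -mulrA gtr_pMr ?mulr_gt0 ?pi_gt0// mulrC ltr_pdivrMr ?ltr0n// mul1r ltr_nat.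
have vK : v ^+ K = 1.
  rewrite /v cisCX; have -> : K%:R * (2 * pi / K%:R * a%:R) = a%:R * (pi *+ 2) :> R.
    by rewrite -mulr_natr; field.
  rewrite -cisCX; have -> : cisC (pi *+ 2) = 1.
    by rewrite /cisC mulr2n cosDpi sinDpi cospi sinpi opprK oppr0.
  by rewrite expr1n.
have := geometric_sub K v1; rewrite vK mul1r => /eqP.
by rewrite -subr_eq0 addrAC subrr sub0r oppr_eq0 => /eqP.
Qed.

Lemma root_of_unity_orth l k : (l < K)%N -> (k < K)%N ->
  \sum_(j < K) (om j)^* ^+ l * om j ^+ k = (l == k)%:R * K%:R.
Proof.
have E j i : (om j)^* ^+ i * om j ^+ i = 1 by rewrite -exprMn cisCJ expr1n.
move=> lK kK; have [lk|kl|->] := ltngtP l k.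
- rewrite mul0r; under eq_bigr => j _.
    rewrite [om j ^+ k](_ : _ = om j ^+ l * om j ^+ (k - l)); last first.
      by rewrite -exprD subnKC// ltnW.
    rewrite mulrA E mul1r; over.
  by apply: sum_root_of_unity; rewrite subn_gt0 lk (leq_ltn_trans (leq_subr _ _)).
- rewrite mul0r.
  transitivity ((\sum_(j < K) om j ^+ (l - k))^*).
    rewrite rmorph_sum/=; apply: eq_bigr => j _.
    by rewrite rmorphXn/= [_ ^+ l](_ : _ = (om j)^* ^+ (l - k) * (om j)^* ^+ k) ?[_ * _ ^+ k * _ ^+ k]mulrA -?mulrA ?E ?mulr1// -exprD subnK// ltnW.
  rewrite sum_root_of_unity ?rmorph0// subn_gt0 kl/=.
  by rewrite (leq_ltn_trans (leq_subr _ _)).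
- by rewrite mul1r; under eq_bigr do rewrite E; rewrite sumr_const card_ord.
Qed.

(** The Herglotz density of [p] on the circle of radius [r], sampled at [K] points. The conjugate
    makes the k-th moment, rather than its conjugate, pick the coefficient of index [k]. *)
Definition disc_weight (p : {poly R[i]}) (r : R) (j : nat) : R :=
  Re p.[r%:C * (om j)^*] / K%:R.

(** Write [Re p] as half of [p] plus its conjugate. Orthogonality selects the coefficient of index
    [k] from [p]; the conjugate contributes to [k = 0] only, because [k + size p <= K] excludes
    aliasing. *)
Lemma disc_moment (p : {poly R[i]}) r k : (k + size p <= K)%N -> (k < K)%N ->
  \sum_(j < K) (disc_weight p r j)%:C * om j ^+ k =
  (p`_k * r%:C ^+ k + (k == 0%N)%:R * (p`_0)^*) / 2.
Proof.
move=> kK kK'; have KC : K%:R != 0 :> R[i] by rewrite pnatr_eq0 -lt0n.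
have sK : (size p <= K)%N by apply: leq_trans kK; exact: leq_addl.
have E1 j : p.[r%:C * (om j)^*] = \sum_(l < K) p`_l * r%:C ^+ l * (om j)^* ^+ l.
  rewrite horner_coef (big_ord_widen K (fun l => p`_l * (r%:C * (om j)^*) ^+ l))//.
  rewrite big_mkcond/=; apply: eq_bigr => l _; case: ltnP => h.
    by rewrite exprMn mulrA.
  by rewrite nth_default// !mul0r.
have E2 j : (disc_weight p r j)%:C * om j ^+ k =
   ((\sum_(l < K) p`_l * r%:C ^+ l * ((om j)^* ^+ l * om j ^+ k)) +
    (\sum_(l < K) (p`_l)^* * r%:C ^+ l * (om j ^+ l * om j ^+ k))) / (2 * K%:R).
  rewrite /disc_weight rmorphM/= fmorphV/= rmorph_nat.
  have -> : (Re p.[r%:C * (om j)^*])%:C = (p.[r%:C * (om j)^*] + (p.[r%:C * (om j)^*])^*) / 2.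
    exact: ReJ_add.
  rewrite E1 rmorph_sum/=.
  have -> : \sum_(l < K) p`_l * r%:C ^+ l * ((om j)^* ^+ l * om j ^+ k) =
    (\sum_(l < K) p`_l * r%:C ^+ l * (om j)^* ^+ l) * om j ^+ k.
    by rewrite mulr_suml; apply: eq_bigr => l _; rewrite !mulrA.
  have -> : \sum_(l < K) (p`_l)^* * r%:C ^+ l * (om j ^+ l * om j ^+ k) =
    (\sum_(l < K) (p`_l * r%:C ^+ l * (om j)^* ^+ l)^*) * om j ^+ k.
    rewrite mulr_suml; apply: eq_bigr => l _.
    by rewrite !conjCM !conjCX conjCR conjCK !mulrA.
  by field; rewrite KC.
under eq_bigr do rewrite E2.
rewrite -mulr_suml big_split/= exchange_big/= [X in _ + X]exchange_big/=.
under eq_bigr do rewrite -mulr_sumr root_of_unity_orth//.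
rewrite (bigD1 (Ordinal kK'))//= eqxx mul1r big1 ?addr0; last first.
  move=> l; rewrite -val_eqE/= => /negbTE ->; by rewrite mul0r mulr0.
have -> : \sum_(l < K) \sum_(j < K) (p`_l)^* * r%:C ^+ l * (om j ^+ l * om j ^+ k) =
    (k == 0%N)%:R * (p`_0)^* * K%:R.
  rewrite (bigD1 (Ordinal K0))//= [X in _ + X]big1 ?addr0; last first.
    move=> l; rewrite -val_eqE/= => l0; rewrite -mulr_sumr.
    have [ls|ls] := leqP (size p) l; first by rewrite nth_default// conjC0 !mul0r.
    under eq_bigr do rewrite -exprD.
    rewrite sum_root_of_unity ?mulr0// addn_gt0 lt0n l0/=.
    by rewrite (leq_trans _ kK)// addnC ltn_add2l.
  under eq_bigr do rewrite !expr0 mul1r mulr1.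
  rewrite -mulr_sumr; case: (posnP k) => [->|k0].
    by under eq_bigr do rewrite expr0; rewrite sumr_const card_ord mul1r.
  by rewrite sum_root_of_unity ?k0// mulr0 !mul0r.
by field; rewrite KC.
Qed.

End RootsOfUnity.

(** * Limits of discrete measures and the representation theorem *)

Section Herglotz.
Variable R : realType.

Lemma cint_image (B : {finite_measure set (measurableTypeR R) -> \bar R})
  (phi : {mfun measurableTypeR R >-> S1 R}) (f : S1 R -> R[i]) : bmeas f ->
  cintegral (image_measure B phi) f =
  (\int[B]_x Re (f (phi x))) +i* (\int[B]_x Im (f (phi x))).
Proof.
move=> [fr fi [M fM]].
have key (h : S1 R -> R) : measurable_fun setT h -> (forall x, `|h x| <= M) ->
    \int[image_measure B phi]_x h x = \int[B]_x h (phi x).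
  move=> mh hM; rewrite /Rintegral; congr fine.
  rewrite (@integral_pushforward _ _ _ _ _ _ (@measurable_funPT _ _ _ _ phi) B setT)//.
  - exact/measurable_EFinP.
  - rewrite preimage_setT; apply: measurable_bounded_integrable => //.
    + by rewrite -ge0_fin_numE// fin_num_measure.
    + exact: measurableT_comp.
    + exists M; split; first exact: num_real.
      by move=> N MN x _; rewrite /= (le_trans (hM _))// ltW.
rewrite cintE !key// => x; [exact: le_trans (Im_cmod _) (fM x)|].
exact: le_trans (Re_cmod _) (fM x).
Qed.

Lemma lipschitz_cos (a : R) : 0 <= a -> lipschitzR (fun x => cos (a * x)) a.
Proof.
move=> a0 x y; wlog xy : x y / y <= x.
  move=> h; have [|/ltW] := leP y x; first exact: h.
  by move=> /h; rewrite distrC (distrC y).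
rewrite (ger0_norm (_ : 0 <= x - y)) ?subr_ge0//.
have axy : a * y <= a * x by rewrite ler_wpM2l.
have [|c _ ->] := @MVT_segment R cos (fun x => - sin x) (a * y) (a * x) axy (fun y _ => is_derive_cos y).
  by apply: continuous_subspaceT => z; exact: continuous_cos.
rewrite normrM normrN -mulrBr (ger0_norm (_ : 0 <= a * (x - y))) ?mulr_ge0 ?subr_ge0//.
by rewrite ler_piMl ?mulr_ge0 ?subr_ge0// sin_max.
Qed.

Lemma lipschitz_sin (a : R) : 0 <= a -> lipschitzR (fun x => sin (a * x)) a.
Proof.
move=> a0 x y; wlog xy : x y / y <= x.
  move=> h; have [|/ltW] := leP y x; first exact: h.
  by move=> /h; rewrite distrC (distrC y).
rewrite (ger0_norm (_ : 0 <= x - y)) ?subr_ge0//.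
have axy : a * y <= a * x by rewrite ler_wpM2l.
have [|c _ ->] := @MVT_segment R sin cos (a * y) (a * x) axy (fun y _ => is_derive_sin y).
  by apply: continuous_subspaceT => z; exact: continuous_sin.
rewrite normrM -mulrBr (ger0_norm (_ : 0 <= a * (x - y))) ?mulr_ge0 ?subr_ge0//.
by rewrite ler_piMl ?mulr_ge0 ?subr_ge0// cos_max.
Qed.

(** Weak compactness of measures of mass [c] on the circle. The limit is the image of [[0, c[] under
    [exp (i q)]; its moments are integrals of [cos (k q)] and [sin (k q)], Lipschitz functions of
    [q]. *)
Lemma ultralimit_measure (c : R) (U : set_system nat) (K : nat -> nat)
  (w : nat -> nat -> R) : 0 <= c -> UltraFilter U ->
  (forall n, (0 < K n)%N) -> (forall n j, 0 <= w n j) ->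
  (forall n, \sum_(j < K n) w n j = c) ->
  exists rho : {finite_measure set (S1 R) -> \bar R}, mass rho = c /\
   forall k l, clim U (fun n => \sum_(j < K n) (w n j)%:C * root_of_unity R (K n) j ^+ k) l ->
     mom rho k = l.
Proof.
move=> c0 UF K0 w0 wc.
have [q [qmon hq]] := ultralimit_integral c0 UF K0 w0 wc.
have mq : measurable_fun setT ((fun x => cis (q x)) : measurableTypeR R -> S1 R).
  by apply: (measurableT_comp (@measurable_cis R)); exact: nondecreasing_measurable.
pose phi : {mfun measurableTypeR R >-> S1 R} := mfun_Sub (mem_set mq).
exists (image_measure (itv_measure c) phi); split.
  rewrite /mass /= /image_measure /pushforward preimage_setT.
  have mD : measurable (`[0, c[%classic : set (measurableTypeR R)).
    exact: measurable_itv.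
  have := measureU (itv_measure c) mD (measurableC mD) (setICr _).
  by rewrite setUv /= itv_measure_itv// itv_measure_out adde0 subr0 => ->.
move=> k l [hr hi]; rewrite /mom cint_image; last exact: bmeas_cvalX.
have mcos (a : R) : continuous (fun x => cos (a * x)).
  by move=> x; apply: continuous_comp; [exact: mulrl_continuous|exact: continuous_cos].
have msin (a : R) : continuous (fun x => sin (a * x)).
  by move=> x; apply: continuous_comp; [exact: mulrl_continuous|exact: continuous_sin].
apply: complex_eq; rewrite /=.
- under eq_Rintegral do rewrite /= cval_cis cisCX /=.
  apply: (hq (fun x => cos (k%:R * x)) k%:R 1) => //.
  + exact: lipschitz_cos.
  + exact: continuous_measurable_fun.
  + by move=> x; exact: cos_max.
  + move: hr; apply: cvg_trans; apply: near_eq_cvg; apply: nearW => n.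
    rewrite Re_sum; apply: eq_bigr => j _.
    by rewrite ReM/= mul0r subr0 /root_of_unity cisCX.
- under eq_Rintegral do rewrite /= cval_cis cisCX /=.
  apply: (hq (fun x => sin (k%:R * x)) k%:R 1) => //.
  + exact: lipschitz_sin.
  + exact: continuous_measurable_fun.
  + by move=> x; exact: sin_max.
  + move: hi; apply: cvg_trans; apply: near_eq_cvg; apply: nearW => n.
    rewrite Im_sum; apply: eq_bigr => j _.
    by rewrite ImM/= mul0r addr0 /root_of_unity cisCX.
Qed.

Lemma cvg_harmonic2 : ((n.+2%:R)^-1 @[n --> \oo] --> (0 : R))%R.
Proof.
by have := @cvg_harmonic R; rewrite -(cvg_shiftS (@harmonic R)).
Qed.

Theorem herglotz (h : R[i] -> R[i]) : disk_approx h ->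
  (forall z, cmod z < 1 -> 0 <= Re (h z)) -> Im (h 0) = 0 ->
  exists rho : {finite_measure set (S1 R) -> \bar R},
    forall z, cmod z < 1 -> h z = 2 * res0 rho z - (mass rho)%:C.
Proof.
move=> ha hre him; have [U [UF Uoo]] := ex_ultrafilter_nat.
set c := Re (h 0).
have h0 : h 0 = c%:C by apply: complex_eq.
have c0 : 0 <= c by apply: hre; rewrite cmod0.
pose e n : R := n.+2%:R^-1.
have e0 n : 0 < e n by rewrite invr_gt0 ltr0n.
have e1 n : e n <= 1 / 2 by rewrite /e mul1r lef_pV2 ?posrE ?ltr0n// ler_nat.
have ecvg : e n @[n --> U] --> 0 by apply: cvg_trans cvg_harmonic2; exact: cvg_app.
pose r n : R := 1 - e n.
have r01 n : 0 <= r n < 1.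
  by rewrite subr_ge0 ltrBlDr ltrDl e0 andbT (le_trans (e1 n))//; lra.
have r0 n : 1 / 2 <= r n by rewrite /r; have := e1 n; lra.
have [p hp] := choice (fun n => ha (r n) (e n) (r01 n) (e0 n)).
(* The constant sets the value at 0 to [h 0 + 2 * e n]. On radius [r n] the errors at [z] and at 0
   are at most [e n] each, so the added [2 * e n] keeps the real part nonnegative. *)
pose s n := p n + (h 0 - (p n).[0] + (2 * e n)%:C)%:P.
have hs n z : cmod z <= r n -> cmod ((s n).[z] - h z) <= 4 * e n.
  move=> zr; rewrite hornerD hornerC.
  have -> : (p n).[z] + (h 0 - (p n).[0] + (2 * e n)%:C) - h z =
     - (h z - (p n).[z]) + (h 0 - (p n).[0]) + (2 * e n)%:C by ring.
  apply: le_trans (cmodD _ _) _; rewrite cmodR ger0_norm ?mulr_ge0 ?(ltW (e0 n))//.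
  have := cmodD (- (h z - (p n).[z])) (h 0 - (p n).[0]); rewrite cmodN.
  have := hp n _ zr; have := hp n 0; rewrite cmod0 => /(_ _)/=.
  by case/andP: (r01 n) => -> _ /(_ erefl); lra.
have sre n z : cmod z <= r n -> 0 <= Re (s n).[z].
  move=> zr; rewrite hornerD hornerC.
  have -> : (p n).[z] + (h 0 - (p n).[0] + (2 * e n)%:C) =
     h z + (- (h z - (p n).[z]) + (h 0 - (p n).[0]) + (2 * e n)%:C) by ring.
  rewrite ReD ReD /=.
  have hz : 0 <= Re (h z) by apply: hre; case/andP: (r01 n) => _; exact: le_lt_trans.
  have := Re_cmod (- (h z - (p n).[z]) + (h 0 - (p n).[0])).
  have := cmodD (- (h z - (p n).[z])) (h 0 - (p n).[0]); rewrite cmodN.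
  have := hp n _ zr; have := hp n 0; rewrite cmod0 => /(_ _)/=.
  case/andP: (r01 n) => -> _ /(_ erefl) k1 k2 k3; rewrite ler_norml => /andP[k4 _].
  lra.
pose cn n := c + 2 * e n.
have cn0 n : 0 < cn n by rewrite ltr_wpDl// mulr_gt0.
have cn1 n : cn n <= c + 1 by rewrite /cn; have := e1 n; lra.
have s0 n : (s n)`_0 = (cn n)%:C.
  by rewrite -horner_coef0 hornerD hornerC h0 rmorphD/=; ring.
(* Enough sample points for [disc_moment] at every index up to [size (s n) + n], hence eventually at
   each fixed index. *)
pose K n := (size (s n) + size (s n) + n.+1)%N.
have K0 n : (0 < K n)%N by rewrite /K addnS.
pose dw n j := disc_weight (K n) (s n) (r n) j.
have dw0 n j : 0 <= dw n j.
  rewrite /dw /disc_weight divr_ge0// sre// cmodM cmodR cmodJ cmod_cisC mulr1.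
  by rewrite ger0_norm//; case/andP: (r01 n).
have dwc n : \sum_(j < K n) dw n j = cn n.
  apply: (@complexI R); rewrite rmorph_sum/=.
  have := @disc_moment R (K n) (K0 n) (s n) (r n) 0 _ (K0 n).
  rewrite add0n expr0 mulr1 s0 eqxx mul1r conjCR.
  have -> : ((cn n)%:C + (cn n)%:C) / 2 = (cn n)%:C :> R[i] by field.
  move=> <-; last by rewrite /K -addnA leq_addr.
  by apply: eq_bigr => j _; rewrite expr0 mulr1.
(* All discrete measures must have the same mass [c] to share the interval [[0, c[]; the rescaling
   moves the moments by at most [2 * e n]. *)
pose w n j := c / cn n * dw n j.
have w0 n j : 0 <= w n j by rewrite mulr_ge0// divr_ge0// ltW.
have wc n : \sum_(j < K n) w n j = c.
  by rewrite -mulr_sumr dwc mulfVK// gt_eqF.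
have [rho [mrho hrho]] := ultralimit_measure c0 UF K0 w0 wc.
(* For [k > 0], the k-th moment of [dw n] written with coefficients. This form makes sense for all
   [k], and past the degree it is 0, so its bound [cn n] holds at every [k > 0]. *)
pose mt n k : R[i] := (s n)`_k * (r n)%:C ^+ k / 2.
have mtE n k : (0 < k)%N -> (k <= size (s n) + n)%N ->
    mt n k = \sum_(j < K n) (dw n j)%:C * root_of_unity R (K n) j ^+ k.
  move=> k0 kn; rewrite disc_moment//.
  - by rewrite (gtn_eqF k0) mul0r addr0.
  - by rewrite /K -addnA addnC leq_add2l (leq_trans kn)// leq_add2l.
  - by rewrite /K addnS ltnS (leq_trans kn)// leq_add2r leq_addr.
have mt_bound n k : (0 < k)%N -> cmod (mt n k) <= cn n.
  move=> k0; have [ks|sk] := leqP k (size (s n) + n)%N.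
    rewrite mtE// -dwc; apply: le_trans (cmod_sum _ _ _) _; apply: ler_sum => j _.
    by rewrite cmodM cmodR ger0_norm// cmodX cmod_cisC expr1n mulr1.
  rewrite /mt nth_default ?mul0r ?cmod0 ?ltW//.
  by rewrite (leq_trans _ (ltnW sk))// leq_addr.
have mt_lim k : (0 < k)%N -> clim U (fun n => mt n k) (mom rho k).
  move=> k0.
  have wb n : cmod (\sum_(j < K n) (w n j)%:C * root_of_unity R (K n) j ^+ k) <= c.
    rewrite -[leRHS](wc n); apply: le_trans (cmod_sum _ _ _) _; apply: ler_sum => j _.
    by rewrite cmodM cmodR ger0_norm// cmodX cmod_cisC expr1n mulr1.
  have [l hl] := ulimC_ex UF wb.
  rewrite (hrho k l hl) -[l]add0r.
  under eq_fun => n do rewrite -(subrK (\sum_(j < K n) (w n j)%:C * root_of_unity R (K n) j ^+ k) (mt n k)).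
  apply: climD => //; apply: (clim_squeeze (e := fun n => 2 * e n)).
    apply: Uoo; exists k => // n /= kn; rewrite subr0.
    rewrite mtE//; last by rewrite (leq_trans kn)// leq_addl.
    rewrite -sumrB.
    have -> : \sum_(j < K n) ((dw n j)%:C * root_of_unity R (K n) j ^+ k -
        (w n j)%:C * root_of_unity R (K n) j ^+ k) = (2 * e n / cn n)%:C *
        \sum_(j < K n) (dw n j)%:C * root_of_unity R (K n) j ^+ k.
      rewrite mulr_sumr; apply: eq_bigr => j _.
      rewrite -mulrBl -rmorphB/= mulrA -rmorphM/=; congr (_%:C * _).
      rewrite /w -{1}[dw n j]mul1r -mulrBl; congr (_ * _).
      by rewrite /cn; field; rewrite gt_eqF// cn0.
    rewrite -mtE//; last by rewrite (leq_trans kn)// leq_addl.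
    have en0 := ltW (e0 n).
    rewrite cmodM cmodR ger0_norm ?divr_ge0 ?mulr_ge0 ?(ltW (cn0 n))//.
    by rewrite mulrAC ler_pdivrMr// ler_wpM2l ?mulr_ge0// mt_bound.
  by have -> : (0 : R) = 2 * 0; [rewrite mulr0|exact: cvgMl_tmp].
have r_lim : clim U (fun n => (r n)%:C^-1) 1.
  under eq_fun do rewrite -fmorphV; rewrite -[1]/(1%:C).
  apply: climR; rewrite -[X in _ --> X]invr1; apply: cvgV; first exact: oner_neq0.
  by rewrite -[X in _ --> X]subr0; apply: cvgB => //; exact: cvg_cst.
pose A k : R[i] := if k == 0%N then c%:C else 2 * mom rho k.
have rC n : (r n)%:C != 0 :> R[i].
  by rewrite -cmod_gt0 cmodR normr_gt0 gt_eqF//; have := r0 n; lra.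
have s_lim k : clim U (fun n => (s n)`_k) (A k).
  rewrite /A; case: eqVneq => [->|k0].
    under eq_fun do rewrite s0; apply: climR.
    rewrite -[X in _ --> X]addr0; apply: cvgD; first exact: cvg_cst.
    by have -> : (0 : R) = 2 * 0; [rewrite mulr0|exact: cvgMl_tmp].
  have -> : (fun n => (s n)`_k) = fun n => 2 * mt n k * (r n)%:C^-1 ^+ k.
    apply/funext => n; rewrite /mt exprVn mulrC.
    by field; rewrite expf_neq0.
  rewrite -[X in clim _ _ X]mulr1 -[X in _ * X](expr1n _ k); apply: climM; last exact: climX.
  by apply: climM; [exact: clim_cst|apply: mt_lim; rewrite lt0n].
exists rho => z z1; rewrite mrho.
(* By the arithmetic-geometric inequality [cmod z <= q ^+ 2], so [q <= r n] gives
   [cmod z / r n <= q]: the rescaled point stays in a fixed disk. *)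
set q := (1 + cmod z) / 2.
have zq : cmod z < q by rewrite /q; lra.
have q1 : q < 1 by rewrite /q; lra.
have q0 : 0 <= q by rewrite (le_trans (cmod_ge0 z))// ltW.
have near_r : \forall n \near \oo, cmod z / r n <= q /\ cmod z <= r n.
  have : \forall n \near \oo, e n < 1 - q.
    have q1' : 0 < 1 - q by rewrite subr_gt0.
    exact: (cvgr_lt _ cvg_harmonic2 _ q1').
  apply: filterS => n hn; have rn : q <= r n by rewrite /r; lra.
  split; last by rewrite (le_trans _ rn)// ltW.
  have rn0 : 0 < r n by have := r0 n; lra.
  rewrite ler_pdivrMr// /r; rewrite /q in hn *; have := cmod_ge0 z; nra.
have hN N : cmod (psum A z N - h z) <= 2 * (c + 1) * q ^+ N / (1 - q).
  have l1 : clim U (fun n => psum (fun k => (s n)`_k) z N - (s n).[z]) (psum A z N - h z).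
    apply: climB.
      rewrite /psum; apply: (@clim_sum R _ U _ _ _ (fun (i : 'I_N) n => (s n)`_i * z ^+ i)
        (fun i : 'I_N => A i * z ^+ i)) => i.
      by apply: climM => //; exact: clim_cst.
    apply: (clim_squeeze (e := fun n => 4 * e n)).
      by apply: Uoo; apply: filterS near_r => n [_]; exact: hs.
    by have -> : (0 : R) = 4 * 0; [rewrite mulr0|exact: cvgMl_tmp].
  apply: (clim_le l1); apply: Uoo; apply: filterS near_r => n [zr _].
  (* Only these rescaled coefficients are bounded uniformly in [n] and [k], so the tail of [s n] at
     [z] is estimated as a series in [y = z / r n]. *)
  pose a k := (s n)`_k * (r n)%:C ^+ k.
  pose y := z / (r n)%:C.
  have cy : cmod y <= q.
    by rewrite /y cmodM cmodV cmodR ger0_norm//; case/andP: (r01 n).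
  have ay k : a k * y ^+ k = (s n)`_k * z ^+ k.
    by rewrite /a /y exprMn exprVn; field; rewrite expf_neq0.
  have aM k : cmod (a k) <= 2 * (c + 1).
    have -> : a k = 2 * mt n k by rewrite /mt /a; field.
    rewrite cmodM -[2](rmorph_nat (real_complex R)) cmodR normr_nat ler_pM2l//.
    case: (posnP k) => [->|k0].
      rewrite /mt s0 expr0 mulr1 cmodM cmodV cmod_nat cmodR gtr0_norm//.
      rewrite ler_pdivrMr//; have := cn1 n; lra.
    by apply: le_trans (mt_bound n k k0) _.
  have := psum_dist N (size (s n)) aM (le_lt_trans cy q1).
  have -> : psum a y N = psum (fun k => (s n)`_k) z N.
    by apply: eq_bigr => i _; exact: ay.
  have -> : psum a y (N + size (s n)) = (s n).[z].
    rewrite horner_coef /psum addnC big_split_ord/= [X in _ + X]big1 ?addr0.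
      by apply: eq_bigr => i _; exact: ay.
    by move=> i _; rewrite ay nth_default ?mul0r// leq_addr.
  rewrite cmodBC => /le_trans; apply.
  rewrite ler_pM ?mulr_ge0 ?exprn_ge0 ?invr_ge0 ?subr_ge0 ?addr_ge0 ?cmod_ge0//.
  - by rewrite (le_trans cy)// ltW.
  - by rewrite ler_wpM2l ?mulr_ge0 ?addr_ge0// lerXn2r ?nnegrE ?cmod_ge0.
  - by rewrite lef_pV2 ?posrE ?subr_gt0// ?lerB// (le_lt_trans cy).
have l2 : clim \oo (psum A z) (h z).
  apply: (clim_squeeze (e := fun N => 2 * (c + 1) * q ^+ N / (1 - q))).
    exact: nearW.
  by apply: geo_tail_cvg0; rewrite q0.
apply: (clim_unique l2).
have l3 : clim \oo (fun N => 2 * psum (mom rho) z N - c%:C) (2 * res0 rho z - c%:C).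
  by apply: climB; [apply: climM; [exact: clim_cst|exact: res0_ps]|exact: clim_cst].
have E N : (0 < N)%N -> psum A z N = 2 * psum (mom rho) z N - c%:C.
  case: N => // N _; rewrite /psum !big_ord_recl/= mom0 mrho !expr0 !mulr1.
  have -> : \sum_(i < N) A (bump 0 i) * z ^+ bump 0 i = 2 * \sum_(i < N) mom rho (bump 0 i) * z ^+ bump 0 i.
    by rewrite mulr_sumr; apply: eq_bigr => i _; rewrite /A/= mulrA.
  by rewrite /A/=; ring.
case: l3 => l3 l4; split.
- move: l3; apply: cvg_trans; apply: near_eq_cvg; exists 1%N => // N /= N0; by rewrite E.
- move: l4; apply: cvg_trans; apply: near_eq_cvg; exists 1%N => // N /= N0; by rewrite E.
Qed.

End Herglotz.

(** * Moments determine measures on the circle *)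

Section IndicatorApproximation.
Variable R : realType.

Lemma bernoulli_ge (t : R) n : 0 <= t <= 1 -> 1 - n%:R * t <= (1 - t) ^+ n.
Proof.
move=> /andP[t0 t1]; elim: n => [|n IH]; first by rewrite mul0r subr0 expr0.
rewrite exprS; apply: (@le_trans _ _ ((1 - t) * (1 - n%:R * t))).
  have : 0 <= n%:R * t * t by rewrite !mulr_ge0.
  by rewrite -natr1; lra.
by rewrite ler_wpM2l// subr_ge0.
Qed.

Lemma bernoulli_1D_ge (t : R) n : 0 <= t -> 1 + n%:R * t <= (1 + t) ^+ n.
Proof.
move=> t0; elim: n => [|n IH]; first by rewrite mul0r addr0 expr0.
rewrite exprS; apply: (@le_trans _ _ ((1 + t) * (1 + n%:R * t))).
  have : 0 <= n%:R * t * t by rewrite !mulr_ge0.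
  by rewrite -natr1; lra.
by rewrite ler_wpM2l// addr_ge0.
Qed.

(** With [s = sqrt r], [n r^n] is [n s^n] times [s^n], and [n s^n] is at most the sum of the [s^i]
    for [i < n], hence bounded. *)
Lemma cvg_natM_expr (r : R) : 0 <= r < 1 -> (n%:R * r ^+ n @[n --> \oo] --> (0 : R))%R.
Proof.
move=> /andP[r0 r1]; set s := Num.sqrt r.
have s0 : 0 <= s by rewrite sqrtr_ge0.
have s1 : s < 1 by rewrite -[ltRHS](@sqrtr1 R) ltr_sqrt.
have bd n : n%:R * s ^+ n <= 1 / (1 - s).
  rewrite ler_pdivlMr ?subr_gt0//.
  have : (\sum_(i < n) s ^+ i) * (1 - s) = 1 - s ^+ n.
    by elim: n => [|n IH]; rewrite ?big_ord0 ?big_ord_recr/= ?mulrDl ?IH ?exprS; ring.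
  have : n%:R * s ^+ n <= \sum_(i < n) s ^+ i.
    rewrite mulr_natl -[X in _ *+ X](card_ord n) -sumr_const; apply: ler_sum => i _.
    by apply: ler_wiXn2l; [exact: s0|exact: ltW|exact: ltnW].
  have : 0 <= s ^+ n by rewrite exprn_ge0.
  have : 0 < 1 - s by rewrite subr_gt0.
  by move: (\sum_(i < n) _) (n%:R * _) => A B; nra.
apply: (@squeeze_cvgr _ _ _ _ (fun=> 0) (fun n => 1 / (1 - s) * s ^+ n)).
- apply: nearW => n; rewrite mulr_ge0 ?exprn_ge0//=.
  by rewrite -{1}(sqr_sqrtr r0) -/s -exprM mul2n -addnn exprD mulrA ler_wpM2r// exprn_ge0.
- exact: cvg_cst.
- rewrite -[X in _ --> X](mulr0 (1 / (1 - s))); apply: cvgMl_tmp; apply: cvg_expr.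
  by rewrite ger0_norm.
Qed.

(* Converges to [1] for [s < 1/2], and to [0] for [s >= 1/2]. *)
Definition half_poly (s : R) n : R := (1 - s ^+ n) ^+ (n * 2 ^ n).

Lemma half_poly_itv s n : 0 <= s <= 1 -> 0 <= half_poly s n <= 1.
Proof.
move=> /andP[s0 s1]; have h : s ^+ n <= 1 by rewrite exprn_ile1.
have h0 : 0 <= s ^+ n by rewrite exprn_ge0.
by rewrite exprn_ge0 ?subr_ge0//= exprn_ile1 ?subr_ge0// lerBlDr lerDl.
Qed.

(** Put [m = n 2^n], so that [m s^n = n (2 s)^n]. If [s < 1/2], Bernoulli bounds the value below by
    [1 - n (2 s)^n]. If [s >= 1/2], then [(1 - s^n)^m (1 + s^n)^m <= 1] and the second factor is at
    least [1 + n]; the factor [n] in the exponent is what handles [s = 1/2]. *)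
Lemma half_poly_cvg (s : R) : 0 <= s <= 1 ->
  half_poly s n @[n --> \oo] --> ((s < 1 / 2)%R%:R : R).
Proof.
move=> s01; have /andP[s0 s1] := s01.
have hn n : (n * 2 ^ n)%:R * s ^+ n = n%:R * (2 * s) ^+ n :> R.
  by rewrite natrM natrX exprMn; ring.
have sn n : 0 <= s ^+ n <= 1 by rewrite exprn_ge0 ?exprn_ile1.
have [h|h] := ltP s (1 / 2).
  apply: (@squeeze_cvgr _ _ _ _ (fun n => 1 - n%:R * (2 * s) ^+ n) (fun=> 1)).
  - apply: nearW => n; case/andP: (half_poly_itv n s01) => _ ->; rewrite andbT.
    by rewrite -hn bernoulli_ge.
  - rewrite -[X in _ --> X]subr0; apply: cvgB; first exact: cvg_cst.
    by apply: cvg_natM_expr; lra.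
  - exact: cvg_cst.
apply: (@squeeze_cvgr _ _ _ _ (fun=> 0) (@harmonic R)).
- apply: nearW => n; case/andP: (half_poly_itv n s01) => -> _ /=.
  rewrite /harmonic -[leRHS]mul1r ler_pdivlMr ?ltr0n//.
  have e1 : n.+1%:R <= (1 + s ^+ n) ^+ (n * 2 ^ n) :> R.
    apply: le_trans (bernoulli_1D_ge _ _); last by case/andP: (sn n).
    rewrite hn -natr1 addrC lerD2l -[leLHS]mulr1 ler_wpM2l// exprn_ege1//; lra.
  apply: le_trans (ler_wpM2l _ e1) _; first by case/andP: (half_poly_itv n s01).
  rewrite /half_poly -exprMn exprn_ile1//.
  - by case/andP: (sn n) => a b; rewrite mulr_ge0 ?subr_ge0// addr_ge0.
  - have -> : (1 - s ^+ n) * (1 + s ^+ n) = 1 - (s ^+ n) ^+ 2 by ring.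
    by rewrite lerBlDr lerDl sqr_ge0.
- exact: cvg_cst.
- exact: cvg_harmonic.
Qed.

End IndicatorApproximation.

Section TrigonometricPolynomials.
Variable R : realType.
Implicit Types (f g : S1 R -> R[i]) (A : set (S1 R)).

(** Two natural exponents, for x and its conjugate, instead of one integer: products then only add
    exponents. *)
Inductive trig : (S1 R -> R[i]) -> Prop :=
| trig_mono c a b : trig (fun x => c * (cval x ^+ a * ((cval x)^*) ^+ b))
| trigD f g : trig f -> trig g -> trig (fun x => f x + g x).

Lemma trig_ext f g : f =1 g -> trig f -> trig g.
Proof. by move=> /funext ->. Qed.

Lemma trig_cst c : trig (fun=> c).
Proof. by apply: trig_ext (trig_mono c 0 0) => x; rewrite !expr0 !mulr1. Qed.

Lemma trigM f g : trig f -> trig g -> trig (fun x => f x * g x).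
Proof.
move=> hf hg; elim: hf => [c a b|f1 f2 _ h1 _ h2]; last first.
  by apply: trig_ext (trigD h1 h2) => x; rewrite mulrDl.
elim: hg => [d k l|g1 g2 _ h1 _ h2]; last first.
  by apply: trig_ext (trigD h1 h2) => x; rewrite mulrDr.
by apply: trig_ext (trig_mono (c * d) (a + k) (b + l)) => x; rewrite !exprD; ring.
Qed.

Lemma trigX f n : trig f -> trig (fun x => f x ^+ n).
Proof.
move=> hf; elim: n => [|n IH].
  by apply: trig_ext (trig_cst 1) => x; rewrite expr0.
by apply: trig_ext (trigM hf IH) => x; rewrite exprS.
Qed.

Lemma trigB f g : trig f -> trig g -> trig (fun x => f x - g x).
Proof.
move=> hf hg; apply: trig_ext (trigD hf (trigM (trig_cst (-1)) hg)) => x.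
by rewrite mulN1r.
Qed.

Lemma bmeas_trig f : trig f -> bmeas f.
Proof.
elim=> [c a b|f1 f2 _ h1 _ h2]; last exact: bmeasD.
apply: bmeasZ; apply: bmeasM; apply: bmeasX; first exact: bmeas_cval.
by apply: bmeasJ; exact: bmeas_cval.
Qed.

Lemma trig_Re : trig (fun x => (Re (cval x))%:C).
Proof.
apply: trig_ext (trigD (trig_mono (1 / 2) 1 0) (trig_mono (1 / 2) 0 1)) => x.
rewrite !expr0 !expr1 mulr1 !mul1r -mulrDr; apply: complex_eq.
  by rewrite ReM ReD ReJ /=; case: (cval x) => a b /=; field.
by rewrite ImM ImD ImJ /=; case: (cval x) => a b /=; field.
Qed.

Lemma trig_Im : trig (fun x => (Im (cval x))%:C).
Proof.
apply: trig_ext (trigM (trig_cst (- 'i%C)) (trigB (trig_mono 1 1 0) trig_Re)) => x.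
rewrite expr0 expr1 mulr1 mul1r; case: (cval x) => a b.
by apply: complex_eq; rewrite /=; ring.
Qed.

(* Sets whose indicator is a bounded pointwise limit of trigonometric
   polynomials. *)
Definition trig_set A : Prop := measurable A /\
  exists F : nat -> S1 R -> R[i], [/\ forall n, trig (F n),
    forall n x, cmod (F n x) <= 1 &
    forall x, clim \oo (F^~ x) ((\1_A x : R)%:C)].

Lemma trig_setI : setI_closed trig_set.
Proof.
move=> A B [mA [F [tF bF cF]]] [mB [G [tG bG cG]]]; split; first exact: measurableI.
exists (fun n x => F n x * G n x); split.
- by move=> n; exact: trigM.
- by move=> n x; rewrite cmodM mulr_ile1// cmod_ge0.
- by move=> x; rewrite indicI /= rmorphM; exact: climM.
Qed.

Lemma trig_setT : trig_set setT.
Proof.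
split=> //; exists (fun _ _ => 1); split.
- by move=> n; exact: trig_cst.
- by move=> n x; rewrite cmod1.
- by move=> x; rewrite indicT; exact: clim_cst.
Qed.

(** The function [s = 1/2 - l / (2 B)] has values in [[0, 1]] and is below [1/2] exactly where
    [l > 0], so [half_poly] of [s] tends to the indicator. *)
Lemma trig_set_pos (l : S1 R -> R) (B : R) : trig (fun x => (l x)%:C) ->
  (forall x, `|l x| <= B) -> 0 < B -> trig_set [set x | 0 < l x].
Proof.
move=> tl lB B0; split.
  have [ml _ _] := bmeas_trig tl; rewrite /= in ml.
  rewrite (_ : [set x | _] = l @^-1` `]0, +oo[); last first.
    by apply/seteqP; split=> x /=; rewrite in_itv/= andbT.
  by rewrite -[X in measurable X]setTI; exact: ml.
pose s x : R := 1 / 2 - l x / (2 * B).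
have s01 x : 0 <= s x <= 1.
  have := lB x; rewrite ler_norml => /andP[h1 h2].
  have h3 : l x / (2 * B) <= 1 / 2 by rewrite ler_pdivrMr ?mulr_gt0//; lra.
  have h4 : - (1 / 2) <= l x / (2 * B) by rewrite ler_pdivlMr ?mulr_gt0//; lra.
  by rewrite /s; apply/andP; split; lra.
exists (fun n x => (half_poly (s x) n)%:C); split.
- move=> n; apply: (@trig_ext (fun x => (1 - ((1 / 2)%:C - (2 * B)^-1%:C * (l x)%:C) ^+ n) ^+ (n * 2 ^ n))).
    move=> x; rewrite /half_poly rmorphXn/= rmorphB/= rmorphXn/= /s rmorphB/=.
    have -> : (l x / (2 * B))%:C = (2 * B)^-1%:C * (l x)%:C :> R[i].
      by rewrite -rmorphM mulrC.
    by [].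
  apply: trigX; apply: trigB; first exact: trig_cst.
  apply: trigX; apply: trigB; first exact: trig_cst.
  by apply: trigM => //; exact: trig_cst.
- move=> n x; case/andP: (half_poly_itv n (s01 x)) => h1 h2.
  by rewrite cmodR ger0_norm.
- move=> x; apply: climR; rewrite indicE.
  have -> : (x \in [set x | 0 < l x]) = (s x < 1 / 2).
    rewrite /s ltrBlDr ltrDl pmulr_lgt0 ?invr_gt0 ?mulr_gt0//.
    by apply/idP/idP; rewrite inE.
  exact: half_poly_cvg.
Qed.

Lemma trig_set_box (a b e : R) :
  trig_set [set x | `|Re (cval x) - a| < e /\ `|Im (cval x) - b| < e].
Proof.
have P (f : S1 R -> R) (d k : R) : trig (fun x => (f x)%:C) -> (forall x, `|f x| <= 1) ->
    trig_set [set x | 0 < k * f x + d].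
  move=> tf f1; apply: (@trig_set_pos _ (`|k| + `|d| + 1)).
  - apply: trig_ext (trigD (trigM (trig_cst k%:C) tf) (trig_cst d%:C)) => x.
    by rewrite rmorphD rmorphM.
  - move=> x; apply: le_trans (ler_normD _ _) _.
    have : `|k * f x| <= `|k| by rewrite normrM ler_piMr.
    lra.
  - by rewrite ltr_wpDl// addr_ge0.
have re1 x : `|Re (@cval R x)| <= 1 by rewrite -(cval_cmod x) Re_cmod.
have im1 x : `|Im (@cval R x)| <= 1 by rewrite -(cval_cmod x) Im_cmod.
rewrite (_ : [set x | _] =
  ([set x | 0 < 1 * Re (cval x) + (e - a)] `&` [set x | 0 < -1 * Re (cval x) + (e + a)]) `&`
  ([set x | 0 < 1 * Im (cval x) + (e - b)] `&` [set x | 0 < -1 * Im (cval x) + (e + b)])).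
  by do 2 apply: trig_setI; apply: P; [exact: trig_Re| |exact: trig_Re| |exact: trig_Im| |exact: trig_Im|].
apply/seteqP; split=> x /=.
  by rewrite !ltr_norml => -[/andP[h1 h2] /andP[h3 h4]]; split; split; lra.
by move=> [[h1 h2] [h3 h4]]; rewrite !ltr_norml; split; apply/andP; split; lra.
Qed.

(** An open set is the countable union of the rational boxes it contains; a box that sticks out of
    [V] is replaced by the empty set. *)
Lemma open_trig_set (V : set (circle R)) : open V -> <<s trig_set >> V.
Proof.
move=> [W oW WV].
pose box (n : nat) (a b : rat) : set (S1 R) :=
  [set x | `|Re (cval x) - ratr a| < n.+1%:R^-1 /\ `|Im (cval x) - ratr b| < n.+1%:R^-1].
pose Bx n a b := if `[< box n a b `<=` V >] then box n a b else set0.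
pose GT := g_sigma_algebraType trig_set.
have mB n a b : @measurable _ GT (Bx n a b).
  rewrite /Bx; case: ifP => _; last exact: measurable0.
  by apply: sub_sigma_algebra; exact: trig_set_box.
have -> : V = \bigcup_n \bigcup_a \bigcup_b Bx n a b.
  apply/seteqP; split=> x; last first.
    by move=> [n _ [a _ [b _]]]; rewrite /Bx; case: ifP => // /asboolP; apply.
  rewrite -WV /= => Wx.
  have /nbhs_ballP[e /= e0 he] := open_nbhs_nbhs (conj oW Wx).
  have [h1 h2] := ger0_Re (ltW e0).
  set r := Re e in h1 h2; have r0 : 0 < r by move: e0; rewrite h1 ltcR.
  have [n hn] : exists n, n.+1%:R^-1 < r / 4.
    exists (Num.truncn (4 / r)); rewrite invf_plt ?posrE ?divr_gt0 ?ltr0n//.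
    by rewrite invf_div truncnS_gt.
  have n0 : 0 < n.+1%:R^-1 :> R by rewrite invr_gt0 ltr0n.
  have rat_near (t d : R) : 0 < d -> exists a : rat, `|t - ratr a| < d.
    move=> d0; have [|a] := @rat_in_itvoo R (t - d) (t + d); first by lra.
    rewrite in_itv/= => /andP[h3 h4].
    by exists a; rewrite ltr_norml; apply/andP; split; lra.
  have [a ha] := rat_near (Re (cval x)) _ n0; have [b hb] := rat_near (Im (cval x)) _ n0.
  exists n => //; exists a => //; exists b => //.
  suff sub : box n a b `<=` V by rewrite /Bx; case: asboolP.
  move=> y [ya yb]; rewrite -WV; apply: he; rewrite -ball_normE/= h1 normE ltcR.
  apply: le_lt_trans (cmod_le _) _; rewrite ReB ImB -/(cval x) -/(cval y).
  have k1 : `|Re (cval x) - Re (cval y)| <= `|Re (cval x) - ratr a| + `|Re (cval y) - ratr a|.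
    by rewrite (distrC (Re (cval y))) ler_distD.
  have k2 : `|Im (cval x) - Im (cval y)| <= `|Im (cval x) - ratr b| + `|Im (cval y) - ratr b|.
    by rewrite (distrC (Im (cval y))) ler_distD.
  apply: le_lt_trans (lerD k1 k2) _; apply: lt_trans (ltrD (ltrD ha ya) (ltrD hb yb)) _.
  by move: hn; move: (n.+1%:R^-1) => d hd; lra.
apply: (@bigcupT_measurable _ GT) => n.
apply: (@bigcupT_measurable_rat _ GT) => a.
by apply: (@bigcupT_measurable_rat _ GT) => b.
Qed.

Section Uniqueness.
Variables m1 m2 : {finite_measure set (S1 R) -> \bar R}.
Hypothesis m12 : forall n, mom m1 n = mom m2 n.

(** On the circle x times its conjugate is 1, so a mixed monomial is a power of x or the conjugate
    of one: the negative moments are conjugates of the positive ones. *)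
Lemma cint_trig_eq f : trig f -> cintegral m1 f = cintegral m2 f.
Proof.
elim=> [c a b|f1 f2 t1 h1 t2 h2]; last first.
  have b1 := bmeas_trig t1; have b2 := bmeas_trig t2.
  by rewrite !cintD// h1 h2.
have bX k := @bmeas_cvalX R k.
have bJ k : bmeas (fun x : S1 R => ((cval x)^*) ^+ k).
  by apply: bmeasX; apply: bmeasJ; exact: bmeas_cval.
rewrite !cintZ; [|exact: bmeasM|exact: bmeasM]; congr (_ * _).
have [ab|/ltnW ba] := leqP a b.
  have E x : cval x ^+ a * ((cval x : R[i])^*) ^+ b = (cval x ^+ (b - a))^*.
    by rewrite -{1}(subnKC ab) exprD mulrA cvalXJ mul1r conjCX.
  rewrite !(eq_cint _ E).
  by rewrite !cintJ ?m12//; congr (_^*); exact: m12.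
have E x : cval x ^+ a * ((cval x : R[i])^*) ^+ b = cval x ^+ (a - b).
  by rewrite -{1}(subnK ba) exprD -mulrA cvalXJ mulr1.
by rewrite !(eq_cint _ E); exact: m12.
Qed.

Lemma cint_indic (m : {finite_measure set (S1 R) -> \bar R}) A : measurable A ->
  cintegral m (fun x => (\1_A x : R)%:C) = (fine (m A))%:C.
Proof.
move=> mA; rewrite cintE /=; apply: complex_eq; rewrite /=.
  by rewrite /Rintegral integral_indic// setIT.
by rewrite Rintegral_cst// mul0r.
Qed.

Lemma trig_set_eq A : trig_set A -> m1 A = m2 A.
Proof.
move=> [mA [F [tF bF cF]]].
have h (m : {finite_measure set (S1 R) -> \bar R}) :
    clim \oo (fun n => cintegral m (F n)) (fine (m A))%:C.
  rewrite -cint_indic//; apply: (@cint_lim _ m _ _ 1) => // n.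
  exact: bmeas_trig.
have e : (fine (m1 A))%:C = (fine (m2 A))%:C :> R[i].
  apply: (clim_unique (h m1)).
  under eq_fun => n do rewrite (cint_trig_eq (tF n)).
  exact: h.
have /complexI e2 := e.
by rewrite -(fineK (fin_num_measure m1 A mA)) e2 fineK// fin_num_measure.
Qed.

(** The sets of [trig_set] are stable under intersection and generate the Borel sets, and both
    measures agree on them by dominated convergence. *)
Theorem mom_determines_measure : eq_meas m1 m2.
Proof.
move=> A mA.
have sub : <<s @open (circle R) >> `<=` <<s trig_set >>.
  apply: smallest_sub; first exact: smallest_sigma_algebra.
  by move=> V; exact: open_trig_set.
apply: (@g_sigma_algebra_measure_unique _ R (S1 R) trig_set _ (fun=> setT)).
- by move=> B [].
- by move=> _; exact: trig_setT.
- by rewrite bigcup_const.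
- exact: trig_setI.
- exact: trig_set_eq.
- by move=> k; rewrite -ge0_fin_numE// fin_num_measure.
- exact: sub.
Qed.

End Uniqueness.
End TrigonometricPolynomials.

(** * The Hilbert space of square-summable sequences *)

Section SemiInner.
Variables (R : realType) (E : lmodType R[i]).

(** Null vectors are allowed: covariances, the form of the boolean product and the increments of an
    operator net are only semi-definite. *)
Record semi_inner (B : E -> E -> R[i]) : Prop := SemiInner {
  semi_innerP : forall a x y z, B (a *: x + y) z = a * B x z + B y z ;
  semi_innerC : forall x y, B x y = (B y x)^* ;
  semi_inner_ge0 : forall x, 0 <= Re (B x x) }.

Variables (B : E -> E -> R[i]) (HB : semi_inner B).

Lemma siDl x y z : B (x + y) z = B x z + B y z.
Proof. by rewrite -[x]scale1r (semi_innerP HB) mul1r scale1r. Qed.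
Lemma si0l z : B 0 z = 0.
Proof. by apply: (addrI (B 0 z)); rewrite -siDl !addr0. Qed.
Lemma siZl a x z : B (a *: x) z = a * B x z.
Proof. by rewrite -[a *: x]addr0 (semi_innerP HB) si0l addr0. Qed.
Lemma siNl x z : B (- x) z = - B x z.
Proof. by rewrite -scaleN1r siZl mulN1r. Qed.
Lemma siBl x y z : B (x - y) z = B x z - B y z.
Proof. by rewrite siDl siNl. Qed.
Lemma siDr x y z : B x (y + z) = B x y + B x z.
Proof. by rewrite !(semi_innerC HB x) siDl conjCD. Qed.
Lemma si0r z : B z 0 = 0.
Proof. by rewrite (semi_innerC HB) si0l conjC0. Qed.
Lemma siZr a x z : B x (a *: z) = a^* * B x z.
Proof. by rewrite !(semi_innerC HB x) siZl conjCM. Qed.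
Lemma siNr x z : B x (- z) = - B x z.
Proof. by rewrite -scaleN1r siZr rmorphN rmorph1 mulN1r. Qed.
Lemma siBr x y z : B x (y - z) = B x y - B x z.
Proof. by rewrite siDr siNr. Qed.
Lemma si_suml I (r : seq I) (P : pred I) (F : I -> E) z :
  B (\sum_(i <- r | P i) F i) z = \sum_(i <- r | P i) B (F i) z.
Proof.
elim/big_rec2: _ => [|i y x _ <-]; first exact: si0l.
by rewrite siDl.
Qed.
Lemma si_sumr I (r : seq I) (P : pred I) (F : I -> E) z :
  B z (\sum_(i <- r | P i) F i) = \sum_(i <- r | P i) B z (F i).
Proof.
elim/big_rec2: _ => [|i y x _ <-]; first exact: si0r.
by rewrite siDr.
Qed.

Definition sq x : R := Re (B x x).

Lemma si_sq x : B x x = (sq x)%:C.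
Proof.
apply: complex_eq => //=; have /(congr1 (@complex.Im R)) := semi_innerC HB x x.
by rewrite ImJ => h; lra.
Qed.
Lemma sq_ge0 x : 0 <= sq x. Proof. exact: semi_inner_ge0. Qed.

Lemma sqB x y : sq (x - y) = sq x - 2 * Re (B x y) + sq y.
Proof.
rewrite /sq !(siBl, siBr) (semi_innerC HB y x) !(ReB, ReJ); ring.
Qed.
Lemma sqD x y : sq (x + y) = sq x + 2 * Re (B x y) + sq y.
Proof. by rewrite -[y in LHS]opprK sqB siNr ReN /sq siNr siNl opprK; ring. Qed.
Lemma sqZ a x : sq (a *: x) = cmod a ^+ 2 * sq x.
Proof. by rewrite /sq siZl siZr mulrA mulcJ si_sq -rmorphM. Qed.

Lemma cauchy_schwarz x y : cmod (B x y) ^+ 2 <= sq x * sq y.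
Proof.
set b := B x y.
(* The phase of [b] is absorbed in the multiple of [y], leaving a real quadratic in [t]. *)
have key (t : R) : 0 <= sq x - 2 * t * cmod b ^+ 2 + t ^+ 2 * cmod b ^+ 2 * sq y.
  have := sq_ge0 (x - (t%:C * b) *: y); rewrite sqB sqZ siZr -/b cmodM cmodR.
  rewrite conjCM conjCR -mulrA (mulrC b^*) mulcJ -rmorphM/= exprMn.
  have -> : `|t| ^+ 2 = t ^+ 2 by rewrite -normrX ger0_norm// sqr_ge0.
  by rewrite mulrA.
have [y0|y0] := eqVneq (sq y) 0; last first.
  have yp : 0 < sq y by rewrite lt_def y0 sq_ge0.
  have := key (sq y)^-1.
  have -> : sq x - 2 * (sq y)^-1 * cmod b ^+ 2 + (sq y)^-1 ^+ 2 * cmod b ^+ 2 * sq y =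
    sq x - cmod b ^+ 2 / sq y by field.
  by rewrite subr_ge0 ler_pdivrMr.
rewrite y0 mulr0 leNgt; apply/negP => b0.
(* For a null [y] the quadratic is affine in [t]; this [t] gives it the value -1. *)
have := key ((sq x + 1) / (2 * cmod b ^+ 2)).
rewrite y0 mulr0 addr0.
have -> : sq x - 2 * ((sq x + 1) / (2 * cmod b ^+ 2)) * cmod b ^+ 2 = -1.
  by field; rewrite -sqrf_eq0 gt_eqF.
by rewrite lerNr oppr0 ler10.
Qed.

Lemma sq0_si x y : sq x = 0 -> B x y = 0.
Proof.
move=> x0; have := cauchy_schwarz x y; rewrite x0 mul0r => h.
apply/eqP; rewrite -cmod_eq0 -sqrf_eq0; apply/eqP/le_anti.
by rewrite h sqr_ge0.
Qed.

Lemma cauchy_schwarz_sqrt x y : cmod (B x y) <= Num.sqrt (sq x) * Num.sqrt (sq y).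
Proof.
rewrite -sqrtrM ?sq_ge0// -[leLHS]ger0_norm ?cmod_ge0// -sqrtr_sqr.
by rewrite ler_sqrt ?mulr_ge0 ?sq_ge0// cauchy_schwarz.
Qed.

Lemma sqrt_sqD x y : Num.sqrt (sq (x + y)) <= Num.sqrt (sq x) + Num.sqrt (sq y).
Proof.
have sx := sqrtr_ge0 (sq x); have sy := sqrtr_ge0 (sq y).
rewrite -[leRHS]ger0_norm ?addr_ge0// -sqrtr_sqr ler_sqrt ?sqr_ge0//.
rewrite sqrrD !sqr_sqrtr ?sq_ge0// sqD lerD2r lerD2l -[leRHS]mulr_natl.
by rewrite ler_wpM2l// (le_trans (Re_le_cmod _) (cauchy_schwarz_sqrt _ _)).
Qed.

End SemiInner.

Section SquareSummable.
Variable R : realType.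
Implicit Types (f g : nat -> R[i]^o).

Definition sqsum f n : R := \sum_(i < n) cmod (f i) ^+ 2.

Definition sqsummable : {pred (nat -> R[i]^o)} :=
  fun f => `[< exists M, forall n, sqsum f n <= M >].

Lemma sqsummableP f : reflect (exists M, forall n, sqsum f n <= M) (f \in sqsummable).
Proof. exact: asboolP. Qed.

Lemma sqsummable_submod : submod_closed sqsummable.
Proof.
split.
  apply/sqsummableP; exists 0 => n; rewrite /sqsum big1// => i _.
  by rewrite [X in cmod X](_ : _ = 0)// cmod0 expr0n.
move=> a f g /sqsummableP[M hM] /sqsummableP[N hN]; apply/sqsummableP.
exists (2 * cmod a ^+ 2 * M + 2 * N) => n.
apply: (@le_trans _ _ (2 * cmod a ^+ 2 * sqsum f n + 2 * sqsum g n)); last first.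
  by rewrite lerD// ler_wpM2l ?hM ?hN// mulr_ge0// sqr_ge0.
rewrite /sqsum !mulr_sumr -big_split/=; apply: ler_sum => i _.
rewrite -mulrA -exprMn -cmodM.
have -> : (a *: f + g) i = a * f i + g i by [].
have := cmodD (a * f i) (g i); have := cmod_ge0 (a * f i); have := cmod_ge0 (g i).
have := cmod_ge0 (a * f i + g i).
move: (cmod (a * f i)) (cmod (g i)) (cmod _) => u v w w0 v0 u0 h.
have : w ^+ 2 <= (u + v) ^+ 2 by rewrite ler_sqr ?nnegrE ?addr_ge0.
by have := sqr_ge0 (u - v); nra.
Qed.

HB.instance Definition _ := GRing.isSubmodClosed.Build _ _ sqsummable sqsummable_submod.

Record l2 : Type := L2 { l2val :> nat -> R[i]^o ; l2valP : l2val \in sqsummable }.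

HB.instance Definition _ := [isSub for l2val].
HB.instance Definition _ := [Choice of l2 by <:].
HB.instance Definition _ := [SubChoice_isSubLmodule of l2 by <:].

End SquareSummable.

Section L2Dot.
Variable R : realType.
Local Notation l2 := (l2 R).
Implicit Types (f g : l2).

Lemma l2D f g i : (f + g) i = f i + g i. Proof. by []. Qed.
Lemma l2Z a f i : (a *: f) i = a * f i. Proof. by []. Qed.
Lemma l2B f g i : (f - g) i = f i - g i. Proof. by []. Qed.
Lemma l2_0 i : (0 : l2) i = 0. Proof. by []. Qed.
Lemma l2_eq f g : (forall i, f i = g i) -> f = g.
Proof. by move=> h; apply: val_inj; apply/funext. Qed.

Definition l2psum f g n : R[i] := \sum_(i < n) f i * (g i)^*.

Lemma sqsum_cvg f : exists l : R, sqsum f n @[n --> \oo] --> l.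
Proof.
have /sqsummableP[M hM] := l2valP f.
suff /cvg_ex[l hl] : cvg (sqsum f n @[n --> \oo]) by exists l.
apply: nondecreasing_is_cvgn; last by exists M => _ [n _ <-].
by apply/nondecreasing_seqP => n; rewrite /sqsum big_ord_recr/= lerDl sqr_ge0.
Qed.

(** Polarisation: the real part comes from the square sums of [f + g], the imaginary part from those
    of [f + i g]. *)
Lemma l2psum_cvg f g : exists l, clim \oo (l2psum f g) l.
Proof.
have [a ha] := sqsum_cvg (f + g); have [b hb] := sqsum_cvg f.
have [c hc] := sqsum_cvg g; have [d hd] := sqsum_cvg (f + 'i%C *: g).
exists (((a - b - c) / 2) +i* ((d - b - c) / 2)); split => /=.
- have -> : (fun n => Re (l2psum f g n)) =
     fun n => (sqsum (f + g) n - sqsum f n - sqsum g n) / 2.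
    apply/funext => n; rewrite Re_sum /sqsum -!sumrB mulr_suml; apply: eq_bigr => i _.
    rewrite l2D !cmod_sqr ReM ReJ ImJ ReD ImD; case: (f i) => x y; case: (g i) => u v /=.
    by field.
  by apply: cvgMr_tmp; apply: cvgB => //; apply: cvgB.
- have -> : (fun n => Im (l2psum f g n)) =
     fun n => (sqsum (f + 'i%C *: g) n - sqsum f n - sqsum g n) / 2.
    apply/funext => n; rewrite Im_sum /sqsum -!sumrB mulr_suml; apply: eq_bigr => i _.
    rewrite l2D l2Z !cmod_sqr ImM ReJ ImJ ReD ImD; case: (f i) => x y; case: (g i) => u v /=.
    by field.
  by apply: cvgMr_tmp; apply: cvgB => //; apply: cvgB.
Qed.

Definition l2dot f g : R[i] := projT1 (cid (l2psum_cvg f g)).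

Lemma l2dotP f g : clim \oo (l2psum f g) (l2dot f g).
Proof. by rewrite /l2dot; case: cid. Qed.

Lemma l2dot_unique f g l : clim \oo (l2psum f g) l -> l2dot f g = l.
Proof. exact: clim_unique (l2dotP f g). Qed.

Lemma l2dot_linear a f g h : l2dot (a *: f + g) h = a * l2dot f h + l2dot g h.
Proof.
apply: l2dot_unique.
have -> : l2psum (a *: f + g) h = fun n => a * l2psum f h n + l2psum g h n.
  apply/funext => n; rewrite /l2psum mulr_sumr -big_split/=; apply: eq_bigr => i _.
  by rewrite mulrA -mulrDl.
by apply: climD; [apply: climM; [exact: clim_cst|]|]; exact: l2dotP.
Qed.

Lemma l2dotC f g : l2dot f g = (l2dot g f)^*.
Proof.
apply: l2dot_unique.
have -> : l2psum f g = fun n => (l2psum g f n)^*.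
  apply/funext => n; rewrite /l2psum conjC_sum; apply: eq_bigr => i _.
  by rewrite conjCM conjCK mulrC.
by apply: climJ; exact: l2dotP.
Qed.

Lemma l2psum_self f n : l2psum f f n = (sqsum f n)%:C.
Proof.
rewrite /l2psum /sqsum rmorph_sum/=; apply: eq_bigr => i _; exact: mulcJ.
Qed.

Lemma sqsum_le f n : sqsum f n <= Re (l2dot f f).
Proof.
have [h _] := l2dotP f f; apply: (cvgr_to_ge h); exists n => // m /= nm.
rewrite l2psum_self /= -(subnKC nm) /sqsum big_split_ord/= lerDl.
by apply: sumr_ge0 => i _; exact: sqr_ge0.
Qed.

Lemma l2dot_le f M : (forall n, sqsum f n <= M) -> Re (l2dot f f) <= M.
Proof.
move=> hM; have [h _] := l2dotP f f; apply: (cvgr_to_le h).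
by apply: nearW => n; rewrite l2psum_self; exact: hM.
Qed.

Lemma semi_inner_l2 : semi_inner l2dot.
Proof.
split; [exact: l2dot_linear|exact: l2dotC|move=> f].
by apply: le_trans (sqsum_le f 0); rewrite /sqsum big_ord0.
Qed.

Lemma l2dot_gt0 f : f != 0 -> 0 < Re (l2dot f f).
Proof.
move=> f0; rewrite lt_neqAle semi_inner_ge0 ?andbT; last exact: semi_inner_l2.
apply: contraNneq f0 => f0; apply/eqP/l2_eq => i; rewrite l2_0.
have := sqsum_le f i.+1; rewrite -f0 /sqsum big_ord_recr/= => h.
apply/eqP; rewrite -cmod_eq0 -sqrf_eq0; apply/eqP/le_anti; rewrite sqr_ge0 andbT.
by apply: le_trans h; rewrite lerDr sumr_ge0// => j _; exact: sqr_ge0.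
Qed.

Let si := semi_inner_l2.

HB.instance Definition _ := @isBilinear.Build R[i] l2 l2 R[i] *%R (Num.conj \; *%R) l2dot
  (fun g => (fun f1 f2 => siBl si f1 f2 g)) (fun f => siBr si f)
  (fun g a f => siZl si a f g) (fun f a g => siZr si a f g).

Let l2dot_herm f g : l2dot f g = (-1) ^+ false * Num.conj (l2dot g f).
Proof. by rewrite expr0 mul1r; exact: l2dotC. Qed.

HB.instance Definition _ := @isHermitianSesquilinear.Build R[i] l2 false Num.conj l2dot l2dot_herm.

Let l2dot_pos f : f != 0 -> 0 < l2dot f f.
Proof. by move=> f0; rewrite (si_sq si) ltcR l2dot_gt0. Qed.

HB.instance Definition _ := @isDotProduct.Build R[i] l2 l2dot l2dot_pos.

Definition l2norm f : R[i] := (Num.sqrt (sq l2dot f))%:C.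

Let l2norm_triangle f g : l2norm (f + g) <= l2norm f + l2norm g.
Proof. by rewrite /l2norm -rmorphD lecR; exact: sqrt_sqD. Qed.

Let l2normZ a f : l2norm (a *: f) = `|a| * l2norm f.
Proof.
rewrite /l2norm (sqZ si) normE -rmorphM sqrtrM ?sqr_ge0//.
by rewrite sqrtr_sqr ger0_norm ?cmod_ge0.
Qed.

Let l2norm0_eq0 f : l2norm f = 0 -> f = 0.
Proof.
move=> /complexI/eqP; rewrite sqrtr_eq0 => f0; apply/eqP; apply: contraTT f0 => f0.
by rewrite -ltNge l2dot_gt0.
Qed.

HB.instance Definition _ :=
  @Lmodule_isNormed.Build R[i] l2 l2norm l2norm_triangle l2normZ l2norm0_eq0.

Lemma l2_normE f : `|f| = (Num.sqrt (sq l2dot f))%:C. Proof. by []. Qed.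

Lemma l2_coord_le f i : cmod (f i) ^+ 2 <= sq l2dot f.
Proof.
apply: le_trans (sqsum_le f i.+1); rewrite /sqsum big_ord_recr/= lerDr.
by apply: sumr_ge0 => j _; exact: sqr_ge0.
Qed.

Lemma l2_complete (F : set_system l2) : ProperFilter F -> cauchy F -> cvg F.
Proof.
move=> FF /cauchyP Fc.
have ball_sq (f g : l2) (e : R) : 0 <= e -> ball f e%:C g -> sq l2dot (f - g) <= e ^+ 2.
  move=> e0; rewrite -ball_normE/= l2_normE ltcR => h.
  have : Num.sqrt (sq l2dot (f - g)) ^+ 2 <= e ^+ 2.
    by rewrite ler_sqr ?nnegrE ?sqrtr_ge0// ltW.
  by rewrite sqr_sqrtr//; exact: sq_ge0.
have hF (e : R) : 0 < e -> exists f0 : l2, F [set g | sq l2dot (f0 - g) <= e ^+ 2].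
  move=> e0; have e0C : 0 < (e%:C : R[i]) by rewrite ltcR.
  have [f0 h] := Fc _ e0C; exists f0; apply: filterS h => g.
  by apply: ball_sq; rewrite ltW.
have coord (h : R[i] -> R) i : (forall z w, `|h z - h w| <= cmod (z - w)) ->
    exists l : R, (fun g : l2 => h (g i)) @ F --> l.
  move=> hh; suff /cvg_ex[l hl] : cvg ((fun g : l2 => h (g i)) @ F) by exists l.
  apply: cauchy_cvg; apply: cauchy_exP => e e0.
  have e20 : 0 < e / 2 by rewrite divr_gt0.
  have [f0 h0] := hF _ e20; exists (h (f0 i)).
  change (F [set g : l2 | ball (h (f0 i)) e (h (g i))]).
  apply: filterS h0 => g hg; rewrite -ball_normE/=.
  apply: le_lt_trans (hh _ _) _; rewrite -l2B.
  have := le_trans (l2_coord_le (f0 - g) i) hg.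
  by rewrite ler_sqr ?nnegrE ?cmod_ge0 ?(ltW e20)// => /le_lt_trans; apply; lra.
have hc i : exists l, clim F (fun g : l2 => g i) l.
  have [a ha] := coord (@complex.Re R) i (fun z w => le_trans (eq_ind _ (fun u => `|u| <= _) (Re_cmod (z - w)) _ (ReB z w)) (lexx _)).
  have [b hb] := coord (@complex.Im R) i (fun z w => le_trans (eq_ind _ (fun u => `|u| <= _) (Im_cmod (z - w)) _ (ImB z w)) (lexx _)).
  by exists (a +i* b).
have [c {}hc] := choice hc.
(* A Fatou argument: finite partial sums pass to the coordinatewise limit [c]. The bound shows both
   that [c] is square-summable and that it is close to [f]. *)
have lim_bound (f : l2) (e : R) : F [set g | sq l2dot (f - g) <= e] ->
    forall n, sqsum (fun i => f i - c i) n <= e.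
  move=> hf n.
  have hl : (fun g : l2 => \sum_(i < n) cmod (f i - g i) ^+ 2) @ F --> sqsum (fun i => f i - c i) n.
    apply: (@cvgr_sum R _ F _ n (fun i (g : l2) => cmod (f i - g i) ^+ 2) (fun i => cmod (f i - c i) ^+ 2)) => i.
    rewrite !expr2; under eq_fun do rewrite expr2.
    have h1 := clim_cmod (climB (clim_cst (f i)) (hc i)).
    exact: (cvgM (h1 _ _ _) (h1 _ _ _)).
  apply: (cvgr_to_le hl); apply: filterS hf => g /= hg.
  exact: le_trans (sqsum_le (f - g) n) hg.
have cP : (c : nat -> R[i]^o) \in @sqsummable R.
  have [f0 h0] := hF _ ltr01.
  have hd : (fun i => f0 i - c i : R[i]^o) \in @sqsummable R.
    by apply/sqsummableP; eexists; exact: lim_bound h0.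
  have e1 : l2val f0 - (fun i => f0 i - c i : R[i]^o) = c.
    by apply/funext => i; exact: subKr.
  by rewrite -[c]e1; exact: (rpredB (l2valP f0) hd).
pose cl := L2 cP.
apply/cvg_ex; exists cl; apply/cvgrPdist_lt => e e0.
have [h1 h2] := ger0_Re (ltW e0); set r := Re e in h1 h2.
have r0 : 0 < r by move: e0; rewrite h1 ltcR.
have r40 : 0 < r / 4 by rewrite divr_gt0.
have [f0 h0] := hF _ r40.
have hb (g : l2) : sq l2dot (f0 - g) <= (r / 4) ^+ 2 -> Num.sqrt (sq l2dot (f0 - g)) <= r / 4.
  by move=> hg; rewrite -[leRHS]ger0_norm ?(ltW r40)// -sqrtr_sqr ler_sqrt ?sqr_ge0.
have dec (g : l2) : cl - g = (f0 - g) + (- (f0 - cl)).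
  by rewrite opprB [RHS]addrC addrA subrK.
apply: filterS (h0) => g hg; rewrite h1 l2_normE ltcR.
rewrite [cl - g](dec g).
apply: le_lt_trans (sqrt_sqD si _ _) _.
have -> : sq l2dot (- (f0 - cl)) = sq l2dot (f0 - cl) by rewrite /sq (siNl si) (siNr si) opprK.
have k1 := hb _ hg.
have k2 : Num.sqrt (sq l2dot (f0 - cl)) <= r / 4.
  by apply: hb; apply: l2dot_le => n; exact: (lim_bound f0 ((r / 4) ^+ 2) h0).
lra.
Qed.

HB.instance Definition _ := Uniform_isComplete.Build l2 l2_complete.

Let l2_hdot_norm f : `|f| ^+ 2 = l2dot f f.
Proof. by rewrite l2_normE -rmorphXn/= sqr_sqrtr ?(si_sq si)//; exact: sq_ge0. Qed.

Definition l2_hilbert : hilbertSpace R := @HilbertSpace R l2 l2dot l2_hdot_norm.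

End L2Dot.

Lemma clim_near_eq (R : realType) (T : Type) (F : set_system T)
    (FF : ProperFilter F) (u v : T -> R[i]) a :
  (\forall t \near F, u t = v t) -> clim F u a -> clim F v a.
Proof.
move=> h /climP hu; apply: (clim_squeeze (e := fun t => cmod (u t - a))) => //.
by apply: filterS h => t ->.
Qed.

(** * Bounded operators, Vigier's theorem and vector states *)

Section Hilbert.
Variables (R : realType) (H : hilbertSpace R).
Local Notation dot := (@hdot R H).
Implicit Types (x y z : H) (S T : H -> H).

Let hnormr (x : H) : `|x| = (Re `|x|)%:C.
Proof. by have [] := ger0_Re (normr_ge0 x). Qed.

Lemma semi_inner_hdot : semi_inner (fun x y => dot x y).
Proof.
split=> [a x y z|x y|x]; first exact: linearPl.
- by rewrite hermC expr0 mul1r.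
- by rewrite -hdot_norm hnormr -rmorphXn/= sqr_ge0.
Qed.
Local Notation si := semi_inner_hdot.

Definition hn x : R := Num.sqrt (sq (fun x y => dot x y) x).

Lemma hn_ge0 x : 0 <= hn x. Proof. exact: sqrtr_ge0. Qed.

Lemma hn_sqr x : hn x ^+ 2 = Re (dot x x).
Proof. by rewrite sqr_sqrtr//; exact: (sq_ge0 si). Qed.

Lemma dot_self x : dot x x = (hn x ^+ 2)%:C.
Proof. by rewrite hn_sqr; exact: (si_sq si). Qed.

Lemma norm_hn x : `|x| = (hn x)%:C.
Proof.
have [h1 h2] := ger0_Re (normr_ge0 x).
rewrite h1; congr (_%:C); rewrite -[LHS]ger0_norm// -sqrtr_sqr; congr Num.sqrt.
by rewrite /sq -hdot_norm h1 -rmorphXn.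
Qed.

Lemma hn_cauchy_schwarz x y : cmod (dot x y) <= hn x * hn y.
Proof. exact: (cauchy_schwarz_sqrt si). Qed.

Lemma hnD x y : hn (x + y) <= hn x + hn y.
Proof. exact: (sqrt_sqD si). Qed.

Lemma hnZ a x : hn (a *: x) = cmod a * hn x.
Proof.
by rewrite /hn (sqZ si) sqrtrM ?sqr_ge0// sqrtr_sqr ger0_norm ?cmod_ge0.
Qed.

Lemma hnN x : hn (- x) = hn x.
Proof. by rewrite -scaleN1r hnZ cmodN cmod1 mul1r. Qed.

Lemma hn0_eq0 x : hn x = 0 -> x = 0.
Proof. by move=> x0; apply/normr0_eq0; rewrite norm_hn x0. Qed.

Lemma dot_ext x y : (forall z, dot x z = dot y z) -> x = y.
Proof.
move=> h; apply/eqP; rewrite -subr_eq0; apply/eqP/hn0_eq0/eqP.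
by rewrite -sqrf_eq0 hn_sqr (siBl si) h subrr.
Qed.

Lemma BH_intro T (M : R) : linear T -> (forall x, hn (T x) <= M * hn x) -> BH T.
Proof.
by move=> lT hM; split=> //; exists M%:C => x; rewrite !norm_hn -rmorphM lecR.
Qed.

Lemma BH_bound T : BH T -> exists2 M : R, 0 <= M & forall x, hn (T x) <= M * hn x.
Proof.
move=> [lT [M hM]]; exists (cmod M); first exact: cmod_ge0.
move=> x; have := hM x; rewrite -[M * _]ger0_norm; last exact: le_trans (hM x).
by rewrite normrM !normr_id normE !norm_hn -rmorphM lecR.
Qed.

Lemma BHD T : BH T -> forall x y, T (x + y) = T x + T y.
Proof. by move=> [lT _] x y; have := lT 1 x y; rewrite !scale1r. Qed.

Lemma BH0 T : BH T -> T 0 = 0.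
Proof. by move=> bT; apply: (addrI (T 0)); rewrite -(BHD bT) !addr0. Qed.

Lemma BHZ T : BH T -> forall a x, T (a *: x) = a *: T x.
Proof. by move=> bT a x; have := bT.1 a x 0; rewrite (BH0 bT) !addr0. Qed.

Lemma BHB T : BH T -> forall x y, T (x - y) = T x - T y.
Proof. by move=> bT x y; rewrite (BHD bT) -scaleN1r (BHZ bT) scaleN1r. Qed.

Lemma BH_id : BH (id : H -> H).
Proof. by apply: (@BH_intro _ 1) => // x; rewrite mul1r. Qed.

Lemma BH_comp S T : BH S -> BH T -> BH (S \o T).
Proof.
move=> bS bT; have [M M0 hM] := BH_bound bS; have [N N0 hN] := BH_bound bT.
apply: (@BH_intro _ (M * N)) => [a x y|x] /=; first by rewrite bT.1 bS.1.
by apply: le_trans (hM _) _; rewrite -mulrA ler_wpM2l.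
Qed.

Lemma BH_add S T : BH S -> BH T -> BH (fun x => S x + T x).
Proof.
move=> bS bT; have [M M0 hM] := BH_bound bS; have [N N0 hN] := BH_bound bT.
apply: (@BH_intro _ (M + N)) => [a x y|x] /=.
  by rewrite bT.1 bS.1 scalerDr addrACA.
by apply: le_trans (hnD _ _) _; rewrite mulrDl lerD.
Qed.

Lemma BH_scale a S : BH S -> BH (fun x => a *: S x).
Proof.
move=> bS; have [M M0 hM] := BH_bound bS.
apply: (@BH_intro _ (cmod a * M)) => [b x y|x] /=.
  by rewrite bS.1 scalerDr !scalerA mulrC.
by rewrite hnZ -mulrA ler_wpM2l// cmod_ge0.
Qed.

Lemma BH_sub S T : BH S -> BH T -> BH (fun x => S x - T x).
Proof.
move=> bS bT; have := BH_add bS (BH_scale (-1) bT).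
by congr BH; apply/funext => x; rewrite scaleN1r.
Qed.

Lemma BH_iter S n : BH S -> BH (iter n S).
Proof.
by move=> bS; elim: n => [|n IH]; [exact: BH_id|exact: (BH_comp bS IH)].
Qed.

(** Mutually inverse contractions preserve norms. Polarisation then preserves real parts of dot
    products, and replacing [x] by [i x] the imaginary parts. *)
Lemma contraction_unitary U U' : linear U -> linear U' ->
  (forall x, hn (U x) <= hn x) -> (forall x, hn (U' x) <= hn x) ->
  U \o U' = id -> U' \o U = id -> unitary U.
Proof.
move=> lU lU' cU cU' UU' U'U.
have bU : BH U by apply: (@BH_intro _ 1) => // x; rewrite mul1r.
have bU' : BH U' by apply: (@BH_intro _ 1) => // x; rewrite mul1r.
have iso x : sq (fun x y => dot x y) (U x) = sq (fun x y => dot x y) x.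
  rewrite /sq -!hn_sqr; congr (_ ^+ 2); apply/le_anti; rewrite cU/=.
  by rewrite -{1}[x](congr1 (@^~ x) U'U) cU'.
have isoRe x y : Re (dot (U x) (U y)) = Re (dot x y).
  have := iso (x + y); rewrite (BHD bU) !(sqD si) !iso.
  by move=> h; lra.
have isoD x y : dot (U x) (U y) = dot x y.
  apply: complex_eq => //; have := isoRe ('i%C *: x) y.
  rewrite (BHZ bU) !(siZl si) !ReM /= !mul0r !mul1r !sub0r.
  by move=> /oppr_inj.
split=> //; exists U' => //; split=> // x y.
by rewrite -{1}[y](congr1 (@^~ y) UU') isoD.
Qed.

Section VectorState.
Variables (w : H) (w1 : dot w w = 1).

Definition vstate T : R[i] := dot (T w) w.

Definition rform T x : R := Re (dot (T x) x).

Lemma sa_Im T x : is_adjoint T T -> Im (dot (T x) x) = 0.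
Proof.
move=> aT; have : dot (T x) x = (dot (T x) x)^* by rewrite {1}aT (semi_innerC si).
by move=> /(congr1 (@complex.Im R)); rewrite ImJ => h; lra.
Qed.

(** The order of [R[i]] also requires equal imaginary parts, and those of a self-adjoint form are
    0. *)
Lemma op_leP S T : is_adjoint S S -> is_adjoint T T ->
  op_le S T <-> forall x, rform S x <= rform T x.
Proof.
move=> aS aT; rewrite /op_le; split=> h x; have := h x.
  by rewrite lecE => /andP[].
by rewrite lecE !sa_Im// eqxx.
Qed.

Section Vigier.
Variables (D : set (H -> H)) (T : H -> H).
Hypotheses (dD : op_directed D) (lubT : op_lub D T).

Let Dsa S : D S -> BHsa S. Proof. by have [_ h _] := dD; exact: h. Qed.
Let Tsa : BHsa T. Proof. by have [] := lubT. Qed.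
Let leT S x : D S -> rform S x <= rform T x.
Proof.
move=> DS; have [_ h _] := lubT; move: x; apply/op_leP; last exact: h.
- by have [] := Dsa DS.
- by have [] := Tsa.
Qed.
Let leD S S' : D S -> D S' -> op_le S S' <-> forall x, rform S x <= rform S' x.
Proof. by move=> /Dsa[_ a] /Dsa[_ b]; exact: op_leP. Qed.

(** The tails of the net [D]: a strong limit of the net is a limit along this filter. *)
Let G : set_system (H -> H) :=
  [set A | exists2 S0, D S0 & forall S, D S -> op_le S0 S -> A S].

Let op_le_refl S : op_le S S. Proof. by move=> x. Qed.
Let op_le_trans S1 S2 S3 : op_le S1 S2 -> op_le S2 S3 -> op_le S1 S3.
Proof. by move=> h1 h2 x; apply: le_trans (h1 x) (h2 x). Qed.

Let GF : ProperFilter G.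
Proof.
have [[S0 DS0] _ dir] := dD.
apply: Build_ProperFilter.
  by move=> [S DS h]; exact: (h S DS (@op_le_refl S)).
split.
- by exists S0.
- move=> A B [S1 D1 h1] [S2 D2 h2]; have [S [DS l1 l2]] := dir _ _ D1 D2.
  exists S => // S' DS' l; split; [apply: h1|apply: h2] => //.
    exact: op_le_trans l1 l.
  exact: op_le_trans l2 l.
- by move=> A B AB [S1 D1 h1]; exists S1 => // S DS l; apply/AB/h1.
Qed.

#[local] Existing Instance GF.

Let G_tail S0 : D S0 -> G [set S | D S /\ op_le S0 S].
Proof. by move=> DS0; exists S0. Qed.

(* Cauchy-Schwarz for the form <A x, y>, A = S' - S >= 0. *)
Let increment S0 : D S0 -> exists2 M : R, 0 <= M & forall S S' x, D S -> D S' ->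
  op_le S0 S -> op_le S S' ->
  hn (S' x - S x) ^+ 2 <= M * (rform S' x - rform S x).
Proof.
move=> DS0; have bTS := BH_sub Tsa.1 (Dsa DS0).1.
have [M M0 hM] := BH_bound bTS; exists M => // S S' x DS DS' l1 l2.
have [bS aS] := Dsa DS; have [bS' aS'] := Dsa DS'.
pose B x y := dot (S' x - S x) y.
have siB : semi_inner B.
  split=> [a u v z|u v|u]; rewrite /B.
  - by rewrite !(siBl si) bS'.1 bS.1 !(siDl si) !(siZl si); ring.
  - by rewrite !(siBl si) conjCB aS aS' -!(semi_innerC si).
  - by rewrite (siBl si) ReB subr_ge0; exact: (leD DS DS').1.
have sqB u : sq B u = rform S' u - rform S u.
  by rewrite /sq /B (siBl si) ReB.
set y := S' x - S x.
have By : B x y = (hn y ^+ 2)%:C by exact: dot_self.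
have := cauchy_schwarz siB x y; rewrite By cmodR ger0_norm ?sqr_ge0// !sqB.
(* Since [S'] is below [T] and [S] above [S0], the increment is dominated by the fixed operator
   [T - S0], whose bound is [M]. *)
have : rform S' y - rform S y <= M * hn y ^+ 2.
  apply: (@le_trans _ _ (rform T y - rform S0 y)).
    by rewrite lerB// ?leT//; exact: (leD DS0 DS).1.
  rewrite /rform -ReB -(siBl si); apply: le_trans (Re_le_cmod _) _.
  apply: le_trans (hn_cauchy_schwarz _ _) _.
  by rewrite expr2 mulrA ler_wpM2r ?hn_ge0.
have x0 : 0 <= rform S' x - rform S x by rewrite -sqB; exact: (sq_ge0 siB).
move: (rform S' x - _) (rform S' y - _) x0 => u v u0 hv h.
have hy0 := hn_ge0 y; have [/eqP y0|yn0] := eqVneq (hn y) 0.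
  by rewrite (eqP y0) expr0n/= mulr_ge0.
have yp : 0 < hn y ^+ 2 by rewrite exprn_gt0// lt_def yn0.
rewrite -(ler_pM2r yp) -expr2; apply: le_trans h _.
by rewrite (mulrC M) -mulrA ler_wpM2l.
Qed.

Let rform_cauchy S0 x (e : R) : D S0 -> 0 < e ->
  exists S1, [/\ D S1, op_le S0 S1 & forall S, D S -> op_le S1 S ->
    rform S x - rform S1 x < e].
Proof.
move=> DS0 e0; pose A := [set rform S x | S in D].
have hA : has_sup A.
  split; first by exists (rform S0 x); exists S0.
  by exists (rform T x) => _ [S DS <-]; exact: leT.
have [_ [S1 D1 <-] h1] := sup_adherent e0 hA.
have [_ _ dir] := dD; have [S2 [D2 l1 l2]] := dir _ _ DS0 D1.
exists S2; split=> // S DS l.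
have : rform S x <= sup A by apply: ub_le_sup; [exact: hA.2|exists S].
have : rform S1 x <= rform S2 x by apply: (leD D1 D2).1.
lra.
Qed.

Let pointwise x : exists y, (fun S => hn (S x - y)) @ G --> (0 : R).
Proof.
have [[S0 DS0] _ _] := dD; have [M M0 hM] := increment DS0.
have Mp : 0 < M + 1 by lra.
suff /cvg_ex[y hy] : cvg ((fun S => S x) @ G).
  exists y; apply/cvgrPdist_lt => e e0.
  have e0C : 0 < (e%:C : R[i]) by rewrite ltcR.
  move/cvgrPdist_lt : hy => /(_ _ e0C); apply: filterS => S.
  by rewrite norm_hn ltcR sub0r normrN ger0_norm ?hn_ge0// -hnN opprB.
apply: cauchy_cvg; apply: cauchy_exP => e e0.
have [h1 h2] := ger0_Re (ltW e0); set r := Re e in h1 h2.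
have r0 : 0 < r by move: e0; rewrite h1 ltcR.
have d0 : 0 < r ^+ 2 / (M + 1) by rewrite divr_gt0// exprn_gt0.
have [S1 [D1 l1 hS1]] := rform_cauchy x DS0 d0.
exists (S1 x); change (G [set S | ball (S1 x) e (S x)]).
exists S1 => // S DS l; rewrite -ball_normE/= h1 norm_hn ltcR -hnN opprB.
rewrite -(@ltr_sqr _ _ r) ?nnegrE ?hn_ge0//.
apply: le_lt_trans (hM S1 S x D1 DS l1 l) _.
have := hS1 S DS l; rewrite ltr_pdivlMr//.
have : rform S1 x <= rform S x by apply: (leD D1 DS).1.
by move: (rform S x) (rform S1 x) => a b; nra.
Qed.

(* Vigier's theorem: a bounded increasing net converges strongly. *)
Lemma vigier : exists T', [/\ BHsa T', forall S, D S -> op_le S T' &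
  forall x, clim G (fun S => dot (S x) x) (dot (T' x) x)].
Proof.
have [T' hT'] := choice pointwise.
have lim x y : clim G (fun S => dot (S x) y) (dot (T' x) y).
  apply: (clim_squeeze (e := fun S => hn (S x - T' x) * hn y)).
    apply: nearW => S; rewrite -(siBl si); exact: hn_cauchy_schwarz.
  by rewrite -[X in _ --> X](mul0r (hn y)); apply: cvgMr_tmp.
have [[S0 DS0] _ _] := dD; have [M M0 hM] := increment DS0.
have linT' : linear T'.
  move=> a x y; apply: dot_ext => z; apply: (clim_unique (lim _ z)).
  rewrite (siDl si) (siZl si).
  apply: clim_near_eq (climD (climM (clim_cst a) (lim x z)) (lim y z)).
  apply: filterS (G_tail DS0) => S [DS _].
  by rewrite (Dsa DS).1.1 (siDl si) (siZl si).
have adj : is_adjoint T' T'.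
  move=> x y; rewrite [RHS](semi_innerC si); apply: (clim_unique (lim x y)).
  apply: clim_near_eq (climJ (lim y x)); apply: filterS (G_tail DS0) => S [DS _].
  by rewrite (Dsa DS).2 -(semi_innerC si).
have [MT MT0 hMT] := BH_bound Tsa.1; have [N N0 hN] := BH_bound (Dsa DS0).1.
have rf_le S L x : 0 <= L -> (forall x, hn (S x) <= L * hn x) ->
    `|rform S x| <= L * hn x ^+ 2.
  move=> L0 hL; apply: le_trans (Re_cmod _) _.
  by apply: le_trans (hn_cauchy_schwarz _ _) _; rewrite expr2 mulrA ler_wpM2r ?hn_ge0.
(* [increment] bounds the square of the norm of [S x - S0 x] by [a * hn x ^+ 2] with
   [a = M * (MT + N)]; the square root is avoided by [a <= (a + 1)^2]. *)
pose K := M * (MT + N) + 1.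
have K0 : 0 <= K by rewrite /K addr_ge0// mulr_ge0// addr_ge0.
have bnd S x : D S -> op_le S0 S -> hn (S x) <= (N + K) * hn x.
  move=> DS l; rewrite -[S x](subrK (S0 x)) addrC mulrDl.
  apply: le_trans (hnD _ _) _; apply: lerD => //.
  rewrite -ler_sqr ?nnegrE ?mulr_ge0 ?hn_ge0//.
  apply: le_trans (hM S0 S x DS0 DS (@op_le_refl S0) l) _.
  have h1 : rform S x <= rform T x by exact: leT.
  have h2 : rform T x <= MT * hn x ^+ 2 by exact: le_trans (ler_norm _) (rf_le T MT x MT0 hMT).
  have h3 : - rform S0 x <= N * hn x ^+ 2.
    by apply: le_trans (rf_le S0 N x N0 hN); rewrite -normrN ler_norm.
  apply: (@le_trans _ _ (M * ((MT + N) * hn x ^+ 2))).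
    by apply: ler_wpM2l => //; rewrite mulrDl; lra.
  rewrite mulrA exprMn ler_wpM2r ?sqr_ge0//.
  have : 0 <= M * (MT + N) by rewrite mulr_ge0// addr_ge0.
  by rewrite /K; move: (M * _) => a; nra.
exists T'; split=> [||x]; last exact: lim.
- split=> //; apply: (@BH_intro _ (N + K)) => // x.
  have := hn_ge0 (T' x); rewrite le_eqVlt => /predU1P[<-|y0].
    by rewrite mulr_ge0 ?hn_ge0// addr_ge0.
  rewrite -(ler_pM2r y0) -expr2 -[leLHS]ger0_norm ?sqr_ge0// -cmodR -dot_self.
  apply: (clim_le (lim x (T' x))); apply: filterS (G_tail DS0) => S [DS l].
  apply: le_trans (hn_cauchy_schwarz _ _) _.
  by rewrite ler_wpM2r ?hn_ge0// bnd.
- move=> S DS; apply/op_leP; [exact: (Dsa DS).2|exact: adj|move=> x].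
  have [h _] := lim x x; apply: (cvgr_to_ge h); apply: filterS (G_tail DS) => S' [DS' l].
  exact: (leD DS DS').1.
Qed.

(** The strong limit is an upper bound of [D], so the least one, [T], lies below it; the form of the
    strong limit is a limit of forms of the net, all at most [u]. *)
Lemma vigier_lub x u : (forall S, D S -> dot (S x) x <= u) -> dot (T x) x <= u.
Proof.
move=> hu; have [T' [saT' ubT' limT']] := vigier.
have [_ _ leastT] := lubT; apply: le_trans (leastT _ saT' ubT' x) _.
have [[S0 DS0] _ _] := dD.
(* Comparing the complex number [u] with one form of the net shows that [u] is real. *)
have := hu _ DS0; rewrite !lecE (sa_Im x saT'.2) (sa_Im x (Dsa DS0).2) => /andP[-> _]/=.
have [h _] := limT' x; apply: (cvgr_to_le h); apply: filterS (G_tail DS0) => S [DS _].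
by have := hu _ DS; rewrite lecE => /andP[].
Qed.

End Vigier.

Lemma normal_vstate : normal_state vstate.
Proof.
split=> [a S T bS bT|T bT hT||D T dD lubT]; rewrite /vstate //=.
- by rewrite (siDl si) (siZl si).
- split=> [_ [S DS <-]|u hu]; first by have [_ h _] := lubT; exact: h.
  by apply: (vigier_lub dD lubT) => S DS; apply: hu; exists S.
Qed.

End VectorState.
End Hilbert.

(** * Gram-Schmidt and lifting of isometries *)

Section GramSchmidt.
Variables (R : realType) (E : lmodType R[i]) (B : E -> E -> R[i]).
Hypothesis (HB : semi_inner B).
Variable g : nat -> E.

(** On a null vector the convention [0^-1 = 0] yields the vector 0, so dependent generators keep
    their index with a zero basis vector. *)
Definition gs_normalize (r : E) : E := ((Num.sqrt (sq B r))^-1)%:C *: r.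

Fixpoint gs_seq n : seq E :=
  if n is m.+1 then
    rcons (gs_seq m) (gs_normalize (g m - \sum_(e <- gs_seq m) B (g m) e *: e))
  else [::].

Definition gs n : E := nth 0 (gs_seq n.+1) n.

Let size_gs_seq n : size (gs_seq n) = n.
Proof. by elim: n => //= n IH; rewrite size_rcons IH. Qed.

Let gs_seqE n : gs_seq n = [seq gs i | i <- iota 0 n].
Proof.
elim: n => // n IH; rewrite -addn1 iotaD map_cat -IH addn1 /= cats1; congr rcons.
by rewrite /gs /= nth_rcons size_gs_seq ltnn eqxx.
Qed.

Let gs_res n : E := g n - \sum_(i < n) B (g n) (gs i) *: gs i.

Let gsE n : gs n = gs_normalize (gs_res n).
Proof.
rewrite /gs /= nth_rcons size_gs_seq ltnn eqxx; congr (gs_normalize (_ - _)).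
by rewrite gs_seqE big_map -{1}[n]subn0 big_mkord.
Qed.

Definition gs_nz n : bool := sq B (gs_res n) != 0.

Let gs_res_null n h : ~~ gs_nz n -> B (gs_res n) h = 0.
Proof. by rewrite negbK => /eqP; exact: sq0_si. Qed.

Lemma gs_null n : ~~ gs_nz n -> gs n = 0.
Proof.
by rewrite negbK gsE /gs_normalize => /eqP ->; rewrite sqrtr0 invr0 scale0r.
Qed.

Let gs_res_pos n : gs_nz n -> 0 < sq B (gs_res n).
Proof. by move=> nz; rewrite lt_neqAle eq_sym (sq_ge0 HB) andbT; exact: nz. Qed.

Let gs_norm n : gs_nz n -> B (gs n) (gs n) = 1.
Proof.
move=> nz; rewrite (si_sq HB) gsE /gs_normalize (sqZ HB) cmodR.
have pos := gs_res_pos nz.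
rewrite normrV ?unitfE ?gt_eqF ?sqrtr_gt0// ger0_norm ?sqrtr_ge0// exprVn.
by rewrite sqr_sqrtr ?ltW// mulVf ?gt_eqF.
Qed.

Lemma gs_ortho i j : B (gs i) (gs j) = ((i == j) && gs_nz i)%:R.
Proof.
have lt_ortho n : forall k, (k < n)%N -> B (gs n) (gs k) = 0.
  elim/ltn_ind: n => n IH k kn; rewrite gsE /gs_normalize (siZl HB).
  have -> : B (gs_res n) (gs k) = 0; last by rewrite mulr0.
  rewrite /gs_res (siBl HB) (si_suml HB) (bigD1 (Ordinal kn))//= big1 => [|l lk].
    rewrite addr0 (siZl HB); have [nz|z] := boolP (gs_nz k).
      by rewrite gs_norm// mulr1 subrr.
    by rewrite gs_null// !(si0r HB) mulr0 subrr.
  rewrite (siZl HB); have := lk; rewrite -val_eqE /= neq_ltn => /orP[h|h].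
    by rewrite [B (gs l) _](semi_innerC HB) IH// conjC0 mulr0.
  by rewrite IH ?mulr0.
have [<-|ij] /= := eqVneq i j.
  by have [nz|z] := boolP (gs_nz i); [exact: gs_norm|rewrite gs_null// (si0l HB)].
move: ij; rewrite neq_ltn => /orP[h|h]; last exact: lt_ortho.
by rewrite (semi_innerC HB) lt_ortho// conjC0.
Qed.

Lemma gs_ortho_ord n (i j : 'I_n) : j != i -> B (gs i) (gs j) = 0.
Proof.
move=> ji; rewrite gs_ortho (_ : (i == j :> nat) = false)//.
by apply: contraNF ji => /eqP ij; apply/eqP/val_inj.
Qed.

Inductive gspan : E -> Prop :=
| gspan0 : gspan 0
| gspanS a k f : gspan f -> gspan (a *: g k + f).

Lemma gspanD f h : gspan f -> gspan h -> gspan (f + h).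
Proof.
move=> sf sh; elim: sf => [|a k f' _ IH]; first by rewrite add0r.
by rewrite -addrA; exact: gspanS.
Qed.

Lemma gspanZ a f : gspan f -> gspan (a *: f).
Proof.
elim=> [|b k f' _ IH]; first by rewrite scaler0; exact: gspan0.
by rewrite scalerDr scalerA; exact: gspanS.
Qed.

Lemma gspan_gen k : gspan (g k).
Proof. by rewrite -[g k]scale1r -[_ *: _]addr0; apply: gspanS; exact: gspan0. Qed.

Lemma gspan_gs n : gspan (gs n).
Proof.
elim/ltn_ind: n => n IH; rewrite gsE; apply: gspanZ; rewrite /gs_res.
apply: gspanD; first exact: gspan_gen.
rewrite -scaleN1r; apply: gspanZ; elim/big_rec: _ => [|i x _ sx]; first exact: gspan0.
by apply: gspanD => //; apply: gspanZ; exact: IH.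
Qed.

Lemma gspan_map (T : E -> E) : linear T -> (forall k, gspan (T (g k))) ->
  forall f, gspan f -> gspan (T f).
Proof.
move=> lT hT f; elim=> [|a k f' _ IH]; last by rewrite lT; apply: gspanD => //; exact: gspanZ.
by rewrite (_ : T 0 = 0); [exact: gspan0|have := lT (-1) 0 0; rewrite scaler0 addr0 scaleN1r addNr].
Qed.

(** [f] equals its finite expansion along [gs] modulo null vectors; [h] ranges over all of [E], not
    only over the span. *)
Definition parseval f N := forall h, B f h = \sum_(k < N) B f (gs k) * B (gs k) h.

Lemma parseval_widen f N N' : (N <= N')%N -> parseval f N -> parseval f N'.
Proof.
move=> /subnKC <- pf h; rewrite big_split_ord/= -pf big1 ?addr0// => i _.
rewrite pf big1 ?mul0r// => k _; rewrite gs_ortho.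
by rewrite ltn_eqF/= ?mulr0// (leq_trans (ltn_ord k))// leq_addr.
Qed.

Let parseval_gen n : parseval (g n) n.+1.
Proof.
move=> h; rewrite big_ord_recr/=.
have e1 : g n = \sum_(i < n) B (g n) (gs i) *: gs i + gs_res n by rewrite addrC subrK.
rewrite {1}e1 (siDl HB) (si_suml HB); congr (_ + _).
  by apply: eq_bigr => i _; rewrite (siZl HB).
have [nz|z] := boolP (gs_nz n); last by rewrite gs_res_null// gs_null// (si0l HB) mulr0.
have e2 : gs_res n = (Num.sqrt (sq B (gs_res n)))%:C *: gs n.
  rewrite gsE /gs_normalize scalerA -rmorphM mulfV ?scale1r// gt_eqF// sqrtr_gt0.
  exact: gs_res_pos.
have -> : B (g n) (gs n) = B (gs_res n) (gs n).
  rewrite {1}e1 (siDl HB) (si_suml HB) big1 ?add0r// => i _.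
  by rewrite (siZl HB) gs_ortho ltn_eqF// mulr0.
by rewrite {1 2}e2 !(siZl HB) gs_norm// mulr1.
Qed.

Lemma gspan_parseval f : gspan f -> exists N, parseval f N.
Proof.
elim=> [|a k f' _ [N pN]]; first by exists 0 => h; rewrite big_ord0 (si0l HB).
exists (maxn k.+1 N) => h.
have p1 := parseval_widen (leq_maxl k.+1 N) (@parseval_gen k).
have p2 := parseval_widen (leq_maxr k.+1 N) pN.
rewrite (semi_innerP HB) p1 p2 mulr_sumr -big_split/=; apply: eq_bigr => i _.
by rewrite (semi_innerP HB) mulrDl mulrA.
Qed.

Lemma bessel f n : \sum_(i < n) cmod (B f (gs i)) ^+ 2 <= sq B f.
Proof.
pose s := \sum_(i < n) B f (gs i) *: gs i.
have Bs : B f s = (\sum_(i < n) cmod (B f (gs i)) ^+ 2)%:C.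
  rewrite (si_sumr HB) rmorph_sum; apply: eq_bigr => i _.
  by rewrite (siZr HB) mulrC mulcJ.
have ss : B s s = B f s.
  rewrite {1}/s (si_suml HB) (si_sumr HB); apply: eq_bigr => i _.
  rewrite (siZl HB) (siZr HB) (si_sumr HB) (bigD1 i)//= big1 => [|j ji].
    rewrite addr0 (siZr HB) gs_ortho eqxx /=.
    have [nz|z] := boolP (gs_nz i); first by rewrite mulr1 mulrC.
    by rewrite gs_null// (si0r HB) mul0r mulr0.
  by rewrite (siZr HB) gs_ortho_ord// mulr0.
have := sq_ge0 HB (f - s); rewrite (sqB HB) /sq ss Bs /= => h; lra.
Qed.

(** Bessel's inequality defines it on all of [E]; Parseval makes it compatible with the forms as
    soon as one argument is in the span. *)
Definition gs_coord f : l2 R :=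
  L2 (introT (sqsummableP (fun i => B f (gs i))) (ex_intro _ _ (bessel f))).

Local Notation J := gs_coord.

Lemma gs_coord_dot f h : gspan f -> l2dot (J f) (J h) = B f h.
Proof.
move=> /gspan_parseval[N pN]; apply: l2dot_unique.
apply: clim_near_eq (clim_cst (B f h)); exists N => // n /= Nn.
rewrite (parseval_widen Nn pN); apply: eq_bigr => i _.
by rewrite /= (semi_innerC HB (gs i)).
Qed.

Section Lift.
Variables (T T' : E -> E).
Hypotheses (lT : linear T) (adjT : forall f h, B (T f) h = B f (T' h)).
Hypotheses (isoT : forall f, sq B (T f) = sq B f).
Hypothesis spT' : forall f, gspan f -> gspan (T' f).

(** As [T'] preserves the span, row [i] of the matrix of [T] vanishes from column [deg i] on: each
    coordinate of the lift is a finite sum, even for an arbitrary sequence in [l2]. *)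
Let deg i : nat := projT1 (cid (gspan_parseval (spT' (gspan_gs i)))).
Let degP i : parseval (T' (gs i)) (deg i).
Proof. by rewrite /deg; case: cid. Qed.

Let lift_sum (c : nat -> R[i]) i N := \sum_(j < N) c j * B (gs j) (T' (gs i)).

Let lift_sumE c i N : lift_sum c i N = B (T (\sum_(j < N) c j *: gs j)) (gs i).
Proof. by rewrite adjT (si_suml HB); apply: eq_bigr => j _; rewrite (siZl HB). Qed.

Let deg_out i j : (deg i <= j)%N -> B (gs j) (T' (gs i)) = 0.
Proof.
move=> ij; rewrite (semi_innerC HB) degP big1 ?conjC0// => k _.
by rewrite gs_ortho ltn_eqF/= ?mulr0// (leq_trans (ltn_ord k)).
Qed.

Let lift_sum_deg c i N : (deg i <= N)%N -> lift_sum c i N = lift_sum c i (deg i).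
Proof.
move=> /subnKC <-; rewrite /lift_sum big_split_ord/= [X in _ + X]big1 ?addr0// => j _.
by rewrite deg_out ?mulr0// leq_addr.
Qed.

(* The first term fixes the coordinates of null vectors [gs i = 0], so that the
   lift is invertible on all of [l2]. *)
Definition lift_coord (c : nat -> R[i]) i : R[i] :=
  (~~ gs_nz i)%:R * c i + \sum_(j < deg i) c j * B (gs j) (T' (gs i)).

Lemma lift_coordE c i N : (deg i <= N)%N ->
  lift_coord c i = (~~ gs_nz i)%:R * c i + \sum_(j < N) c j * B (gs j) (T' (gs i)).
Proof. by move=> iN; rewrite /lift_coord -[X in _ + X](lift_sum_deg c iN). Qed.

Lemma lift_coord_ex : exists d : nat -> nat, forall i c N, (d i <= N)%N ->
  lift_coord c i = (~~ gs_nz i)%:R * c i + \sum_(j < N) c j * B (gs j) (T' (gs i)).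
Proof. by exists deg => i c N; exact: lift_coordE. Qed.

(** The first [n] coordinates see a truncation [f] of [c] only. At non-null indices they are the
    coefficients of [T f], controlled by Bessel and the isometry; null indices copy [c]. *)
Let lift_bound (c : l2 R) n : sqsum (lift_coord c) n <= sq (@l2dot R) c.
Proof.
pose N := maxn n (\max_(i < n) deg i).
have degN (i : 'I_n) : (deg i <= N)%N.
  by rewrite /N leq_max (leq_bigmax i) orbT.
pose f := \sum_(j < N) c j *: gs j.
have sqf : sq B f = \sum_(j < N) (gs_nz j)%:R * cmod (c j) ^+ 2.
  apply: complexI; rewrite -(si_sq HB) (si_suml HB) rmorph_sum; apply: eq_bigr => i _.
  rewrite (siZl HB) (si_sumr HB) (bigD1 i)//= big1 => [|j ji].
    rewrite addr0 (siZr HB) gs_ortho eqxx /= mulrA mulcJ mulrC.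
    by case: gs_nz; rewrite ?mul1r ?mul0r.
  by rewrite (siZr HB) gs_ortho_ord// mulr0.
have termE (i : 'I_n) : cmod (lift_coord c i) ^+ 2 =
    (~~ gs_nz i)%:R * cmod (c i) ^+ 2 + cmod (B (T f) (gs i)) ^+ 2.
  rewrite (lift_coordE _ (degN i)) -/(lift_sum c i N) lift_sumE -/f.
  have [nz|z] := boolP (gs_nz i); first by rewrite !mul0r !add0r.
  by rewrite gs_null// (si0r HB) cmod0 expr0n/= !mul1r !addr0.
apply: (@le_trans _ _ (sqsum c N)); last exact: sqsum_le.
rewrite /sqsum (eq_bigr _ (fun i _ => termE i)) big_split/=.
apply: (@le_trans _ _ (\sum_(i < N) (~~ gs_nz i)%:R * cmod (c i) ^+ 2 +
    \sum_(i < N) (gs_nz i)%:R * cmod (c i) ^+ 2)); last first.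
  rewrite -big_split/=; apply: ler_sum => i _; rewrite -mulrDl.
  by case: gs_nz; rewrite ?addr0 ?add0r mul1r.
apply: lerD; last by rewrite -sqf -isoT; exact: bessel.
rewrite -(subnKC (leq_maxl n _ : (n <= N)%N)) big_split_ord/= lerDl.
by apply: sumr_ge0 => i _; rewrite mulr_ge0// sqr_ge0.
Qed.

Definition lift (c : l2 R) : l2 R :=
  L2 (introT (sqsummableP (lift_coord c)) (ex_intro _ _ (lift_bound c))).

Lemma lift_linear : linear lift.
Proof.
move=> a c d; apply: l2_eq => i.
transitivity (a * lift_coord c i + lift_coord d i); last by [].
rewrite /lift_coord mulrDr addrACA mulr_sumr -big_split/= /lift_coord.
congr (_ + _).
  by transitivity ((~~ gs_nz i)%:R * (a * c i + d i)); [|ring].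
apply: eq_bigr => j _; rewrite mulrA -mulrDl; congr (_ * _).
Qed.

Lemma lift_contraction c : hn (lift c : l2_hilbert R) <= hn (c : l2_hilbert R).
Proof. by apply: ler_wsqrtr; apply: l2dot_le => n; exact: lift_bound. Qed.

Lemma lift_gs_coord f : lift (J f) = J (T f).
Proof.
apply: l2_eq => i /=; rewrite /lift_coord /= adjT.
rewrite [RHS](semi_innerC HB) degP conjC_sum [X in X + _](_ : _ = 0) ?add0r.
  apply: eq_bigr => j _; rewrite conjCM mulrC; congr (_ * _).
  - exact: semi_innerC.
  - by rewrite -(semi_innerC HB).
by have [nz|z] := boolP (gs_nz i); rewrite ?mul0r// gs_null// (si0r HB) mulr0.
Qed.

End Lift.

(** A product of two row-finite matrices: [N] bounds the row of the outer lift, [K] the rows of the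
    inner one. After exchanging the sums, Parseval for [T (gs i)] contracts the inner index and the
    isometry leaves [B (gs k) (gs i)]. *)
Lemma lift_inverse (T T' : E -> E)
    (lT : linear T) (lT' : linear T')
    (isoT : forall f h, B (T f) (T h) = B f h)
    (adjT : forall f h, B (T f) h = B f (T' h))
    (adjT' : forall f h, B (T' f) h = B f (T h))
    (nT : forall f, sq B (T f) = sq B f) (nT' : forall f, sq B (T' f) = sq B f)
    (spT : forall f, gspan f -> gspan (T f))
    (spT' : forall f, gspan f -> gspan (T' f)) c :
  lift adjT' nT' spT (lift adjT nT spT' c) = c.
Proof.
apply: l2_eq => i /=.
have [d hd] := lift_coord_ex spT'; have [d' hd'] := lift_coord_ex spT.
have [N0 hN0] : exists N, parseval (T (gs i)) N by exact: gspan_parseval (spT _ (gspan_gs i)).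
pose N := maxn (maxn N0 (d' i)) i.+1; pose K := maxn N (\max_(j < N) d j).
have N0N : (N0 <= N)%N by rewrite /N !leq_max leqnn.
have d'N : (d' i <= N)%N by rewrite /N !leq_max leqnn orbT.
have iK : (i < K)%N by rewrite /K leq_max /N leq_max leqnn orbT.
have dK (j : 'I_N) : (d j <= K)%N by rewrite /K leq_max (leq_bigmax j) orbT.
have pN h : B h (T (gs i)) = \sum_(j < N) B h (gs j) * B (gs j) (T (gs i)).
  rewrite (semi_innerC HB) (parseval_widen N0N hN0) conjC_sum; apply: eq_bigr => j _.
  by rewrite conjCM -!(semi_innerC HB) mulrC.
rewrite (hd' i _ N d'N) /=.
have -> : (~~ gs_nz i)%:R * lift_coord spT' c i = (~~ gs_nz i)%:R * c i.
  have [nz|z] := boolP (gs_nz i); first by rewrite !mul0r.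
  rewrite !mul1r (hd i c (d i) (leqnn _)) z mul1r big1 ?addr0// => j _.
  by rewrite -adjT (gs_null z) (si0r HB) mulr0.
have -> : \sum_(j < N) lift_coord spT' c j * B (gs j) (T (gs i)) =
    \sum_(k < K) c k * B (gs k) (gs i).
  transitivity (\sum_(j < N) \sum_(k < K)
      c k * (B (T (gs k)) (gs j) * B (gs j) (T (gs i)))).
    apply: eq_bigr => j _; rewrite (hd j c K (dK j)) mulrDl.
    rewrite [X in X + _](_ : _ = 0) ?add0r.
      by rewrite mulr_suml; apply: eq_bigr => k _; rewrite adjT mulrA.
    by have [nz|z] := boolP (gs_nz j); rewrite ?mul0r// gs_null// (si0l HB) mulr0.
  rewrite exchange_big/=; apply: eq_bigr => k _.
  by rewrite -mulr_sumr -pN isoT.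
rewrite (bigD1 (Ordinal iK))//= big1 => [|k ki]; last first.
  by rewrite (gs_ortho_ord (i := k) (j := Ordinal iK)) ?mulr0// eq_sym.
rewrite addr0 gs_ortho eqxx /= mulrC -mulrDr.
by case: gs_nz; rewrite /= ?addr0 ?add0r mulr1.
Qed.

(** [U] is determined by [T] only on the image of [gs_coord], which contains every vector met by
    words applied to the vacuum. *)
Lemma lift_unitary (T T' : E -> E) :
  linear T -> linear T' -> T \o T' = id -> T' \o T = id ->
  (forall f h, B (T f) (T h) = B f h) ->
  (forall k, gspan (T (g k))) -> (forall k, gspan (T' (g k))) ->
  exists U : l2_hilbert R -> l2_hilbert R,
    unitary U /\ forall f, U (gs_coord f) = gs_coord (T f).
Proof.
move=> lT lT' TT' T'T isoT gT gT'.
have k1 f : T (T' f) = f by exact: (congr1 (@^~ f) TT').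
have k2 f : T' (T f) = f by exact: (congr1 (@^~ f) T'T).
have isoT' f h : B (T' f) (T' h) = B f h by rewrite -isoT !k1.
have adjT f h : B (T f) h = B f (T' h).
  by rewrite -[in LHS](k1 h) isoT.
have adjT' f h : B (T' f) h = B f (T h).
  by rewrite -[in LHS](k2 h) isoT'.
have nT f : sq B (T f) = sq B f by rewrite /sq isoT.
have nT' f : sq B (T' f) = sq B f by rewrite /sq isoT'.
have spT := gspan_map lT gT; have spT' := gspan_map lT' gT'.
exists (lift adjT nT spT'); split; last exact: lift_gs_coord.
apply: (@contraction_unitary R (l2_hilbert R) (lift adjT nT spT') (lift adjT' nT' spT)).
- exact: lift_linear.
- exact: lift_linear.
- exact: lift_contraction.
- exact: lift_contraction.
- by apply/funext => c; exact: lift_inverse.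
- by apply/funext => c; exact: lift_inverse.
Qed.

End GramSchmidt.

(** * The boolean product model *)

Section BoundedFunctions.
Variable R : realType.

Definition bmeasp : {pred (S1 R -> R[i]^o)} := fun f => `[< bmeas f >].

Lemma bmeasp_submod : submod_closed bmeasp.
Proof.
split; first by apply/asboolP; exact: bmeas_cst.
move=> a f g /asboolP hf /asboolP hg; apply/asboolP.
by apply: bmeasD => //; exact: bmeasZ.
Qed.

HB.instance Definition _ := GRing.isSubmodClosed.Build _ _ bmeasp bmeasp_submod.

(** Bounded functions stand for the [L2] spaces: they are stable under multiplication, and functions
    equal almost everywhere differ by null vectors. *)
Record bfun : Type := BFun { bval :> S1 R -> R[i]^o ; bvalP : bval \in bmeasp }.

HB.instance Definition _ := [isSub for bval].
HB.instance Definition _ := [Choice of bfun by <:].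
HB.instance Definition _ := [SubChoice_isSubLmodule of bfun by <:].

Definition mkb (f : S1 R -> R[i]) (hf : bmeas f) : bfun := BFun (introT (asboolP _) hf).

Lemma bfunP (p : bfun) : bmeas p. Proof. exact/asboolP/bvalP. Qed.

Lemma bfun_eq (p q : bfun) : (forall x, p x = q x) -> p = q.
Proof. by move=> h; apply: val_inj; apply/funext. Qed.

Definition bcst c : bfun := mkb (bmeas_cst c).
Definition bmul (p q : bfun) : bfun := mkb (bmeasM (bfunP p) (bfunP q)).

Lemma bmulA p q r : bmul p (bmul q r) = bmul (bmul p q) r.
Proof. by apply: bfun_eq => x; exact: mulrA. Qed.

Lemma bcst0 : bcst 0 = 0.
Proof. exact: bfun_eq. Qed.

Lemma bmul_linear p : linear (bmul p).
Proof. by move=> c q r; apply: bfun_eq => x; rewrite [LHS]mulrDr [X in X + _]mulrCA. Qed.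

Lemma bcst_linear : linear bcst.
Proof. by move=> c x y; apply: bfun_eq => t. Qed.

Lemma bmeas_chi (z : int) : bmeas (fun x : S1 R => cval x ^ z).
Proof.
case: z => n; first exact: bmeas_cvalX.
have -> : (fun x : S1 R => cval x ^ Negz n) = fun x => ((cval x)^*) ^+ n.+1.
  apply/funext => x; rewrite NegzE -exprnN -exprVn; congr (_ ^+ _).
  by apply: (mulfI (cval_neq0 x)); rewrite mulfV ?cval_neq0// cvalJ.
by apply: bmeasX; apply: bmeasJ; exact: bmeas_cval.
Qed.

Definition chi z : bfun := mkb (bmeas_chi z).

Lemma chiM z w : bmul (chi z) (chi w) = chi (z + w).
Proof. by apply: bfun_eq => x; rewrite /= expfzDr// cval_neq0. Qed.

Lemma chi0 : chi 0 = bcst 1.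
Proof. by apply: bfun_eq => x; rewrite /= expr0z. Qed.

Lemma cmod_chi z x : cmod (chi z x) = 1.
Proof.
case: z => n; first by rewrite /= -exprnP cmodX cval_cmod expr1n.
by rewrite /= NegzE -exprnN cmodV cmodX cval_cmod expr1n invr1.
Qed.

Definition bexp (m : probability (S1 R) R) (p : bfun) : R[i] := cintegral m p.

Lemma bexpP m a p q : bexp m (a *: p + q) = a * bexp m p + bexp m q.
Proof.
rewrite /bexp -cintZ; last exact: bfunP.
by rewrite -cintD//; [exact/bmeasZ/bfunP|exact: bfunP].
Qed.

Lemma bexp_cst m c : bexp m (bcst c) = c.
Proof. by rewrite /bexp cint_cst mass_prob mulr1. Qed.

Lemma bexp0 m : bexp m 0 = 0.
Proof. exact: (bexp_cst m 0). Qed.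

Lemma bexp_mulc m c p : bexp m (bmul p (bcst c)) = c * bexp m p.
Proof. by rewrite /bexp -cintZ; [apply: eq_cint => x; exact: mulrC|exact: bfunP]. Qed.

(** The inner product in [L2 m] of the zero-mean parts of [p] and [q]. *)
Definition cov (m : probability (S1 R) R) (p q : bfun) : R[i] :=
  cintegral m (fun x => p x * (q x)^*) - bexp m p * (bexp m q)^*.

Lemma semi_inner_cov m : semi_inner (cov m).
Proof.
have bpq (p q : bfun) : bmeas (fun x => p x * (q x)^*).
  by apply: bmeasM; [|apply: bmeasJ]; exact: bfunP.
split=> [a p q r|p q|p]; rewrite /cov.
- rewrite bexpP (_ : (fun x => (a *: p + q) x * _) = fun x => a * (p x * (r x)^*) + q x * (r x)^*).
    rewrite cintD//; last exact: bmeasZ.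
    by rewrite cintZ//; ring.
  by apply/funext => x; rewrite mulrA -mulrDl.
- rewrite conjCB conjCM conjCK -(cintJ m (bpq q p)); congr (_ - _); last exact: mulrC.
  by apply: eq_cint => x; rewrite conjCM conjCK mulrC.
- by rewrite ReB subr_ge0 mulcJ /=; apply: cint_var; exact: bfunP.
Qed.

End BoundedFunctions.

Section BooleanModel.
Variable R : realType.
Local Notation E := (bfun R * bfun R)%type.
Local Notation prob := (probability (S1 R) R).
Implicit Types (mu nu : prob) (a b : E) (u : bfun R).

Definition tot mu nu a : R[i] := bexp mu a.1 + bexp nu a.2.

Lemma totP mu nu c a b : tot mu nu (c *: a + b) = c * tot mu nu a + tot mu nu b.
Proof. by rewrite /tot /= !bexpP mulrDr addrACA. Qed.

(* [(p, q)] stands for [p + q] in the boolean product of [L2 mu] and [L2 nu],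
   the orthogonal sum of their zero-mean parts and of the common constants. *)
Definition bform mu nu a b : R[i] :=
  cov mu a.1 b.1 + cov nu a.2 b.2 + tot mu nu a * (tot mu nu b)^*.

Lemma semi_inner_bform mu nu : semi_inner (bform mu nu).
Proof.
have h1 := semi_inner_cov mu; have h2 := semi_inner_cov nu.
split=> [c a b d|a b|a]; rewrite /bform.
- by rewrite totP /= (semi_innerP h1) (semi_innerP h2); ring.
- rewrite [RHS]conjCD [(_ + cov _ _ _)^*]conjCD -(semi_innerC h1) -(semi_innerC h2).
  by rewrite [(tot _ _ b * _)^*]conjCM conjCK [tot _ _ a * _]mulrC.
- have h3 : 0 <= Re (tot mu nu a * (tot mu nu a)^*) by rewrite mulcJ; exact: sqr_ge0.
  rewrite 2!ReD; apply: addr_ge0; last exact: h3.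
  apply: addr_ge0; [exact: (semi_inner_ge0 h1)|exact: (semi_inner_ge0 h2)].
Qed.

Definition swap a : E := (a.2, a.1).

Lemma bform_swap mu nu a b : bform mu nu a b = bform nu mu (swap a) (swap b).
Proof. by rewrite /bform /tot /= [cov nu _ _ + _]addrC ![bexp nu _ + _]addrC. Qed.

(** The component in [L2 mu]: of the second function only the mean survives, as a constant. *)
Definition lpart nu a : bfun R := a.1 + bcst (bexp nu a.2).

Lemma lpart_linear nu : linear (lpart nu).
Proof. by move=> c a b; rewrite /lpart /= bexpP bcst_linear scalerDr addrACA. Qed.

Lemma bexp_lpart mu nu a : bexp mu (lpart nu a) = tot mu nu a.
Proof. by have := bexpP mu 1 a.1 (bcst (bexp nu a.2)); rewrite scale1r mul1r bexp_cst. Qed.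

(** The constants are regrouped with the zero-mean part of [L2 mu]; in this form multiplication by a
    unimodular function is visibly isometric. *)
Lemma bformE mu nu a b : bform mu nu a b =
  cintegral mu (fun x => lpart nu a x * (lpart nu b x)^*) + cov nu a.2 b.2.
Proof.
rewrite /bform addrAC; congr (_ + _).
have := semi_inner_cov mu => si.
have e : cov mu (lpart nu a) (lpart nu b) = cov mu a.1 b.1.
  have c0 c (p : bfun R) : cov mu (bcst c) p = 0.
    rewrite /cov bexp_cst cintZ; last by apply: bmeasJ; exact: bfunP.
    by rewrite cintJ ?subrr//; exact: bfunP.
  rewrite /lpart (siDl si) !(siDr si) !c0 addr0.
  by rewrite [cov mu a.1 (bcst _)](semi_innerC si) c0 conjC0 !addr0.
by rewrite -e /cov !bexp_lpart subrK.
Qed.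

Lemma lpart0 nu p : lpart nu (p, 0) = p.
Proof. by rewrite /lpart /= bexp0 (bcst0) addr0. Qed.

(* Multiplication by [u] on [L2 mu], which contains the constants, and the
   identity on the zero-mean part of [L2 nu]. *)
Definition bop nu u a : E :=
  (bmul u (lpart nu a) - bcst (bexp nu a.2), a.2).

Lemma lpart_bop nu u a : lpart nu (bop nu u a) = bmul u (lpart nu a).
Proof. by rewrite /lpart /= subrK. Qed.

Lemma bop_comp nu u v a : bop nu u (bop nu v a) = bop nu (bmul u v) a.
Proof. by rewrite {1}/bop lpart_bop bmulA. Qed.

Lemma bop1 nu a : bop nu (bcst 1) a = a.
Proof.
case: a => p q; congr (_, _); apply: bfun_eq => x.
rewrite [LHS](_ : _ = 1 * (p x + bexp nu q) - bexp nu q)//.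
by rewrite mul1r addrK.
Qed.

Lemma bop_linear nu u : linear (bop nu u).
Proof.
move=> c a b; congr (_, _).
by rewrite lpart_linear bmul_linear bexpP bcst_linear /= scalerBr opprD addrACA.
Qed.

Lemma bop_iso mu nu u a b : (forall x, cmod (u x) = 1) ->
  bform mu nu (bop nu u a) (bop nu u b) = bform mu nu a b.
Proof.
move=> u1; rewrite !bformE !lpart_bop; congr (_ + _); apply: eq_cint => x.
rewrite /= conjCM mulrACA mulcJ u1 expr1n.
exact: mul1r.
Qed.

Definition bopr mu u a : E := swap (bop mu u (swap a)).

(** The Laurent monomials of both components, indexed by [nat] through the encoding of pairs; a
    number that encodes no pair gives 0. *)
Definition lgen k : E :=
  if unpickle k is Some (b, z) then
    if b then (chi R z, 0) else (0, chi R z)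
  else 0 : E.

Lemma gspan_chil z : gspan lgen (chi R z, 0).
Proof.
have := gspan_gen lgen (pickle (true, z : int)).
by rewrite {2}/lgen pickleK.
Qed.

Lemma gspan_chir z : gspan lgen (0, chi R z).
Proof.
have := gspan_gen lgen (pickle (false, z : int)).
by rewrite {2}/lgen pickleK.
Qed.

Lemma gspan_swap a : gspan lgen a -> gspan lgen (swap a).
Proof.
apply: gspan_map => // k; rewrite /lgen; case: unpickle => [[[] z]|].
- exact: gspan_chir.
- exact: gspan_chil.
- exact: gspan0.
Qed.

Lemma gspan_bop nu e k : gspan lgen (bop nu (chi R e) (lgen k)).
Proof.
rewrite /lgen; case: unpickle => [[[] z]|].
- have -> : bop nu (chi R e) (chi R z, 0) = (chi R (e + z), 0).
    congr (_, _); rewrite -chiM; apply: bfun_eq => x.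
    transitivity (chi R e x * (chi R z x + bexp nu 0) - bexp nu 0) => //.
    by rewrite bexp0 addr0 subr0.
  exact: gspan_chil.
- have -> : bop nu (chi R e) (0, chi R z) =
      bexp nu (chi R z) *: (chi R e, 0) + (- bexp nu (chi R z) *: (chi R 0, 0) + (0, chi R z)).
    congr (_, _); last by rewrite /= !scaler0 !add0r.
    rewrite chi0; apply: bfun_eq => x.
    set c := bexp nu _.
    transitivity (chi R e x * (0 + c) - c) => //.
    transitivity (c * chi R e x + (- c * 1 + 0)) => //.
    ring.
  by apply: gspanD; [apply: gspanZ; exact: gspan_chil|apply: gspanD; [apply: gspanZ; exact: gspan_chil|exact: gspan_chir]].
- have -> : bop nu (chi R e) 0 = 0.
    by have := bop_linear nu (chi R e) (-1) 0 0; rewrite !scaleN1r !addNr.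
  exact: gspan0.
Qed.

Lemma gspan_bopr mu e k : gspan lgen (bopr mu (chi R e) (lgen k)).
Proof.
apply: gspan_swap; apply: (gspan_map (bop_linear _ _)) => [j|]; first exact: gspan_bop.
exact/gspan_swap/gspan_gen.
Qed.

Definition vac : E := (bcst 1, 0).

Lemma tot_vac mu nu : tot mu nu vac = 1.
Proof. by rewrite /tot bexp_cst bexp0 addr0. Qed.

Lemma bform_vac mu nu a : bform mu nu a vac = tot mu nu a.
Proof.
have c1 : cov mu a.1 (bcst 1) = 0.
  have e1 : (bexp mu (bcst 1))^* = 1 by rewrite bexp_cst conjC1.
  rewrite /cov e1 mulr1; apply/eqP; rewrite subr_eq0; apply/eqP/eq_cint => x.
  by rewrite /= conjC1 mulr1.
have c2 : cov nu a.2 0 = 0 by exact: (si0r (semi_inner_cov nu)).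
by rewrite /bform /= c1 c2 !add0r tot_vac conjC1 mulr1.
Qed.

Lemma gspan_vac : gspan lgen vac.
Proof. by rewrite /vac -chi0; exact: gspan_chil. Qed.

Definition bopB nu a : E := bop nu (chi R 1) a - a.

Section Words.
Variables mu nu : prob.

Definition mom1 (m : prob) n : R[i] := cintegral m (fun x => (cval x - 1) ^+ n).

Definition opX a : E := bop nu (chi R 1) a - a.
Definition opY a : E := bopr mu (chi R 1) a - a.

Let bmeas1 n : bmeas (fun x : S1 R => (cval x - 1) ^+ n).
Proof. by apply: bmeasX; apply: bmeasB; [exact: bmeas_cval|exact: bmeas_cst]. Qed.

Let w n : bfun R := mkb (bmeas1 n).

(** The operator minus 1 kills the zero-mean part on which it acts as the identity, so its image
    lies in the first component, where it multiplies by [x - 1]. *)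
Let iter_bopB (m : prob) n a :
  iter n.+1 (bopB m) a = (bmul (w n.+1) (lpart m a), 0).
Proof.
have opXE b : bopB m b = (bmul (w 1) (lpart m b), 0).
  congr (_, _); last by rewrite /= subrr.
  rewrite /= /lpart -addrA -opprD [_ + b.1]addrC; apply: bfun_eq => x.
  transitivity (cval x ^ 1 * (b.1 x + bexp m b.2) - (b.1 x + bexp m b.2)) => //.
  transitivity ((cval x - 1) ^+ 1 * (b.1 x + bexp m b.2)) => //.
  by rewrite expr1z expr1 mulrBl mul1r.
elim: n => [|n IH]; first exact: opXE.
rewrite iterS IH opXE; congr (_, _).
rewrite lpart0 bmulA; congr (bmul _ _); apply: bfun_eq => x.
by rewrite /= -exprD.
Qed.

Let iter_opX n a : iter n.+1 opX a = (bmul (w n.+1) (lpart nu a), 0).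
Proof. exact: iter_bopB. Qed.

Let iter_opY n a : iter n.+1 opY a = (0, bmul (w n.+1) (lpart mu (swap a))).
Proof.
transitivity (swap (iter n.+1 (bopB mu) (swap a))); last by rewrite iter_bopB.
by elim: n.+1 => [|k IH]; [case: a|rewrite !iterS IH].
Qed.

Definition block_word T (X Y : T -> T) (k : nat) (n m : nat -> nat) : T -> T :=
  \big[(fun S T => S \o T)/id]_(0 <= l < k) (iter (n l) X \o iter (m l) Y).

(** Boolean independence for one block: [opY] sees a vector of [L2 mu] only through its mean, and
    [opX] sees the result only through its mean. With [m = 0] the vector is not reset to its mean,
    so it must be the vacuum. *)
Let block_step a n m : a.2 = 0 -> (0 < m)%N \/ a = vac ->
  tot mu nu (iter n opX (iter m opY a)) = mom1 mu n * mom1 nu m * tot mu nu a /\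
  ((0 < n)%N -> (iter n opX (iter m opY a)).2 = 0).
Proof.
move=> a2 hm.
have [lb tb] : lpart nu (iter m opY a) = bcst (mom1 nu m * tot mu nu a) /\
    tot mu nu (iter m opY a) = mom1 nu m * tot mu nu a.
  case: m hm => [[//|->]|m _].
    have e : mom1 nu 0 = 1 by rewrite /mom1 cint_cst mass_prob mulr1.
    by rewrite e tot_vac mulr1 /= lpart0.
  have ta : bmul (w m.+1) (lpart mu (swap a)) = bmul (w m.+1) (bcst (tot mu nu a)).
    by rewrite /lpart /tot /swap /= a2 add0r bexp0 addr0.
  have eb : bexp nu (bmul (w m.+1) (bcst (tot mu nu a))) = mom1 nu m.+1 * tot mu nu a.
    by rewrite bexp_mulc mulrC.
  by rewrite iter_opY ta /lpart /tot /= eb add0r bexp0 add0r.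
move: (iter m opY a) lb tb => b lb tb; case: n => [|n].
  by rewrite /= tb; split=> //; rewrite [mom1 mu 0]cint_cst mass_prob mulr1 mul1r.
rewrite iter_opX lb; split=> //.
by rewrite {1}/tot /= bexp0 addr0 bexp_mulc mulrC mulrA.
Qed.

Lemma tot_block_word k (n m : nat -> nat) : (0 < k)%N ->
  (forall l, (0 < l < k)%N -> (0 < n l)%N) ->
  (forall l, (l.+1 < k)%N -> (0 < m l)%N) ->
  tot mu nu (block_word opX opY k n m vac) =
    \prod_(0 <= l < k) (mom1 mu (n l) * mom1 nu (m l)).
Proof.
move=> k0 hn hm.
(* The induction also records what [block_step] asks of the next vector: a zero second component if
   the leading exponent is positive, and the vacuum for an empty word. *)
suff : [/\ tot mu nu (block_word opX opY k n m vac) =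
        \prod_(0 <= l < k) (mom1 mu (n l) * mom1 nu (m l)),
      (0 < k)%N -> (0 < n 0)%N -> (block_word opX opY k n m vac).2 = 0 &
      k = 0 -> block_word opX opY k n m vac = vac] by case.
elim: k n m {k0} hn hm => [|k IH] n m hn hm.
  by rewrite /block_word !big_geq//; split=> //; exact: tot_vac.
have [||IH1 IH2 IH3] := IH (n \o succn) (m \o succn).
- by move=> l /andP[l0 lk]; apply: hn; rewrite /= ltnS.
- by move=> l lk; apply: hm.
have e : block_word opX opY k.+1 n m vac =
    iter (n 0) opX (iter (m 0) opY (block_word opX opY k (n \o succn) (m \o succn) vac)).
  by rewrite /block_word big_ltn// big_add1.
have [||h1 h2] := @block_step (block_word opX opY k (n \o succn) (m \o succn) vac) (n 0) (m 0).
- by case: k IH2 IH3 {hm e IH1 IH} hn => [_ ->//|k] h _ hn; apply: h => //; apply: hn.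
- by case: k IH2 IH3 {hn e IH1 IH} hm => [_ h3 _|k _ _ hm]; [right; exact: h3|left; exact: hm].
split=> //; last by rewrite e.
by rewrite e h1 IH1 [RHS]big_ltn// big_add1.
Qed.

End Words.

End BooleanModel.

(** * Boolean convolution multiplies F *)

Section WordSums.

Definition letter T (X Y : T -> T) (b : bool) := if b then X else Y.

Definition wop T (X Y : T -> T) (w : seq bool) : T -> T :=
  foldr (fun b S => letter X Y b \o S) id w.

Definition word_step (b : bool) (ws : seq (seq bool)) := map (cons b) ws ++ ws.

(** The words of the expanded power [((X + 1)(Y + 1))^k], with multiplicity; [word_step] multiplies
    on the left by a letter plus 1. *)
Definition product_words k : seq (seq bool) :=
  iter k (fun ws => word_step true (word_step false ws)) [:: [::]].

Lemma product_wordsP (V : zmodType) (X Y : V -> V) :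
  (forall x y, X (x + y) = X x + X y) -> (forall x y, Y (x + y) = Y x + Y y) ->
  forall k x, iter k (fun y => X (Y y + y) + (Y y + y)) x =
    \sum_(w <- product_words k) wop X Y w x.
Proof.
move=> aX aY k x.
have add_sum (Z : V -> V) : (forall x y, Z (x + y) = Z x + Z y) ->
    forall ws, Z (\sum_(w <- ws) wop X Y w x) = \sum_(w <- ws) Z (wop X Y w x).
  move=> aZ; elim=> [|w ws IH]; last by rewrite !big_cons aZ IH.
  by rewrite !big_nil; apply: (addrI (Z 0)); rewrite -aZ !addr0.
elim: k => [|k IH]; first by rewrite /= big_seq1.
rewrite iterS IH {IH} /product_words iterS -/(product_words k).
move: (product_words k) => ws.
have step b ws' : \sum_(w <- word_step b ws') wop X Y w x =
    letter X Y b (\sum_(w <- ws') wop X Y w x) + \sum_(w <- ws') wop X Y w x.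
  rewrite /word_step big_cat big_map; congr (_ + _).
  by rewrite add_sum//; case: b.
by rewrite !step.
Qed.

Lemma block_wordS T (X Y : T -> T) k n m : block_word X Y k.+1 n m =
  (iter (n 0) X \o iter (m 0) Y) \o block_word X Y k (n \o succn) (m \o succn).
Proof. by rewrite /block_word big_ltn// big_add1. Qed.

(* Prepending [Y] to a word that starts with [X] opens a new block. *)
Lemma word_blocks (w : seq bool) : exists k (n m : nat -> nat),
  [/\ (0 < k)%N, forall l, (0 < l < k)%N -> (0 < n l)%N,
      forall l, (l.+1 < k)%N -> (0 < m l)%N &
      forall T (X Y : T -> T), wop X Y w = block_word X Y k n m].
Proof.
elim: w => [|b w [k [n [m [k0 hn hm hw]]]]].
  exists 1, (fun=> 0), (fun=> 0); split=> //; first by move=> [|[|l]].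
  by move=> T X Y; rewrite block_wordS /block_word big_geq.
case: k k0 hn hm hw => // k _ hn hm hw.
case: b.
  exists k.+1, (fun l => if l is 0 then (n 0).+1 else n l), m; split=> //.
    by case=> // l; exact: hn.
  by move=> T X Y; rewrite /= hw !block_wordS.
case n0 : (n 0) => [|n'].
  exists k.+1, n, (fun l => if l is 0 then (m 0).+1 else m l); split=> //.
    by case=> // l; exact: hm.
  by move=> T X Y; rewrite /= hw !block_wordS /= n0.
exists k.+2, (fun l => if l is l'.+1 then n l' else 0), (fun l => if l is l'.+1 then m l' else 1).
split=> //.
- by case=> // -[|l] /=; [rewrite n0|move=> h; apply: hn].
- by case=> // l; exact: hm.
- by move=> T X Y; rewrite /= hw [RHS]block_wordS.
Qed.

End WordSums.

Section Realization.
Variables (R : realType) (H : hilbertSpace R) (phi : (H -> H) -> R[i]).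
Hypothesis nphi : normal_state phi.
Implicit Types (mu nu tau : probability (S1 R) R).

Lemma state0 : phi (fun=> 0) = 0.
Proof.
have := state_linear nphi (-1) (@BH_id R H) (@BH_id R H).
by rewrite mulN1r addNr (_ : (fun x => _) = fun=> 0)//; apply/funext => x; rewrite scaleN1r addNr.
Qed.

Lemma state_sub S T : BH S -> BH T -> phi (fun x => S x - T x) = phi S - phi T.
Proof.
move=> bS bT; have := state_linear nphi (-1) bT bS.
rewrite mulN1r addrC => <-; congr phi; apply/funext => x.
by rewrite scaleN1r addrC.
Qed.

Lemma BH_0 : BH (fun _ : H => 0 : H).
Proof.
have := BH_sub (@BH_id R H) (@BH_id R H).
by congr BH; apply/funext => x; rewrite subrr.
Qed.

Lemma state_sum I (r : seq I) (F : I -> H -> H) : (forall i, BH (F i)) ->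
  phi (fun x => \sum_(i <- r) F i x) = \sum_(i <- r) phi (F i).
Proof.
move=> hF; suff [] : phi (fun x => \sum_(i <- r) F i x) = \sum_(i <- r) phi (F i) /\
  BH (fun x => \sum_(i <- r) F i x) by [].
elim: r => [|i r [IH bI]].
  rewrite big_nil (_ : (fun x => _) = fun=> 0).
    by split; [exact: state0|exact: BH_0].
  by apply/funext => x; rewrite big_nil.
have -> : (fun x => \sum_(j <- i :: r) F j x) =
    fun x => 1 *: F i x + \sum_(j <- r) F j x.
  by apply/funext => x; rewrite big_cons scale1r.
split; first by rewrite (state_linear nphi)// mul1r IH big_cons.
by apply: BH_add => //; exact: BH_scale.
Qed.

(** The extra power of [U] makes the induction go through: with [X = U - 1],
    [X^(n+1) U^k = X^n U^(k+1) - X^n U^k]. *)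
Lemma state_iter_sub1 U mu n k : BH U -> has_law phi U mu ->
  phi (fun x => iter n (fun y => U y - y) (iter k U x)) =
  cintegral mu (fun x => (cval x - 1) ^+ n * cval x ^+ k).
Proof.
move=> bU lU; have bX := BH_sub bU (@BH_id R H).
elim: n k => [|n IH] k.
  by rewrite [LHS]lU; apply: eq_cint => x; rewrite expr0 mul1r.
have bn := BH_iter n bX.
transitivity (phi (fun x => iter n (fun y => U y - y) (iter k.+1 U x) -
    iter n (fun y => U y - y) (iter k U x))).
  congr phi; apply/funext => x; rewrite -(BHB bn).
  exact: iterSr.
rewrite state_sub; [|exact: (BH_comp bn (BH_iter k.+1 bU))|exact: (BH_comp bn (BH_iter k bU))].
have bxk j l : bmeas (fun x : S1 R => (cval x - 1) ^+ j * cval x ^+ l).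
  apply: bmeasM; last exact: bmeas_cvalX.
  by apply: bmeasX; apply: bmeasB; [exact: bmeas_cval|exact: bmeas_cst].
rewrite !IH -cintB//; apply: eq_cint => x.
by rewrite [in RHS]exprSr exprS; ring.
Qed.

Lemma state_iter_sub1_mom1 U mu n : BH U -> has_law phi U mu ->
  phi (iter n (fun y => U y - y)) = mom1 mu n.
Proof.
move=> bU lU; have := state_iter_sub1 n 0 bU lU => /= ->.
by apply: eq_cint => x; rewrite expr0 mulr1.
Qed.

(** Both sides expand over the same words; each is a block word, evaluated by independence on the
    left and by [tot_block_word] in the model. *)
Lemma state_product mu nu U V : BH U -> BH V ->
  has_law phi U mu -> has_law phi V nu ->
  boolean_independent phi (fun x => U x - x) (fun x => V x - x) ->
  forall k, phi (iter k (U \o V)) =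
    tot mu nu (iter k (bop nu (chi R 1) \o bopr mu (chi R 1)) (vac R)).
Proof.
move=> bU bV lU lV ind k.
have bX := BH_sub bU (@BH_id R H); have bY := BH_sub bV (@BH_id R H).
have -> : iter k (U \o V) = fun x => \sum_(w <- product_words k)
    wop (fun x => U x - x) (fun x => V x - x) w x.
  apply/funext => x; rewrite -product_wordsP; [|exact: BHD bX|exact: BHD bY].
  by apply: eq_iter => y /=; rewrite !subrK.
have bw w : BH (wop (fun x => U x - x) (fun x => V x - x) w).
  by elim: w => [|[] w IH]; [exact: BH_id|exact: (BH_comp bX)|exact: (BH_comp bY)].
rewrite state_sum//.
have -> : iter k (bop nu (chi R 1) \o bopr mu (chi R 1)) (vac R) =
    \sum_(w <- product_words k) wop (opX nu) (opY mu) w (vac R).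
  rewrite -product_wordsP; first by apply: eq_iter => y; rewrite /opX /opY !subrK.
  - move=> x y; rewrite /opX; have := bop_linear nu (chi R 1) 1 x y.
    by rewrite !scale1r => ->; rewrite opprD addrACA.
  - move=> x y; rewrite /opY /bopr; have := bop_linear mu (chi R 1) 1 (swap x) (swap y).
    rewrite !scale1r (_ : swap x + swap y = swap (x + y))// => ->.
    by rewrite (_ : swap (_ + _) = swap (bop mu (chi R 1) (swap x)) + swap (bop mu (chi R 1) (swap y)))// opprD addrACA.
have tot0 : tot mu nu 0 = 0 by rewrite /tot !bexp0 addr0.
have totD a b : tot mu nu (a + b) = tot mu nu a + tot mu nu b.
  by have := totP mu nu 1 a b; rewrite scale1r mul1r.
rewrite (big_morph _ totD tot0); apply: eq_bigr => w _.
have [K [n [m [k0 hn hm hw]]]] := word_blocks w.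
rewrite !hw tot_block_word// [LHS]ind//; apply: eq_bigr => l _.
by rewrite !(state_iter_sub1_mom1 _ bU lU) !(state_iter_sub1_mom1 _ bV lV).
Qed.

End Realization.

Section BooleanMoments.
Variables (R : realType) (mu nu : probability (S1 R) R).
Local Notation E := (bfun R * bfun R)%type.
Local Notation HB := (semi_inner_bform mu nu).
Implicit Types (a b : E) (z : R[i]).

Definition bprod a : E := bop nu (chi R 1) (bopr mu (chi R 1) a).

Definition bmom k : R[i] := tot mu nu (iter k bprod (vac R)).

Lemma bopr_linear (m : probability (S1 R) R) u : linear (bopr m u).
Proof. by move=> c a b; rewrite /bopr (_ : swap (c *: a + b) = c *: swap a + swap b)// bop_linear. Qed.

Lemma bprod_linear : linear bprod.
Proof. by move=> c a b; rewrite /bprod bopr_linear bop_linear. Qed.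

Lemma bopr_iso (u : bfun R) a b : (forall x, cmod (u x) = 1) ->
  bform mu nu (bopr mu u a) (bopr mu u b) = bform mu nu a b.
Proof. by move=> u1; rewrite bform_swap bop_iso// -bform_swap. Qed.

Lemma bprod_iso a b : bform mu nu (bprod a) (bprod b) = bform mu nu a b.
Proof.
by rewrite /bprod bop_iso ?bopr_iso// => x; exact: cmod_chi.
Qed.

Lemma tot_bprod_bound a n : cmod (tot mu nu (iter n bprod a)) <=
  Num.sqrt (sq (bform mu nu) a) * Num.sqrt (sq (bform mu nu) (vac R)).
Proof.
rewrite -bform_vac; apply: le_trans (cauchy_schwarz_sqrt HB _ _) _.
rewrite (_ : sq _ (iter n bprod a) = sq (bform mu nu) a)//.
by elim: n => [//|n IH]; rewrite iterS /sq bprod_iso.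
Qed.

Section Series.
Variables (z : R[i]) (z1 : cmod z < 1).

Let kerb : bfun R := mkb (bmeas_ker z1).
Let G (m : probability (S1 R) R) : bfun R := (res0 m z)^-1 *: kerb.
Let F2 := Ftr nu z.
Let c := 1 - z * (Ftr mu z * F2).
(** The resolvent vector. [G m] is the kernel scaled to mean 1, so [V] acts on [G nu] alone and
    produces the mean [F2]; this completes [G mu - 1] to [F2 *: G mu] for [U]. Thus [eta - z UV eta]
    is [c] times the vacuum up to a multiple of [N], a null vector since it represents [1 - 1]. *)
Let eta : E := (F2 *: (G mu - bcst 1), G nu).
Let N : E := (bcst 1, - bcst 1).

Let bexpG (m : probability (S1 R) R) : bexp m (G m) = 1.
Proof.
have := bexpP m (res0 m z)^-1 kerb 0; rewrite addr0 bexp0 addr0 => ->.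
by rewrite mulVf// res0_neq0.
Qed.

Let bexp_chiG (m : probability (S1 R) R) : bexp m (bmul (chi R 1) (G m)) = Ftr m z.
Proof.
rewrite /bexp /Ftr mulrC -cintZ; last exact: bmeas_cval_ker.
by apply: eq_cint => x; rewrite [LHS](_ : _ = cval x ^ 1 * ((res0 m z)^-1 * ker z x))// expr1z mulrCA.
Qed.

Let one_sub_zFtr (m : probability (S1 R) R) : 1 - z * Ftr m z = (res0 m z)^-1.
Proof. by rewrite zFtr// subKr. Qed.

Let chiG (m : probability (S1 R) R) :
  z *: bmul (chi R 1) (G m) = G m - bcst (1 - z * Ftr m z).
Proof.
apply: bfun_eq => x; rewrite one_sub_zFtr.
rewrite [RHS](_ : _ = (res0 m z)^-1 * ker z x - (res0 m z)^-1)//.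
rewrite [LHS](_ : _ = z * (cval x ^ 1 * ((res0 m z)^-1 * ker z x)))//.
rewrite expr1z; transitivity ((res0 m z)^-1 * (z * (cval x * ker z x))); first by ring.
by rewrite ker_shift// mulrBr mulr1.
Qed.

Let bexp_eta1 : bexp mu eta.1 = 0.
Proof.
have := bexpP mu F2 (G mu - bcst 1) 0; rewrite !addr0 bexp0 addr0 => ->.
have := bexpP mu (-1) (bcst 1) (G mu); rewrite scaleN1r addrC => ->.
by rewrite bexpG bexp_cst mulr1 addNr mulr0.
Qed.

Let bprod_eta : z *: bprod eta = eta - c *: vac R + (1 - z * F2) *: N.
Proof.
have e1 : bopr mu (chi R 1) eta = (eta.1, bmul (chi R 1) (G nu)).
  rewrite /bopr /bop /lpart /swap [(_, _).2]/= [(_, _).1]/= bexp_eta1.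
  by rewrite bcst0 addr0 subr0.
have e2 : lpart nu (eta.1, bmul (chi R 1) (G nu)) = F2 *: G mu.
  rewrite /lpart [(_, _).2]/= [(_, _).1]/= bexp_chiG scalerBr.
  by rewrite (_ : bcst F2 = F2 *: bcst 1) ?subrK//; apply: bfun_eq => x; exact: (esym (mulr1 _)).
have bcM x : bcst x = x *: bcst 1 :> bfun R.
  by apply: bfun_eq => t; exact: (esym (mulr1 _)).
have cP p : bmul (chi R 1) (F2 *: p) = F2 *: bmul (chi R 1) p.
  have := bmul_linear (chi R 1) F2 p 0; rewrite !addr0 => ->.
  by rewrite (_ : bmul _ 0 = 0) ?addr0//; apply: bfun_eq => x; exact: mulr0.
rewrite /bprod e1 /bop e2 cP [(_, _).2]/= bexp_chiG; congr (_, _).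
- rewrite /= scalerBr scalerA mulrC -scalerA chiG /c !(bcM (_ - _)) (bcM F2) -/F2.
  rewrite !scalerBr !scalerA -!(scaleNr _ (bcst 1)) -!addrA -!scalerDl; congr (_ + _ *: _).
  by rewrite /F2; ring.
- transitivity (G nu - c *: 0 + (1 - z * F2) *: (- bcst 1)); last by [].
  by rewrite [LHS]chiG scaler0 subr0 scalerN -bcM.
Qed.

Let bprodN : bprod N = N.
Proof.
have e1 : bopr mu (chi R 1) N = N.
  rewrite /bopr /bop /swap /lpart /=; congr (_, _).
  rewrite bexp_cst addNr (_ : bmul _ 0 = 0) ?sub0r//.
  by apply: bfun_eq => x; exact: mulr0.
rewrite /bprod e1 /bop /lpart /=; congr (_, _).
have -> : bexp nu (- bcst 1) = -1.
  by rewrite (_ : - bcst 1 = bcst (-1)) ?bexp_cst//; apply: bfun_eq.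
rewrite (_ : bcst (-1) = - bcst 1); last exact: bfun_eq.
rewrite subrr opprK (_ : bmul _ 0 = 0) ?add0r//.
by apply: bfun_eq => x; exact: mulr0.
Qed.

Let iter_lin n x a b : iter n bprod (x *: a + b) = x *: iter n bprod a + iter n bprod b.
Proof. by elim: n => //= n ->; exact: bprod_linear. Qed.

Let series_step n : z * tot mu nu (iter n.+1 bprod eta) =
  tot mu nu (iter n bprod eta) - c * bmom n.
Proof.
have z0 f k : iter k bprod (f *: eta) = f *: iter k bprod eta.
  have := iter_lin k f eta 0; rewrite addr0 => ->.
  rewrite (_ : iter k bprod 0 = 0) ?addr0//.
  by have := iter_lin k (-1) 0 0; rewrite !scaleN1r !addNr.
have -> : z * tot mu nu (iter n.+1 bprod eta) = tot mu nu (iter n bprod (z *: bprod eta)).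
  rewrite iterSr.
  have := iter_lin n z (bprod eta) 0; rewrite addr0 => ->.
  rewrite (_ : iter n bprod 0 = 0); last first.
    by have := iter_lin n (-1) 0 0; rewrite !scaleN1r !addNr.
  by rewrite totP /tot !bexp0 !addr0.
rewrite bprod_eta (_ : eta - _ + _ = (- c) *: vac R + ((1 - z * F2) *: N + eta)); last first.
  by rewrite scaleNr addrA [RHS]addrC addrA.
rewrite !iter_lin !totP (_ : iter n bprod N = N); last first.
  by elim: n => //= n ->; exact: bprodN.
have -> : tot mu nu N = 0.
  rewrite /tot /= bexp_cst (_ : - bcst 1 = bcst (-1)); last exact: bfun_eq.
  by rewrite bexp_cst subrr.
by rewrite mulr0 add0r mulNr addrC.
Qed.

Let tot_eta : tot mu nu eta = 1.
Proof. by rewrite /tot bexp_eta1 bexpG add0r. Qed.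

Let c_neq0 : c != 0.
Proof.
apply: one_sub_neq0; rewrite [cmod (z * _)]cmodM [cmod (Ftr mu z * _)]cmodM.
apply: le_lt_trans z1.
rewrite -[leRHS]mulr1 ler_wpM2l ?cmod_ge0//.
exact: mulr_ile1 (cmod_ge0 _) (cmod_ge0 _) (cmod_Ftr _ z1) (cmod_Ftr _ z1).
Qed.

(** [series_step] telescopes, leaving the remainder [z^n] times a coefficient of an isometric orbit,
    which stays bounded. *)
Lemma bmom_series : clim \oo (psum bmom z) (1 - z * (Ftr mu z * Ftr nu z))^-1.
Proof.
have key n : c * psum bmom z n = 1 - z ^+ n * tot mu nu (iter n bprod eta).
  elim: n => [|n IH]; first by rewrite /psum big_ord0 mulr0 expr0 mul1r tot_eta subrr.
  by rewrite psumS mulrDr IH exprSr -mulrA series_step; ring.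
set K := Num.sqrt (sq (bform mu nu) eta) * Num.sqrt (sq (bform mu nu) (vac R)).
apply: (clim_squeeze (e := fun n => K * cmod z ^+ n / cmod c)).
  apply: nearW => n.
  have -> : psum bmom z n - (1 - z * (Ftr mu z * Ftr nu z))^-1 =
      - (z ^+ n * tot mu nu (iter n bprod eta)) / c.
    have e : psum bmom z n = (1 - z ^+ n * tot mu nu (iter n bprod eta)) / c.
      by rewrite -key mulrAC mulfV ?mul1r// c_neq0.
    by rewrite e mulrBl mul1r mulNr addrAC subrr sub0r.
  rewrite cmodM cmodN cmodV ler_wpM2r ?invr_ge0 ?cmod_ge0// cmodM cmodX mulrC.
  by rewrite ler_wpM2r ?exprn_ge0 ?cmod_ge0//; exact: tot_bprod_bound.
by apply: geo_tail_cvg0; rewrite cmod_ge0.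
Qed.

End Series.

Lemma bmom_bound k : cmod (bmom k) <=
  Num.sqrt (sq (bform mu nu) (vac R)) * Num.sqrt (sq (bform mu nu) (vac R)).
Proof. exact: tot_bprod_bound. Qed.

End BooleanMoments.

Section BooleanConvolutionFtr.
Variables (R : realType) (mu nu : probability (S1 R) R).
Local Notation E := (bfun R * bfun R)%type.
Local Notation HB := (semi_inner_bform mu nu).
Local Notation bmom := (bmom mu nu).
Local Notation bprod := (@bprod R mu nu).
Implicit Types (a b : E) (z : R[i]).

Lemma bexpB (m : probability (S1 R) R) p q : bexp m (p - q) = bexp m p - bexp m q.
Proof. by rewrite addrC -scaleN1r bexpP mulN1r addrC. Qed.

Lemma lpart_bopr_vac u : lpart nu (bopr mu u (vac R)) = bcst (bexp nu u).
Proof.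
have e1 : lpart mu (swap (vac R)) = bcst 1.
  by rewrite /lpart /swap /vac [(_, _).2]/= [(_, _).1]/= bexp_cst add0r.
have e2 : bmul u (bcst 1) = u by apply: bfun_eq => x; exact: mulr1.
rewrite /lpart /bopr /swap /bop -/(swap _) e1 e2 [(_, _).2]/= [(_, _).1]/=.
rewrite bexp_cst bexpB bexp_cst.
by apply: bfun_eq => x; rewrite [LHS](_ : _ = 1 + (bexp nu u - 1))// addrC subrK.
Qed.

Lemma tot_bop u a : tot mu nu (bop nu u a) = bexp mu (bmul u (lpart nu a)).
Proof. by rewrite -bexp_lpart lpart_bop. Qed.

Lemma bexp_chi1 (m : probability (S1 R) R) : bexp m (chi R 1) = mom m 1.
Proof. by apply: eq_cint => x; rewrite /= expr1z. Qed.

Lemma bmom1 : bmom 1 = mom mu 1 * mom nu 1.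
Proof.
by rewrite /bmom /= tot_bop lpart_bopr_vac bexp_mulc !bexp_chi1 mulrC.
Qed.

Lemma mom_boolean_conv tau : boolean_conv mu nu tau -> forall k, mom tau k = bmom k.
Proof.
move=> [H [phi [U [V [[nphi uU uV] [lU lV ind lUV]]]]]] k.
rewrite -[LHS](lUV k); exact: (state_product nphi uU.1 uV.1 lU lV ind k).
Qed.

Lemma Ftr_boolean_conv tau z : boolean_conv mu nu tau -> cmod z < 1 ->
  Ftr tau z = Ftr mu z * Ftr nu z.
Proof.
move=> /mom_boolean_conv h z1; have [->|z0] := eqVneq z 0.
  (* At 0 the series says nothing about F, whose value is the first moment. *)
  by rewrite !Ftr0 h bmom1.
have e : res0 tau z = (1 - z * (Ftr mu z * Ftr nu z))^-1.
  apply: (clim_unique (res0_ps tau z1)); rewrite (_ : mom tau = bmom); last exact/funext.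
  exact: bmom_series.
by apply: (mulfI z0); rewrite zFtr// e invrK subKr.
Qed.

Lemma bmom_eq tau : (forall z, cmod z < 1 -> z != 0 -> Ftr tau z = Ftr mu z * Ftr nu z) ->
  forall k, mom tau k = bmom k.
Proof.
move=> h k; apply/eqP; rewrite -subr_eq0; apply/eqP; move: k.
set K := Num.sqrt (sq (bform mu nu) (vac R)) * Num.sqrt (sq (bform mu nu) (vac R)).
apply: (@ps_uniq _ _ (2 * mass tau + K) 1) => [k||t t0 t1]; last first.
- have t1C : cmod (t%:C) < 1 by rewrite cmodR ger0_norm ?ltW.
  rewrite (_ : psum _ _ = fun n => psum (mom tau) t%:C n - psum bmom t%:C n); last first.
    by apply/funext => n; rewrite /psum -sumrB; apply: eq_bigr => i _; rewrite mulrBl.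
  have := climB (res0_ps tau t1C) (bmom_series mu nu t1C).
  by rewrite res0_Ftr// h// ?subrr; [apply|rewrite -cmod_eq0 cmodR normr_eq0 gt_eqF].
- exact: ltr01.
- by apply: le_trans (cmodB _ _) _; rewrite lerD ?mom_bound ?(bmom_bound mu nu).
Qed.

Lemma iter_bop (m : probability (S1 R) R) k a :
  iter k (bop m (chi R 1)) a = bop m (chi R k%:Z) a.
Proof.
elim: k => [|k IH]; first by rewrite chi0 bop1.
by rewrite iterS IH bop_comp chiM -PoszD add1n.
Qed.

Lemma iter_bopr (m : probability (S1 R) R) k a :
  iter k (bopr m (chi R 1)) a = bopr m (chi R k%:Z) a.
Proof.
rewrite /bopr -iter_bop; elim: k => [|k IH]; first by case: a.
by rewrite !iterS IH.
Qed.

(** The state is the vector state of the image of the vacuum under [J]. As [J] intertwines [U] and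
    [V] with the model operators, laws, independence and the moments of [UV] are read off in the
    model. *)
Lemma boolean_conv_Ftr tau :
  (forall z, cmod z < 1 -> z != 0 -> Ftr tau z = Ftr mu z * Ftr nu z) -> boolean_conv mu nu tau.
Proof.
move=> /bmom_eq hk.
have chi_inv (m : probability (S1 R) R) e : bop m (chi R e) \o bop m (chi R (- e)) = id.
  by apply/funext => a; rewrite /= bop_comp chiM subrr chi0 bop1.
have chi_invr (m : probability (S1 R) R) e : bopr m (chi R e) \o bopr m (chi R (- e)) = id.
  apply/funext => a; rewrite /= /bopr.
  by have /(congr1 (@^~ (swap a))) /= := chi_inv m e; rewrite /bopr => ->; case: a.
have [U [uU JU]] := @lift_unitary _ _ _ HB (@lgen R) (bop nu (chi R 1)) (bop nu (chi R (-1)))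
  (bop_linear _ _) (bop_linear _ _) (chi_inv nu 1) (chi_inv nu (-1))
  (fun a b => bop_iso mu nu a b (cmod_chi 1)) (gspan_bop nu 1) (gspan_bop nu (-1)).
have [V [uV JV]] := @lift_unitary _ _ _ HB (@lgen R) (bopr mu (chi R 1)) (bopr mu (chi R (-1)))
  (bopr_linear _ _) (bopr_linear _ _) (chi_invr mu 1) (chi_invr mu (-1))
  (fun a b => bopr_iso mu nu a b (cmod_chi 1)) (gspan_bopr mu 1) (gspan_bopr mu (-1)).
pose J a : l2_hilbert R := gs_coord HB (@lgen R) a.
have JB a b : J (a - b) = J a - J b by apply: l2_eq => i; exact: (siBl HB).
have Jtot a : hdot (l2_hilbert R) (J a) (J (vac R)) = tot mu nu a.
  rewrite -bform_vac (semi_innerC HB) -(gs_coord_dot HB a (gspan_vac R)).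
  exact: l2dotC.
pose phi := @vstate R (l2_hilbert R) (J (vac R)).
have phiE S S0 : (forall a, S (J a) = J (S0 a)) -> phi S = tot mu nu (S0 (vac R)).
  by move=> h; rewrite /phi /vstate h Jtot.
have iterJ S S0 n : (forall a, S (J a) = J (S0 a)) ->
    forall a, iter n S (J a) = J (iter n S0 a).
  by move=> h a; elim: n => //= n ->.
have JX a : U (J a) - J a = J (opX nu a) by rewrite JB /J JU.
have JY a : V (J a) - J a = J (opY mu a) by rewrite JB /J JV.
have wordJ k n m a :
    block_word (fun x => U x - x) (fun x => V x - x) k n m (J a) =
    J (block_word (opX nu) (opY mu) k n m a).
  elim: k n m => [|k IH] n m; first by rewrite /block_word !big_geq.
  rewrite !block_wordS /= IH.
  by rewrite (iterJ _ (opY mu))// (iterJ _ (opX nu)).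
have totX n : tot mu nu (iter n (opX nu) (vac R)) = mom1 mu n.
  have := @tot_block_word R mu nu 1 (fun=> n) (fun=> 0%N) isT.
  rewrite block_wordS /block_word [\big[_/_]_(0 <= _ < 0) _]big_geq// big_nat1 /=.
  rewrite [mom1 nu 0](_ : _ = 1); last by rewrite /mom1 cint_cst mass_prob mulr1.
  by rewrite mulr1; apply=> //; case=> [|[|l]].
have totY n : tot mu nu (iter n (opY mu) (vac R)) = mom1 nu n.
  have := @tot_block_word R mu nu 1 (fun=> 0%N) (fun=> n) isT.
  rewrite block_wordS /block_word [\big[_/_]_(0 <= _ < 0) _]big_geq// big_nat1 /=.
  rewrite [mom1 mu 0](_ : _ = 1); last by rewrite /mom1 cint_cst mass_prob mulr1.
  by rewrite mul1r; apply=> //; case=> [|[|l]].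
exists (l2_hilbert R), phi, U, V; split; first split=> //.
  by apply: normal_vstate; rewrite Jtot tot_vac.
split.
- move=> k; rewrite (phiE _ (iter k (bop nu (chi R 1)))); last first.
    by apply: iterJ => a; exact: JU.
  rewrite iter_bop tot_bop /lpart bexp0 bcst0 addr0; apply: eq_cint => x.
  by rewrite [LHS](_ : _ = cval x ^ k%:Z * 1)// mulr1.
- move=> k; rewrite (phiE _ (iter k (bopr mu (chi R 1)))); last first.
    by apply: iterJ => a; exact: JV.
  by rewrite iter_bopr -bexp_lpart lpart_bopr_vac bexp_cst.
- move=> k n m k0 hn hm.
  rewrite (phiE _ (block_word (opX nu) (opY mu) k n m)); last exact: wordJ.
  rewrite tot_block_word//; apply: eq_bigr => l _; rewrite -totX -totY; congr (_ * _).
    by rewrite (phiE _ (iter (n l) (opX nu)))//; exact: iterJ.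
  by rewrite (phiE _ (iter (m l) (opY mu)))//; exact: iterJ.
- move=> k; rewrite (phiE _ (iter k bprod)); first exact/esym/hk.
  by apply: iterJ => a; rewrite /= /J JV JU.
Qed.

End BooleanConvolutionFtr.

(** * Infinite divisibility *)

Section Haar.
Variable R : realType.

Lemma haar_integral (h : S1 R -> R) (f F : R -> R) :
  measurable_fun setT h -> (forall x, 0 <= h x) -> (forall t, h (cis t) = f t) ->
  continuous f -> (forall t : R, derivable F t 1 /\ 'D_1 F t = f t) ->
  \int[haar R]_x h x = (2 * pi)^-1 * (F (2 * pi) - F 0).
Proof.
move=> mh h0 hf cf dF; rewrite /Rintegral.
have mhE : measurable_fun setT (EFin \o h) by exact/measurable_EFinP.
rewrite (@ge0_integral_distribution _ _ _ _ _ _ _ (EFin \o h))//.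
have -> : ((EFin \o h) \o ((@cis R : measurableTypeR R -> S1 R) : {mfun measurableTypeR R >-> S1 R})) =
    EFin \o f by apply/funext => t /=; rewrite hf.
rewrite integral_uniform; last first.
- by move=> t /=; rewrite lee_fin -hf.
- by apply/measurable_EFinP; exact: continuous_measurable_fun.
have pi20 : 0 < 2 * pi :> R by rewrite mulr_gt0// pi_gt0.
have cF t : {for t, continuous F}.
  by apply: differentiable_continuous; apply/derivable1_diffP; exact: (dF t).1.
rewrite (@continuous_FTC2 _ f F)//.
- by rewrite subr0 -EFinB -EFinM.
- exact: continuous_subspaceT.
- split; first by move=> t _; exact: (dF t).1.
  + exact/cvg_at_right_filter/cF.
  + exact/cvg_at_left_filter/cF.
- by move=> t _; rewrite derive1E; exact: (dF t).2.
Qed.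

Lemma is_derive_comp_scale (g dg : R -> R) (n t : R) :
  (forall x : R, is_derive x 1 g (dg x)) ->
  is_derive t 1 (fun x => g (n * x)) (dg (n * t) * n).
Proof.
move=> h; have e : is_derive t 1 (fun x : R => n * x) n.
  have := @is_deriveZ R R R id n t 1 1 _; rewrite /GRing.scale/= mulr1.
  by apply; exact: is_derive_id.
exact: (@is_derive1_comp R g (fun x => n * x)).
Qed.

Lemma cisC2pi n : cisC (n%:R * (2 * pi)) = 1 :> R[i].
Proof.
by rewrite -cisCX /cisC mulrC mulr_natr cos2pi sin2pi; exact: expr1n.
Qed.

Lemma mom_haar n : (0 < n)%N -> mom (haar R) n = 0.
Proof.
move=> n0; have nz : (n%:R : R) != 0 by rewrite pnatr_eq0 -lt0n.
have [mr mi _] := bmeas_cvalX R n.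
have pi20 : 0 < 2 * pi :> R by rewrite mulr_gt0// pi_gt0.
have [c2 s2] : cos (n%:R * (2 * pi)) = 1 :> R /\ sin (n%:R * (2 * pi)) = 0 :> R.
  by split; [exact: (congr1 (@complex.Re R) (cisC2pi n))|
             exact: (congr1 (@complex.Im R) (cisC2pi n))].
have le1 (x : S1 R) : `|Re (cval x ^+ n)| <= 1 /\ `|Im (cval x ^+ n)| <= 1.
  have h : cmod (cval x ^+ n) = 1 by rewrite cmodX cval_cmod expr1n.
  by split; rewrite -h; [exact: Re_cmod|exact: Im_cmod].
(* Adding 1 makes the integrand nonnegative, as [haar_integral] requires. *)
have split1 (h : S1 R -> R) : measurable_fun setT h -> (forall x, `|h x| <= 1) ->
    \int[haar R]_x (1 + h x) = 1 -> \int[haar R]_x h x = 0.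
  move=> mh h1; rewrite RintegralD//; last 2 first.
  - exact: finite_measure_integrable_cst.
  - exact: (@integrable_bounded R (haar R) _ 1).
  rewrite Rintegral_cst// mul1r -/(mass (haar R)) mass_prob => /eqP.
  by rewrite -[X in _ == X]addr0 (inj_eq (addrI _)) => /eqP.
apply: complex_eq; rewrite /mom cintE /=; apply: split1 => //.
- by move=> x; have [] := le1 x.
- rewrite (@haar_integral _ (fun t => 1 + cos (n%:R * t)) (fun t => t + sin (n%:R * t) / n%:R)).
  + by rewrite mulr0 sin0 s2 mul0r !addr0 subr0 mulVf// gt_eqF.
  + exact: measurable_funD.
  + by move=> x; have [+ _] := le1 x; rewrite ler_norml => /andP[h _]; lra.
  + by move=> t; rewrite cval_cis cisCX.
  + move=> t; apply: cvgD; first exact: cvg_cst.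
    by apply: continuous_comp; [exact: mulrl_continuous|exact: continuous_cos].
  + move=> t; suff h : is_derive t 1 (fun t : R => t + sin (n%:R * t) / n%:R) (1 + cos (n%:R * t)) by split; [exact: ex_derive|exact: derive_val].
    apply: is_deriveD.
    have h := is_derive_comp_scale n%:R t (@is_derive_sin R).
    have := @is_deriveZ R R R _ (n%:R)^-1 t 1 _ h.
    rewrite /GRing.scale/= mulrCA mulVf// mulr1.
    rewrite (_ : _ \*: _ = (fun x => sin (n%:R * x) / n%:R))//.
    by apply/funext => x; exact: mulrC.
- by move=> x; have [] := le1 x.
- rewrite (@haar_integral _ (fun t => 1 + sin (n%:R * t)) (fun t => t - cos (n%:R * t) / n%:R)).
  + by rewrite mulr0 cos0 c2 mul1r sub0r opprK subrK mulVf// gt_eqF.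
  + exact: measurable_funD.
  + by move=> x; have [_ +] := le1 x; rewrite ler_norml => /andP[h _]; lra.
  + by move=> t; rewrite cval_cis cisCX.
  + move=> t; apply: cvgD; first exact: cvg_cst.
    by apply: continuous_comp; [exact: mulrl_continuous|exact: continuous_sin].
  + move=> t; suff h : is_derive t 1 (fun t : R => t - cos (n%:R * t) / n%:R) (1 + sin (n%:R * t)) by split; [exact: ex_derive|exact: derive_val].
    apply: is_deriveD.
    have h := is_derive_comp_scale n%:R t (@is_derive_cos R).
    have := @is_deriveZ R R R _ (- (n%:R)^-1) t 1 _ h.
    rewrite /GRing.scale/= mulNr mulNr mulrN opprK mulrCA mulVf// mulr1.
    rewrite (_ : _ \*: _ = (fun x => - (cos (n%:R * x) / n%:R)))//.
    by apply/funext => x; rewrite /= /GRing.scale/= mulNr mulrC.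
Qed.

End Haar.

(** * Characteristic exponents and compactness of Herglotz functions *)

Section Exponents.
Variable R : realType.
Implicit Types (rho : {finite_measure set (S1 R) -> \bar R}) (z : R[i]) (h : R[i] -> R[i]).
Implicit Types (mu nu tau : probability (S1 R) R).

Lemma disk_approx_conj h : disk_approx h -> disk_approx (fun z => (h z^*)^*).
Proof.
move=> hh r e r01 e0; have [p hp] := hh r e r01 e0.
exists (map_poly Num.conj p) => z zr.
have -> : (map_poly Num.conj p).[z] = (p.[z^*])^* by rewrite -{1}[z]conjCK horner_map.
by rewrite -conjCB cmodJ; apply: hp; rewrite cmodJ.
Qed.

Lemma res0_0 rho : res0 rho 0 = (mass rho)%:C.
Proof.
by have := res1_res0 rho (z := 0); rewrite cmod0 mul0r => /(_ ltr01)/esym/eqP; rewrite subr_eq0 => /eqP.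
Qed.

Definition herglotz_fun rho z : R[i] := 2 * res0 rho z - (mass rho)%:C.

Lemma Re_herglotz_fun rho z : cmod z < 1 -> 0 <= Re (herglotz_fun rho z).
Proof.
move=> /(Re_res0_ge rho) h; rewrite /herglotz_fun ReB mulr_natl mulr2n ReD [Re (mass rho)%:C]/=; lra.
Qed.

(** For x on the circle with conjugate y, [(x + z) / (x - z) = (1 + y z) / (1 - y z)], the conjugate
    of [2 ker - 1] taken at the conjugate of z. *)
Lemma char_exponentE b rho z : cmod z < 1 ->
  char_exponent b rho z = 'i%C * b%:C - (herglotz_fun rho z^*)^*.
Proof.
move=> z1; congr (_ - _); have zc1 : cmod z^* < 1 by rewrite cmodJ.
have bk := bmeas_ker zc1.
have -> : herglotz_fun rho z^* = cintegral rho (fun x => 2 * ker z^* x - 1).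
  rewrite cintB; [|exact: bmeasZ|exact: bmeas_cst].
  by rewrite cintZ// cint_cst mul1r.
rewrite -cintJ; last by apply: bmeasB; [exact: bmeasZ|exact: bmeas_cst].
apply: eq_cint => x; have x0 := cval_neq0 x; have xy := cvalJ x.
have k0 := ker_neq0 x zc1.
have k0' : 1 - (cval x)^* * z != 0.
  by have := k0; rewrite -conjC_eq0 conjCB conjC1 conjCM conjCK.
rewrite /ker conjCB conjC1 conjCM fmorphV/= conjCB conjCM conjCK conjC1 conjC_nat.
move: (cval x) ((cval x)^*) x0 xy k0' => x' y x0 xy k0'.
have -> : x' - z = x' * (1 - y * z) by rewrite mulrBr mulr1 mulrA xy mul1r.
have -> : x' + z = x' * (1 + y * z) by rewrite mulrDr mulr1 mulrA xy mul1r.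
by field; rewrite x0 k0'.
Qed.

Lemma herglotz_char h : disk_approx h -> (forall z, cmod z < 1 -> 0 <= Re (h z)) ->
  exists rho, forall b z, cmod z < 1 ->
    char_exponent b rho z = 'i%C * b%:C - (h z - 'i%C * (Im (h 0))%:C).
Proof.
move=> hh hre; pose c : R[i] := 'i%C * (Im (h 0))%:C.
have [rho hrho] : exists rho, forall z, cmod z < 1 ->
    ((h z^* - c)^*) = 2 * res0 rho z - (mass rho)%:C.
  apply: herglotz.
  - apply: (@disk_approx_conj (fun z => h z - c)); apply: disk_approxB => //; exact: disk_approx_cst.
  - move=> z z1; rewrite ReJ ReB /c /= !mul0r mul1r subr0 subr0 hre// cmodJ//.
  - by rewrite ImJ conjC0 ImB /c /= mul0r mul1r add0r subrr oppr0.
exists rho => b z z1; rewrite char_exponentE//; congr (_ - _).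
by rewrite /herglotz_fun -hrho ?cmodJ// !conjCK.
Qed.

(** The coefficients are moments of the Herglotz measure, whose mass is [Re (h 0)], so their bound
    depends on [h 0] alone. The 6 is 4 from twice a moment plus 2 from the correction of the
    constant term. *)
Lemma herglotz_ps h : disk_approx h -> (forall z, cmod z < 1 -> 0 <= Re (h z)) ->
  exists a : nat -> R[i], (forall k, cmod (a k) <= 6 * cmod (h 0)) /\
    forall z, cmod z < 1 -> clim \oo (psum a z) (h z).
Proof.
move=> hh hre; pose c : R[i] := 'i%C * (Im (h 0))%:C.
have [rho hrho] : exists rho, forall z, cmod z < 1 ->
    h z - c = 2 * res0 rho z - (mass rho)%:C.
  apply: herglotz.
  - apply: disk_approxB => //; exact: disk_approx_cst.
  - by move=> z z1; rewrite ReB /c /= !mul0r mul1r subr0 subr0 hre.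
  - by rewrite ImB /c /= mul0r mul1r add0r subrr.
have mE : mass rho = Re (h 0).
  have := hrho 0; rewrite cmod0 => /(_ ltr01)/(congr1 (@complex.Re R)).
  by rewrite res0_0 !ReB ReM /c /= !mul0r mul1r !subr0 => ->; ring.
have mle : mass rho <= cmod (h 0) by rewrite mE; exact: Re_le_cmod.
have m0 := mass_ge0 rho.
exists (fun k => 2 * mom rho k + (k == 0%N)%:R * (c - (mass rho)%:C)); split.
  move=> k; apply: le_trans (cmodD _ _) _; rewrite cmodM cmod_nat.
  have h1 := mom_bound rho k.
  have h2 : cmod ((k == 0%N)%:R * (c - (mass rho)%:C)) <= 2 * cmod (h 0).
    rewrite cmodM cmod_nat; apply: (@le_trans _ _ (cmod (c - (mass rho)%:C))).
      by case: (k == 0%N); rewrite ?mul1r ?mul0r ?cmod_ge0.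
    apply: le_trans (cmodB _ _) _; rewrite /c cmodM !cmodR.
    rewrite (ger0_norm m0) (_ : cmod 'i%C = 1); last by rewrite /cmod /= expr0n/= expr1n add0r sqrtr1.
    by have := Im_cmod (h 0); lra.
  lra.
move=> z z1; have <- : 2 * res0 rho z - ((mass rho)%:C - c) = h z.
  by rewrite opprB addrA addrAC -hrho// subrK.
apply: clim_near_eq (climB (climM (clim_cst 2) (res0_ps rho z1)) (clim_cst ((mass rho)%:C - c))).
exists 1%N => // n /= n0.
rewrite /psum mulr_sumr; under [RHS]eq_bigr do rewrite mulrDl.
rewrite big_split/=; congr (_ + _); first by apply: eq_bigr => i _; rewrite mulrA.
case: n n0 => // n _; rewrite big_ord_recl big1 => [|i _]; last by rewrite !mul0r.
by rewrite expr0 mulr1 mul1r addr0 opprB.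
Qed.

Section UltraLimit.
Variables (U : set_system nat) (UF : UltraFilter U) (Uoo : \oo `<=` U).

Lemma clim_norm_le (T : Type) (F : set_system T) (FF : ProperFilter F) (u : T -> R[i]) l :
  (forall e : R, 0 < e -> \forall t \near F, cmod (u t - l) <= e) -> clim F u l.
Proof.
move=> hu; apply/climP/cvgrPdist_lt => e e0.
have e20 : 0 < e / 2 by rewrite divr_gt0.
apply: filterS (hu _ e20) => t ht; rewrite sub0r normrN ger0_norm ?cmod_ge0//.
by apply: le_lt_trans ht _; lra.
Qed.

(** A Montel argument: the coefficients have limits along [U], and their common bound makes the
    tails uniformly small. *)
Lemma herglotz_ultralimit (hn : nat -> R[i] -> R[i]) (M : R) :
  (forall n, disk_approx (hn n)) ->
  (forall n z, cmod z < 1 -> 0 <= Re (hn n z)) ->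
  (forall n, cmod (hn n 0) <= M) ->
  exists h, disk_approx h /\ forall z, cmod z < 1 -> clim U (hn^~ z) (h z).
Proof.
move=> dh reh h0.
have [a ha] := choice (fun n => herglotz_ps (dh n) (reh n)).
have aM n k : cmod (a n k) <= 6 * M.
  by have [h1 _] := ha n; apply: le_trans (h1 k) _; rewrite ler_wpM2l.
have [b hb] := choice (fun k => ulimC_ex UF (u := fun n => a n k) (M := 6 * M) (aM^~ k)).
have bM k : cmod (b k) <= 6 * M.
  by apply: (clim_le (hb k)); apply: nearW => n; exact: aM.
have hps z : exists l, cmod z < 1 -> clim \oo (psum b z) l.
  have [z1|z1] := boolP (cmod z < 1); last by exists 0.
  by have [l [hl _]] := ps_cvg bM z1; exists l.
have [h hh] := choice hps.
exists h; split; first exact: (disk_approx_ps bM hh).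
move=> z z1; apply: clim_norm_le => e e0.
have z01 : 0 <= cmod z < 1 by rewrite cmod_ge0.
have e40 : 0 < e / 4 by rewrite divr_gt0.
have tail := @geo_tail_cvg0 R (6 * M) (cmod z) (1 - cmod z) z01.
have [N _ hN] := cvgr_lt _ tail _ e40.
have {}hN := hN N (leqnn N).
have hfin : clim U (fun n => psum (a n) z N) (psum b z N).
  by apply: clim_sum => i; apply: climM; [exact: hb|exact: clim_cst].
move/climP : hfin => hfin; apply: filterS (cvgr_lt _ hfin _ e40) => n hn'.
have t1 := ps_lim_dist (aM n) z1 ((ha n).2 z z1) N.
have t2 := ps_lim_dist bM z1 (hh z z1) N.
have -> : hn n z - h z = - (psum (a n) z N - hn n z) +
  ((psum (a n) z N - psum b z N) + (psum b z N - h z)) by ring.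
apply: le_trans (cmodD _ _) _; rewrite cmodN.
have := cmodD (psum (a n) z N - psum b z N) (psum b z N - h z).
move: hN hn' t1 t2 => /=; lra.
Qed.

Lemma clim_cexp (T : Type) (F : set_system T) (FF : ProperFilter F) (u : T -> R[i]) l :
  clim F u l -> clim F (fun t => cexp (u t)) (cexp l).
Proof.
move=> [hr hi]; apply: climM.
  by apply: climR; apply: (cvg_comp _ _ hr); exact: continuous_expR.
by split => /=; apply: (cvg_comp _ _ hi); [exact: continuous_cos|exact: continuous_sin].
Qed.

End UltraLimit.

End Exponents.

Section BooleanPowers.
Variable R : realType.
Implicit Types (rho : {finite_measure set (S1 R) -> \bar R}) (z : R[i]) (h : R[i] -> R[i]).
Implicit Types (mu nu tau : probability (S1 R) R).

Lemma eq_meas_cint (m1 m2 : {finite_measure set (S1 R) -> \bar R}) f :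
  eq_meas m1 m2 -> cintegral m1 f = cintegral m2 f.
Proof.
move=> e; rewrite !cintE /Rintegral; apply: complex_eq; rewrite /=; congr fine;
  by apply: eq_measure_integral => A mA _; exact: e.
Qed.

Lemma Ftr_boolean_power nu n tau z : boolean_power nu n tau -> cmod z < 1 ->
  Ftr tau z = Ftr nu z ^+ n.
Proof.
move=> h z1; elim: h => [tau' e|m sigma tau' _ IH c].
  by rewrite expr1 /Ftr /res1 /res0; congr (_ / _); exact: eq_meas_cint.
by rewrite (Ftr_boolean_conv c z1) IH exprSr.
Qed.

Lemma Ftr_eq0_haar mu (d : R) : 0 < d <= 1 ->
  (forall z, cmod z < d -> Ftr mu z = 0) -> eq_meas mu (haar R).
Proof.
move=> /andP[d0 d1] hF; apply: mom_determines_measure; apply: (mom_eq d0) => z zd _.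
have z1 : cmod z < 1 by exact: lt_le_trans d1.
rewrite res0_Ftr// hF// mulr0 subr0 invr1; apply: (clim_unique _ (res0_ps _ z1)).
apply: clim_near_eq (clim_cst 1); exists 1%N => // -[//|n] _.
rewrite /psum big_ord_recl big1 => [|i _]; last by rewrite mom_haar ?mul0r.
by rewrite mom0 mass_prob expr0 mulr1 addr0.
Qed.

(** A Schwarz-type estimate from Herglotz: [1 - F = 2 res0 - 1] for a measure of mass 1, so
    [F = - 2 z res1]. There [|res1| <= 4] by the crude integral bound, and [2 * 4 / 16 = 1/2]. *)
Lemma Ftr_small nu z : Ftr nu 0 = 0 -> cmod z < 1 / 16 -> cmod (Ftr nu z) <= 1 / 2.
Proof.
move=> F0 zs; have z1 : cmod z < 1 by lra.
have [rho hrho] : exists rho, forall z, cmod z < 1 ->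
    1 - Ftr nu z = 2 * res0 rho z - (mass rho)%:C.
  apply: herglotz.
  - apply: disk_approxB; [exact: disk_approx_cst|exact: disk_approx_Ftr].
  - move=> w w1; rewrite ReB subr_ge0; apply: le_trans (Re_le_cmod _) _; exact: cmod_Ftr.
  - by rewrite F0 subr0.
have m1 : mass rho = 1.
  have := hrho 0; rewrite cmod0 => /(_ ltr01); rewrite F0 subr0 res0_0.
  move=> /(congr1 (@complex.Re R)); rewrite mulr_natl mulr2n addrK /=.
  by move=> <-.
have -> : Ftr nu z = - (2 * (z * res1 rho z)).
  by rewrite res1_res0// m1 -[LHS]opprK -[- Ftr nu z](addKr 1) hrho// m1; ring.
rewrite cmodN !cmodM cmod_nat.
have : cmod (res1 rho z) <= 2 * (1 - cmod z)^-1 * mass rho.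
  apply: cint_bound; first exact: bmeas_cval_ker.
  by move=> x; rewrite cmodM cval_cmod mul1r; exact: cmod_ker.
have : (1 - cmod z)^-1 <= 2 by rewrite -[leRHS]invrK lef_pV2 ?posrE; lra.
rewrite m1 => h1 h2; have hr : cmod (res1 rho z) <= 4 by lra.
have := ler_pM (cmod_ge0 z) (cmod_ge0 (res1 rho z)) (ltW zs) hr; lra.
Qed.

Lemma Ftr0_neq0 mu (nu : nat -> probability (S1 R) R) : ~ eq_meas mu (haar R) ->
  (forall n z, cmod z < 1 -> Ftr mu z = Ftr (nu n) z ^+ n.+1) -> Ftr mu 0 != 0.
Proof.
move=> muN hnu; apply/eqP => F0; apply: muN; apply: (@Ftr_eq0_haar _ (1 / 16)) => [|z zs].
  by apply/andP; split; lra.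
have z1 : cmod z < 1 by lra.
have small n : cmod (Ftr (nu n) z) <= 1 / 2.
  apply: Ftr_small => //; have := hnu n 0; rewrite cmod0 F0 => /(_ ltr01)/esym/eqP.
  by rewrite expf_eq0 /= => /eqP.
apply/eqP; rewrite -cmod_eq0; apply/eqP/le_anti; rewrite cmod_ge0 andbT.
apply/ler_addgt0Pl => e e0; rewrite addr0.
have h01 : 0 <= (1 / 2 : R) < 1 by apply/andP; split; lra.
have [n hn] := ex_expr_lt h01 e0; apply: le_trans hn.
rewrite (hnu n)// cmodX; apply: (@le_trans _ _ ((1 / 2) ^+ n.+1)).
  by rewrite ler_pXn2r ?nnegrE ?cmod_ge0//.
by rewrite exprSr ler_piMr ?exprn_ge0//; lra.
Qed.

Lemma cexp_i (t : R) : cexp ('i%C * t%:C) = cisC t.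
Proof.
have r0 : Re ('i%C * t%:C) = 0 by rewrite ReM /=; ring.
have i0 : Im ('i%C * t%:C) = t by rewrite ImM /=; ring.
by rewrite /cexp r0 i0 expR0 (_ : 1%:C = 1 :> R[i])// mul1r.
Qed.

Lemma polar_form (c : R[i]) : c != 0 ->
  exists2 b : R, 0 <= b < 2 * pi & c = cexp ((ln (cmod c))%:C + 'i%C * b%:C).
Proof.
move=> c0; have cp : 0 < cmod c by rewrite cmod_gt0.
pose x := Re c / cmod c; pose y := Im c / cmod c.
have xy : x ^+ 2 + y ^+ 2 = 1.
  rewrite /x /y !exprMn -mulrDl -cmod_sqr exprVn mulfV// sqrf_eq0 gt_eqF//.
have x1 : -1 <= x <= 1.
  move: (x) (y) xy => x' y' xy'; have y2 := sqr_ge0 y'.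
  have x2 : x' ^+ 2 <= 1 by lra.
  by rewrite -ler_norml -(@expr_le1 _ 2)// real_normK ?num_real.
have [b b2pi [cb sb]] : exists2 b : R, 0 <= b < 2 * pi & cos b = x /\ sin b = y.
  have pi0 := pi_gt0 R; have [/andP[a0 api] ca] := acos_def x1.
  have sa : sin (acos x) = `|y|.
    by rewrite sin_acos// (_ : 1 - x ^+ 2 = y ^+ 2) ?sqrtr_sqr//; lra.
  have [y0|y0] := leP 0 y.
    exists (acos x); first by apply/andP; split; lra.
    by rewrite sa ger0_norm.
  have an0 : acos x != 0.
    by apply: contraTneq y0 => e; have := sa; rewrite e sin0 => /esym/eqP; rewrite normr_eq0 => /eqP ->; rewrite ltxx.
  have ap : 0 < acos x by rewrite lt_def an0.
  exists (2 * pi - acos x); first by apply/andP; split; lra.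
  rewrite mulr_natl addrC cosD2pi sinD2pi cosN sinN sa ltr0_norm// opprK; split=> //.
exists b => //; rewrite cexpD.
have -> : cexp ((ln (cmod c))%:C) = (cmod c)%:C.
  by rewrite /cexp /= cos0 sin0 lnK ?posrE// (_ : 1 +i* 0 = 1 :> R[i])// mulr1.
rewrite cexp_i /cisC cb sb.
by apply: complex_eq; rewrite ?ReM ?ImM /= mul0r ?subr0 ?addr0 /x /y mulrC divfK// gt_eqF.
Qed.

End BooleanPowers.

(** * From infinite divisibility to a characteristic pair *)

Section Forward.
Variable R : realType.
Implicit Types (rho : {finite_measure set (S1 R) -> \bar R}) (z : R[i]) (h : R[i] -> R[i]).
Implicit Types (mu nu tau : probability (S1 R) R).

Section Roots.
Variables (L : R[i]) (ReL : Re L <= 0).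

Let N n : R[i] := n.+1%:R.
Let cmod_rootN n : cmod (N n) = n.+1%:R. Proof. exact: cmod_nat. Qed.
Let N0 n : N n != 0. Proof. by rewrite -cmod_eq0 cmod_rootN pnatr_eq0. Qed.

Lemma cexp_root n : cexp (L / N n) ^+ n.+1 = cexp L.
Proof. by rewrite -cexpMn -mulr_natr divfK. Qed.

Lemma cmod_cexp_root n : cmod (cexp (L / N n)) <= 1.
Proof.
have h : cmod (cexp (L / N n)) ^+ n.+1 <= 1.
  by rewrite -cmodX cexp_root cmod_cexp -expR0 ler_expR.
by rewrite -(@expr_le1 _ n.+1)// cmod_ge0.
Qed.

Let near_root n : 2 * cmod L <= n.+1%:R ->
  cmod (N n * (1 - cexp (L / N n)) + L) <= 8 * cmod L ^+ 2 / n.+1%:R.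
Proof.
move=> Ln; have n0 : 0 < n.+1%:R :> R by rewrite ltr0n.
have cv : cmod (L / N n) = cmod L / n.+1%:R by rewrite cmodM cmodV cmod_rootN.
have v2 : cmod (L / N n) <= 1 / 2 by rewrite cv ler_pdivrMr//; lra.
have -> : N n * (1 - cexp (L / N n)) + L =
    - (N n * (cexp (L / N n) - 1 - L / N n)).
  have NL : N n * (L / N n) = L by rewrite mulrC divfK.
  by rewrite !mulrBr NL; ring.
rewrite cmodN cmodM cmod_rootN.
apply: (@le_trans _ _ (n.+1%:R * (8 * (cmod L / n.+1%:R) ^+ 2))).
  by rewrite ler_wpM2l// -cv cexp_sub_le.
rewrite le_eqVlt; apply/orP; left; apply/eqP; field.
by rewrite gt_eqF.
Qed.

(** If [n + 1 >= 2 |L|] the second-order estimate gives [4 |L| + |L|]; otherwise both terms of the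
    difference have modulus at most 1, and [2 (n + 1) <= 4 |L|]. *)
Lemma cexp_root_bound n : cmod (N n * (1 - cexp (L / N n))) <= 5 * cmod L.
Proof.
have n0 : 0 < n.+1%:R :> R by rewrite ltr0n.
have [Ln|/ltW Ln] := leP (2 * cmod L) n.+1%:R.
  have h := near_root Ln.
  have h1 : 8 * cmod L ^+ 2 / n.+1%:R <= 4 * cmod L.
    by rewrite ler_pdivrMr//; have := cmod_ge0 L; nra.
  have h2 := cmodB (N n * (1 - cexp (L / N n)) + L) L; rewrite addrK in h2.
  apply: le_trans h2 _; rewrite (_ : 5 * cmod L = 4 * cmod L + cmod L); last by ring.
  by rewrite lerD2r (le_trans h).
rewrite cmodM cmod_rootN; have := cmod_cexp_root n.
have := cmodB 1 (cexp (L / N n)); rewrite cmod1; have := cmod_ge0 (1 - cexp (L / N n)).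
by have := cmod_ge0 L; nra.
Qed.

Lemma cexp_root_lim : clim \oo (fun n => N n * (1 - cexp (L / N n))) (- L).
Proof.
apply: (clim_squeeze (e := fun n => 8 * cmod L ^+ 2 / n.+1%:R)).
  have := archi_boundP (mulr_ge0 (ler0n R 2) (cmod_ge0 L)).
  set K := Num.bound _ => hK; exists K => // n /= Kn.
  rewrite opprK; apply: near_root; apply: le_trans (ltW hK) _.
  by rewrite ler_nat (leq_trans Kn).
rewrite -[X in _ --> X](mulr0 (8 * cmod L ^+ 2)).
by apply: cvgMl_tmp; exact: cvg_harmonic.
Qed.

End Roots.

Lemma infdiv_char_pair mu : ~ eq_meas mu (haar R) -> boolean_infdiv mu ->
  exists b rho, characteristic_pair mu b rho.
Proof.
move=> muN div.
have [nu hnu] : exists nu : nat -> probability (S1 R) R, forall n z, cmod z < 1 ->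
    Ftr mu z = Ftr (nu n) z ^+ n.+1.
  have [nu hnu] := choice (fun n => div n.+1 isT).
  by exists nu => n z z1; exact: Ftr_boolean_power.
have z01 : cmod (0 : R[i]) < 1 by rewrite cmod0.
have F0 := Ftr0_neq0 muN hnu.
have [b b2 Fb] := polar_form F0; pose L := (ln (cmod (Ftr mu 0)))%:C + 'i%C * b%:C.
rewrite -/L in Fb.
have ReL : Re L <= 0.
  rewrite /L ReD ReM /= !mul0r mul1r oppr0 !addr0 ln_le0//; exact: cmod_Ftr.
have ImL : Im L = b by rewrite /L ImD ImM /= mul0r mul1r !add0r.
have Fn0 n : Ftr (nu n) 0 != 0 by have := F0; rewrite (hnu n)// expf_eq0.
(* A root of unity of order dividing [n + 1]: it leaves the power unchanged and selects at 0 the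
   root close to 1, without which [hn n 0] would not stay bounded. *)
pose c n := cexp (L / n.+1%:R) / Ftr (nu n) 0.
have cX n : c n ^+ n.+1 = 1.
  by rewrite /c exprMn exprVn cexp_root -hnu// -Fb mulfV.
have cm n : cmod (c n) = 1.
  by apply/eqP; rewrite -(@pexpr_eq1 _ _ n.+1) ?cmod_ge0// -cmodX cX cmod1.
pose hn n z := n.+1%:R * (1 - c n * Ftr (nu n) z).
have h0 n : hn n 0 = n.+1%:R * (1 - cexp (L / n.+1%:R)) by rewrite /hn /c divfK.
have dh n : disk_approx (hn n).
  apply: disk_approxZ; apply: disk_approxB; first exact: disk_approx_cst.
  by apply: disk_approxZ; exact: disk_approx_Ftr.
have reh n z : cmod z < 1 -> 0 <= Re (hn n z).
  move=> z1; rewrite /hn mulr_natl.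
  have -> x k : Re (x *+ k) = Re x *+ k :> R by elim: k => //= k IH; rewrite !mulrS ReD IH.
  rewrite mulrn_wge0// ReB subr_ge0; apply: le_trans (Re_le_cmod _) _.
  by rewrite cmodM cm mul1r; exact: cmod_Ftr.
have hM n : cmod (hn n 0) <= 5 * cmod L by rewrite h0; exact: cexp_root_bound.
have [U [UF Uoo]] := ex_ultrafilter_nat.
have [h [dh' hlim]] := herglotz_ultralimit UF dh reh hM.
have rehl z : cmod z < 1 -> 0 <= Re (h z).
  move=> z1; have [hr _] := hlim z z1; apply: (cvgr_to_ge hr).
  by apply: nearW => n; exact: reh.
have hl0 : h 0 = - L.
  apply: (clim_unique (hlim 0 z01)).
  apply: (clim_sub Uoo); have := cexp_root_lim L; apply: clim_near_eq.
  by apply: nearW => n; rewrite h0.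
have Fexp z : cmod z < 1 -> Ftr mu z = cexp (- h z).
  move=> z1; apply: (clim_unique (F := U) (u := fun n => cexp (- hn n z))); last first.
    by apply: clim_cexp; apply: climN; exact: hlim.
  (* Eventually bounds [hn n z] along [U], so [cexp_compound] compares [exp (- hn n z)] with
     [(1 - hn n z / (n + 1))^(n + 1)], which is [F_mu] for every [n]. *)
  pose B := cmod (h z) + 1.
  have B0 : 0 < B by rewrite /B ltr_wpDl ?cmod_ge0.
  have hB : \forall n \near U, cmod (hn n z) <= B.
    have := hlim z z1 => /clim_cmod hc.
    have := cvgr_le _ hc B; rewrite /B ltrDl; apply; exact: ltr01.
  apply: (clim_squeeze (e := fun n => 8 * B ^+ 2 * expR B / n.+1%:R)); last first.
    rewrite -[X in _ --> X](mulr0 (8 * B ^+ 2 * expR B)).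
    by apply: cvgMl_tmp => A /= hA; apply: Uoo; exact: cvg_harmonic.
  have hN : \forall n \near U, 2 * B <= n.+1%:R.
    apply: Uoo; have := archi_boundP (mulr_ge0 (ler0n R 2) (ltW B0)).
    set K := Num.bound _ => hK; exists K => // n /= Kn.
    by apply: le_trans (ltW hK) _; rewrite ler_nat (leq_trans Kn).
  apply: filterS2 hB hN => n h1 h2.
  have := @cexp_compound R (- hn n z) B n.+1; rewrite cmodN => /(_ h1 isT h2).
  rewrite (_ : 1 + _ / _ = c n * Ftr (nu n) z); last first.
    rewrite /hn -mulrN mulrAC mulfV ?mul1r; last by rewrite -cmod_eq0 cmod_nat pnatr_eq0.
    by rewrite opprB addrC subrK.
  by rewrite exprMn cX mul1r -hnu.
have [rho hrho] := herglotz_char dh' rehl.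
exists b, rho; split=> // z; rewrite norm_lt1 => z1.
rewrite F_transformE// hrho// Fexp//; congr cexp.
by rewrite hl0 ImN ImL rmorphN mulrN opprK opprD addrCA subrr addr0.
Qed.

End Forward.

(** * Laws from exponents, and uniqueness of the pair *)

Section Backward.
Variable R : realType.
Implicit Types (rho : {finite_measure set (S1 R) -> \bar R}) (z : R[i]) (u : R[i] -> R[i]).
Implicit Types (mu nu tau : probability (S1 R) R).

Lemma ReZ (t : R) z : Re (t%:C * z) = t * Re z.
Proof. by rewrite ReM /= mul0r subr0. Qed.

(** Matching [res0 = 1 / (1 - z F)] with [1 / (1 - K)] gives [z F = K]. The law is recovered from
    [z F], hence the restriction to [z != 0], which is all [boolean_conv_Ftr] asks for. *)
Lemma ex_law_cexp u : disk_approx u -> (forall z, cmod z < 1 -> Re (u z) <= 0) ->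
  exists sigma : probability (S1 R) R,
    forall z, cmod z < 1 -> z != 0 -> Ftr sigma z = cexp (u z).
Proof.
move=> du reu; pose K z := z * cexp (u z).
have Kz z : cmod z < 1 -> cmod (K z) <= cmod z.
  move=> z1; rewrite /K cmodM cmod_cexp ler_piMr ?cmod_ge0//.
  by rewrite -expR0 ler_expR reu.
have K1 z : cmod z < 1 -> cmod (K z) < 1 by move=> z1; exact: le_lt_trans (Kz z z1) z1.
pose h z := 2 * (1 - K z)^-1 - 1.
have h0 : h 0 = 1 by rewrite /h /K mul0r subr0 invr1 mulr1; ring.
have [rho hrho] : exists rho, forall z, cmod z < 1 -> h z = 2 * res0 rho z - (mass rho)%:C.
  apply: herglotz.
  - apply: disk_approxB; last exact: disk_approx_cst.
    apply: disk_approxZ; apply: disk_approx_geometric.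
      by apply: disk_approxM; [exact: disk_approx_id|exact: disk_approx_cexp].
    move=> r r01; exists r => // z zr; apply: (le_trans (Kz z _) zr).
    by case/andP: r01 => _; exact: le_lt_trans zr.
  (* [1 / (1 - K)] is the kernel at the point 1 of the circle. *)
  - move=> z z1; have := @Re_ker R (K z) (cis 0) (K1 z z1).
    rewrite /ker cval_cis /cisC cos0 sin0 (_ : 1 +i* 0 = 1 :> R[i])// (mul1r (K z)) => hk.
    by rewrite /h ReB mulr_natl mulr2n ReD (_ : Re 1 = 1)//; lra.
  - by rewrite h0.
have m1 : mass rho = 1.
  have := hrho 0; rewrite cmod0 h0 res0_0 => /(_ ltr01)/(congr1 (@complex.Re R)).
  by rewrite mulr_natl mulr2n addrK /= => <-.
have rT : rho setT = 1%E by rewrite -[LHS]fineK ?fin_num_measure// -[fine _]/(mass rho) m1.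
exists (prob_of_mass rT) => z z1 z0; apply: (mulfI z0).
have e : res0 (prob_of_mass rT) z = (1 - K z)^-1.
  have -> : res0 (prob_of_mass rT) z = res0 rho z by exact: eq_meas_cint.
  have := hrho z z1; rewrite /h m1 => /(congr1 (fun x => x + 1)); rewrite !subrK.
  by move/(mulfI _) => ->//; rewrite pnatr_eq0.
by rewrite zFtr// e invrK subKr.
Qed.

Lemma disk_approx_char_exponent b rho : disk_approx (char_exponent b rho).
Proof.
apply: (@disk_approx_ext _ (fun z => 'i%C * b%:C - (herglotz_fun rho z^*)^*)).
  by move=> z z1; rewrite char_exponentE.
apply: disk_approxB; first exact: disk_approx_cst.
apply: disk_approx_conj; apply: disk_approxB; last exact: disk_approx_cst.
by apply: disk_approxZ; exact: disk_approx_res0.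
Qed.

Lemma Re_char_exponent b rho z : cmod z < 1 ->
  Re (char_exponent b rho z) = - Re (herglotz_fun rho z^*).
Proof.
by move=> z1; rewrite char_exponentE// ReB ReM ReJ /= !mul0r mulr0 subrr sub0r.
Qed.

Lemma char_pair_infdiv mu b rho : characteristic_pair mu b rho -> boolean_infdiv mu.
Proof.
move=> [_ Fexp] [//|[|n]] _.
  by exists mu; apply: boolean_power1.
have n0 : (n.+2%:R : R[i]) != 0 by rewrite -cmod_eq0 cmod_nat pnatr_eq0.
pose v z : R[i] := char_exponent b rho z / n.+2%:R.
have Rev z : cmod z < 1 -> Re (v z) <= 0.
  move=> z1; have -> : v z = ((n.+2%:R)^-1)%:C * char_exponent b rho z.
    by rewrite /v mulrC fmorphV/= rmorph_nat.
  rewrite ReZ Re_char_exponent// mulrN oppr_le0 mulr_ge0 ?invr_ge0//.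
  by apply: Re_herglotz_fun; rewrite cmodJ.
have dv : disk_approx v.
  apply: (@disk_approx_ext _ (fun z => (n.+2%:R)^-1 * char_exponent b rho z)).
    by move=> z _; rewrite mulrC.
  by apply: disk_approxZ; exact: disk_approx_char_exponent.
have exs k : exists sigma : probability (S1 R) R,
    forall z, cmod z < 1 -> z != 0 -> Ftr sigma z = cexp (v z) ^+ k.
  have [|z z1|sigma hs] := @ex_law_cexp (fun z => k%:R * v z).
  - exact: disk_approxZ.
  - rewrite mulr_natl; elim: k => [|k IH]; first by rewrite mulr0n.
    by rewrite mulrS ReD; have := Rev z z1; lra.
  - by exists sigma => z z1 z0; rewrite hs// mulr_natl cexpMn.
have [sigma hs] := choice exs.
have chain k : boolean_power (sigma 1%N) k.+1 (sigma k.+1).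
  elim: k => [|k IH]; first exact: boolean_power1.
  apply: (boolean_powerS IH); apply: boolean_conv_Ftr => z z1 z0.
  by rewrite !hs// expr1 exprSr.
(* The last convolution is aimed at [mu] itself rather than at a constructed law with the same
   transform. *)
exists (sigma 1%N); apply: (boolean_powerS (chain n)).
apply: boolean_conv_Ftr => z z1 z0; rewrite !hs// expr1 -exprSr -cexpMn.
by rewrite -F_transformE// Fexp ?norm_lt1// -(mulr_natr (v z)) divfK.
Qed.

(** On the ray through [w] the equality of real parts is an identity of real power series in [t], so
    [Re (d k * w ^+ k) = 0] for every unimodular [w]. Taking [w = 1] and then [w ^+ k = i] kills
    both coordinates of [d k]. *)
Lemma herglotz_uniq rho1 rho2 : (forall z, cmod z < 1 ->
    Re (herglotz_fun rho1 z) = Re (herglotz_fun rho2 z)) -> eq_meas rho1 rho2.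
Proof.
move=> hre.
have m12 : mass rho1 = mass rho2.
  have := hre 0; rewrite cmod0 => /(_ ltr01).
  by rewrite /herglotz_fun !res0_0 !mulr_natl !mulr2n !addrK.
have hres z : cmod z < 1 -> Re (res0 rho1 z - res0 rho2 z) = 0.
  move=> z1; have := hre z z1; rewrite /herglotz_fun m12 !ReB !mulr_natl !mulr2n !ReD.
  by move=> h; lra.
pose d k := mom rho1 k - mom rho2 k.
have dM k : cmod (d k) <= 2 * mass rho1 + 2 * mass rho2.
  by apply: le_trans (cmodB _ _) _; rewrite lerD// mom_bound.
have key (w : R[i]) k : cmod w = 1 -> Re (d k * w ^+ k) = 0.
  move=> w1; have := @ps_uniq R (fun k => (Re (d k * w ^+ k))%:C) (2 * mass rho1 + 2 * mass rho2) 1.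
  move=> /(_ _ ltr01 _ k) h; apply: complexI; apply: h => [j|t t0 t1].
    by rewrite cmodR; apply: le_trans (Re_cmod _) _; rewrite cmodM cmodX w1 expr1n mulr1.
  have tw1 : cmod (w * t%:C) < 1 by rewrite cmodM w1 mul1r cmodR ger0_norm ?ltW.
  have [hr _] := climB (res0_ps rho1 tw1) (res0_ps rho2 tw1).
  rewrite hres// in hr; apply: (clim_near_eq eventually_filter _ (climR hr)); apply: nearW => n.
  rewrite /psum -sumrB Re_sum rmorph_sum; apply: eq_bigr => i _.
  rewrite -mulrBl -/(d i) exprMn mulrA -rmorphXn/= [_ * (_ ^+ _)%:C]mulrC ReZ.
  by rewrite rmorphM mulrC.
apply: mom_determines_measure => k; apply/eqP; rewrite -subr_eq0 -/(d k); apply/eqP.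
have [->|k0] := posnP k; first by rewrite /d !mom0 m12 subrr.
apply: complex_eq; first by have := key 1 k (cmod1 R); rewrite expr1n mulr1.
have := key (cisC (pi / 2 / k%:R)) k (cmod_cisC _).
rewrite cisCX [k%:R * _]mulrC divfK ?pnatr_eq0 -?lt0n// => h.
have : Re (d k * cisC (pi / 2)) = - Im (d k).
  by rewrite ReM /cisC /= cos_pihalf sin_pihalf mulr0 mulr1 sub0r.
by rewrite h => /esym/eqP; rewrite oppr_eq0 => /eqP.
Qed.

Lemma char_pair_uniq mu b1 b2 rho1 rho2 :
  characteristic_pair mu b1 rho1 -> characteristic_pair mu b2 rho2 ->
  b1 = b2 /\ eq_meas rho1 rho2.
Proof.
move=> [b1_2pi F1] [b2_2pi F2].
have e z : cmod z < 1 -> cexp (char_exponent b1 rho1 z) = cexp (char_exponent b2 rho2 z).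
  by move=> z1; rewrite -F1 -?F2// norm_lt1.
have e12 : eq_meas rho1 rho2.
  apply: herglotz_uniq => z z1; have zc1 : cmod z^* < 1 by rewrite cmodJ.
  have := congr1 (@cmod R) (e z^* zc1); rewrite !cmod_cexp => /expR_inj.
  by rewrite !Re_char_exponent// conjCK => /oppr_inj.
split=> //.
have eb : cisC b1 = cisC b2.
  have := e 0; rewrite cmod0 => /(_ ltr01).
  rewrite /char_exponent (eq_meas_cint _ e12) !cexpD => /(mulIf (cexp_neq0 _)).
  by rewrite !cexp_i.
have sub (x y : R) : 0 <= x < 2 * pi -> 0 <= y < 2 * pi -> cisC x = cisC y -> x <= y.
  move=> /andP[x0 x2] /andP[y0 y2] exy; rewrite leNgt; apply/negP => yx.
  have : cisC (x - y) != 1 by apply: cisC_neq1; apply/andP; split; lra.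
  rewrite -cexp_i rmorphB mulrBr cexpD cexp_i exy -cexp_i -cexpD subrr cexp0.
  by rewrite eqxx.
by apply/le_anti/andP; split; apply: sub.
Qed.

End Backward.

Theorem theorem3p6 (R : realType) (mu : probability (S1 R) R)
    (mu_neq_haar : ~ eq_meas mu (haar R)) :
  (boolean_infdiv mu <->
    exists (b : R) (rho : {finite_measure set (S1 R) -> \bar R}),
      characteristic_pair mu b rho) /\
  (forall (b1 b2 : R) (rho1 rho2 : {finite_measure set (S1 R) -> \bar R}),
    characteristic_pair mu b1 rho1 -> characteristic_pair mu b2 rho2 ->
    b1 = b2 /\ eq_meas rho1 rho2).
Proof.
split; last by move=> b1 b2 rho1 rho2; exact: char_pair_uniq.
by split=> [|[b [rho]]]; [exact: infdiv_char_pair|exact: char_pair_infdiv].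
Qed.
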